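(* The knot $8_{18}$ (the knot $8_{18}$ of Rolfsen's table, i.e. the closure of the 3-braid $(\sigma_1\sigma_2^{-1})^4$) is bipartite, i.e. it admits a matched diagram.
   Context: A knot is a smooth embedding of $S^1$ in $\mathbb{R}^3$, considered up to equivalence by orientation-preserving homeomorphisms of $\mathbb{R}^3$ and $S^1$. A matched diagram of a knot is a regular plane diagram whose crossings can be split into disjoint pairs, each pair being of the following form: inside a small disk containing exactly these two crossings, the diagram consists of two antiparallel oriented strands that make one full twist around each other (two consecutive crossings of the same sign). A knot is bipartite if it can be represented by a matched diagram. *)

(* Defs.v *)
From HB Require Import structures.
From mathcomp Require Import all_boot all_order all_algebra.
From mathcomp Require Import all_classical all_reals all_analysis.
From mathcomp Require Import zify ring lra.

Set Implicit Arguments.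
Unset Strict Implicit.
Unset Printing Implicit Defensive.

Import Order.TTheory GRing.Theory Num.Theory.
Import numFieldNormedType.Exports.

Local Open Scope ring_scope.
Local Open Scope classical_set_scope.

(* The circle is R / 2 pi Z: a closed curve is a 2 pi-periodic map on R, and
   an orientation-preserving homeomorphism of the circle is given by a lift,
   i.e. an increasing homeomorphism of R commuting with the translation by
   2 pi. *)
Definition same_param (R : realType) (s t : R) : Prop :=
  exists m : int, t = s + (pi *+ 2) *~ m.

Definition smooth (R : realType) (f : R -> R) : Prop :=
  forall (n : nat) (t : R), derivable (derive1n n f) t 1.

Record knot (R : realType) : Type := Knot {
  curve :> R -> 'rV[R]_3;
  knot_periodic : forall t, curve (t + pi *+ 2) = curve t;
  knot_smooth : forall i, smooth (fun t => curve t 0 i);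
  knot_immersion : forall t, exists i, derive1 (fun u => curve u 0 i) t != 0;
  knot_injective : forall s t, curve s = curve t -> same_param s t
}.

Section Equivalence.
Variable R : realType.

Definition homeomorphism (h : 'rV[R]_3 -> 'rV[R]_3) : Prop :=
  continuous h /\
  exists g : 'rV[R]_3 -> 'rV[R]_3, [/\ continuous g, cancel h g & cancel g h].

(* A homeomorphism h of R^3 preserves orientation when it has local degree 1.
   By connectedness it suffices to look at the origin, where this means that
   u |-> h u - h 0 is homotopic to the identity as a self-map of R^3 \ {0}. *)
Definition orientation_preserving (h : 'rV[R]_3 -> 'rV[R]_3) : Prop :=
  exists H : R * 'rV[R]_3 -> 'rV[R]_3,
    [/\ {within `[0, 1] `*` [set u | u != 0], continuous H},
        forall s u, 0 <= s <= 1 -> u != 0 -> H (s, u) != 0,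
        forall u, u != 0 -> H (0, u) = u &
        forall u, u != 0 -> H (1, u) = h u - h 0].

Definition circle_homeomorphism (phi : R -> R) : Prop :=
  [/\ continuous phi, {homo phi : s t / s < t} &
      forall t, phi (t + pi *+ 2) = phi t + pi *+ 2].

Definition knot_equiv (K L : knot R) : Prop :=
  exists (h : 'rV[R]_3 -> 'rV[R]_3) (phi : R -> R),
    [/\ homeomorphism h, orientation_preserving h, circle_homeomorphism phi &
        forall t, L (phi t) = h (K t)].

End Equivalence.

Section Diagrams.
Variable R : realType.
Implicit Type K : knot R.

Definition coord K (i : 'I_3) (t : R) : R := K t 0 i.

(* Diagrams are projections along the third coordinate axis, seen from above. *)
Definition shadow K (t : R) : 'rV[R]_2 :=
  \row_(i < 2) K t 0 (widen_ord (leqnSn 2) i).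

Definition height K (t : R) : R := coord K 2 t.

Definition velocity_det K (s t : R) : R :=
  derive1 (coord K 0) s * derive1 (coord K 1) t -
  derive1 (coord K 1) s * derive1 (coord K 0) t.

Definition crossing K (s t : R) : Prop :=
  ~ same_param s t /\ shadow K s = shadow K t.

Definition crossing_points K : set 'rV[R]_2 :=
  [set P | exists s t, crossing K s t /\ shadow K s = P].

Definition regular_diagram K : Prop :=
  [/\ forall t, derive1 (coord K 0) t != 0 \/ derive1 (coord K 1) t != 0,
      forall s t, crossing K s t -> velocity_det K s t != 0,
      forall s t u, crossing K s t -> crossing K t u -> same_param s u &
      finite_set (crossing_points K)].

(* The sign det(over, under); it is symmetric in s and t. *)
Definition crossing_sign K (s t : R) : R :=
  Num.sg ((height K s - height K t) * velocity_det K s t).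

Definition closed_disk : set 'rV[R]_2 :=
  [set u | u 0 0 ^+ 2 + u 0 1 ^+ 2 <= 1].
Definition open_disk : set 'rV[R]_2 :=
  [set u | u 0 0 ^+ 2 + u 0 1 ^+ 2 < 1].

(* An embedded disk, the image of e, cuts the diagram in the two strands
   [a, b] and [c, d]; they cross exactly at P and Q, with the same sign, and
   they meet P and Q in opposite orders, i.e. they are antiparallel.  Two
   strands crossing exactly twice in a disk have opposite det(first, second)
   at the two points, so that equal signs mean that the strand which is above
   at P is below at Q: the strands make a full twist. *)
Definition matched_pair K (P Q : 'rV[R]_2) : Prop :=
  exists (e : 'rV[R]_2 -> 'rV[R]_2) (a s1 s2 b c t1 t2 d : R),
    [/\ {within closed_disk, continuous e} /\ set_inj closed_disk e,
        [/\ a < s1, s1 < s2, s2 < b & b < c] /\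
        [/\ c < t1, t1 < t2, t2 < d & d < a + pi *+ 2],
        forall t, a <= t < a + pi *+ 2 ->
          ((e @` closed_disk) (shadow K t) <-> a <= t <= b \/ c <= t <= d) /\
          ((e @` open_disk) (shadow K t) <-> a < t < b \/ c < t < d),
        [/\ shadow K s1 = P, shadow K t2 = P, shadow K s2 = Q &
            shadow K t1 = Q] /\
        crossing_points K `&` e @` closed_disk = [set P; Q] &
        crossing_sign K s1 t2 = crossing_sign K s2 t1].

Definition matched_diagram K : Prop :=
  regular_diagram K /\
  exists ps : seq ('rV[R]_2 * 'rV[R]_2),
    [/\ uniq (unzip1 ps ++ unzip2 ps),
        crossing_points K = [set P | P \in unzip1 ps ++ unzip2 ps] &
        forall pq, pq \in ps -> matched_pair K pq.1 pq.2].

Definition bipartite K : Prop :=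
  exists L : knot R, knot_equiv K L /\ matched_diagram L.

End Diagrams.

Section ClosedBraids.
Variable R : realType.

Definition strand (n : nat) (theta : R) (j : nat) : R :=
  (theta + (pi *+ 2) *+ j) / n%:R.

(* A letter (p, true) stands for sigma_p, and (p, false) for its inverse. *)
Definition braid_word := seq (nat * bool).

(* At angle theta, the p-th and the (p+1)-th strands, counted from the axis,
   cross each other, and no other crossing occurs; the letter is positive when
   the strand moving away from the axis passes over.  The opposite sign
   convention would turn (sigma_1 sigma_2^-1)^4 into (sigma_1^-1 sigma_2)^4,
   which is conjugate to it in the braid group and has the same closure. *)
Definition letter_at (K : knot R) (n : nat) (r : R -> R) (theta : R)
    (l : nat * bool) : Prop :=
  let s (j : 'I_n) := strand n theta j in
  exists j k : 'I_n,
    [/\ r (s j) = r (s k) /\ derive1 r (s j) < 0 < derive1 r (s k),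
        forall i i', i != i' -> r (s i) = r (s i') ->
          [set i; i']%SET = [set j; k]%SET,
        #|[set i | r (s i) < r (s j)]%SET|.+1 = l.1,
        height K (s j) != height K (s k) &
        (height K (s j) < height K (s k)) = l.2].

(* K is the closure of the braid on n strands given by w: it turns n times
   around the third coordinate axis with constant angular velocity, so that its
   strands over the ray of angle theta are at the parameters strand n theta j,
   and the successive crossings, met when theta goes from 0 to 2 pi, spell w. *)
Definition is_braid_closure (n : nat) (w : braid_word) (K : knot R) : Prop :=
  exists r : R -> R,
    [/\ forall t, 0 < r t /\ derivable r t 1,
        forall t, coord K 0 t = r t * cos (t *+ n) /\
                  coord K 1 t = r t * sin (t *+ n) &
        exists thetas : seq R,
          [/\ size thetas = size w,
              sorted <%R thetas,
              forall theta, theta \in thetas = (0 <= theta < pi *+ 2) &&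
                `[< exists j k : 'I_n, j != k /\
                     r (strand n theta j) = r (strand n theta k) >] &
              forall i, (i < size w)%N ->
                letter_at K n r (nth 0 thetas i) (nth (0%N, true) w i)]].

End ClosedBraids.

Section TrigonometricPolynomials.
Variable R : realType.

Inductive trig : (R -> R) -> Prop :=
| trig_cst c : trig (fun=> c)
| trig_cos n : trig (fun t => cos (t *+ n))
| trig_sin n : trig (fun t => sin (t *+ n))
| trig_add f g : trig f -> trig g -> trig (fun t => f t + g t)
| trig_mul f g : trig f -> trig g -> trig (fun t => f t * g t).

Lemma is_derive_mulrn (n : nat) (t : R) :
  is_derive t (1 : R) (fun u : R => u *+ n) n%:R.
Proof.
have -> : (fun u : R => u *+ n) = n%:R \*: id.
  by apply/funext => u /=; rewrite scaler_nat.
have := @is_deriveZ R R^o R^o id n%:R t 1 1 (is_derive_id t (1:R^o)).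
by move=> d; apply: (is_derive_eq d); rewrite /GRing.scale /= mulr1.
Qed.

Lemma is_derive_cosn (n : nat) (t : R) :
  is_derive t (1 : R) (fun u => cos (u *+ n)) (- n%:R * sin (t *+ n)).
Proof.
have d1 := is_derive_mulrn n t.
have d2 := is_derive_cos (t *+ n).
have d := @is_derive1_comp R cos (fun u : R => u *+ n) t _ _ d2 d1.
by apply: (is_derive_eq d); rewrite mulrC mulNr mulrN.
Qed.

Lemma is_derive_sinn (n : nat) (t : R) :
  is_derive t (1 : R) (fun u => sin (u *+ n)) (n%:R * cos (t *+ n)).
Proof.
have d1 := is_derive_mulrn n t.
have d2 := is_derive_sin (t *+ n).
have d := @is_derive1_comp R sin (fun u : R => u *+ n) t _ _ d2 d1.
by apply: (is_derive_eq d); rewrite mulrC.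
Qed.

Lemma trig_derive f : trig f ->
  exists2 g, trig g & forall t, is_derive t (1 : R) f (g t).
Proof.
elim=> {f} [c|n|n|f g _ [f' tf' df] _ [g' tg' dg]|f g tf [f' tf' df] tg [g' tg' dg]].
- by exists (fun=> 0); [exact: trig_cst | move=> t; exact: is_derive_cst].
- exists (fun t => - n%:R * sin (t *+ n)); last exact: is_derive_cosn.
  exact: trig_mul (trig_cst _) (trig_sin _).
- exists (fun t => n%:R * cos (t *+ n)); last exact: is_derive_sinn.
  exact: trig_mul (trig_cst _) (trig_cos _).
- exists (fun t => f' t + g' t); first exact: trig_add.
  by move=> t; exact: is_deriveD.
- exists (fun t => f t * g' t + g t * f' t).
    by apply: trig_add; apply: trig_mul.
  by move=> t; exact: is_deriveM.
Qed.

Lemma trig_smooth f : trig f -> smooth f.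
Proof.
move=> tf n; suff: trig (derive1n n f).
  by case/trig_derive => g _ dg t; case: (dg t).
elim: n => [//|n]; rewrite derive1nS => /trig_derive[g tg dg].
suff -> : derive1 (derive1n n f) = g by [].
by apply/funext => t; rewrite derive1E; exact: derive_val.
Qed.

Lemma cos_sin_eq (x y : R) : cos x = cos y -> sin x = sin y -> same_param x y.
Proof.
move=> cxy sxy.
have {cxy sxy} cD : cos (y - x) = 1.
  by rewrite cosB cxy sxy -!expr2 cos2Dsin2.

have p0 : 0 < pi *+ 2 :> R by rewrite pmulrn_lgt0 // pi_gt0.
have cper (k : int) (z : R) : cos (z + (pi *+ 2) *~ k) = cos z.
  have pn (n : nat) w : cos (w + (pi *+ 2) *+ n) = cos w :> R.
    by rewrite (periodicn (@cosD2pi R)).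
  case: k => k; first exact: pn.
  by rewrite NegzE mulrNz -[LHS](pn k.+1) subrK.
pose m := Num.floor ((y - x) / (pi *+ 2)).
exists m; set z := y - x - (pi *+ 2) *~ m.
suff z0 : z = 0 by move: z0; rewrite /z; lra.
have cz : cos z = 1 by rewrite -cD -(cper m z) /z subrK.
have /andP[z_ge0 z_lt] : 0 <= z < pi *+ 2.
  have := floor_itv ((y - x) / (pi *+ 2)); rewrite -/m intrD.
  rewrite ler_pdivlMr // ltr_pdivrMr // mulrDl mul1r.
  by rewrite /z -(mulrzl _ m); lra.
have [zp|zp] := leP z pi.
  apply: cos_inj => //; rewrite ?in_itv /= ?cos0 ?lexx ?z_ge0 ?pi_ge0 //.
suff : pi *+ 2 - z = 0 by lra.
apply: cos_inj; rewrite ?in_itv /= ?lexx ?pi_ge0 //; first lra.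
by rewrite cos0 addrC cosD2pi cosN.
Qed.

Lemma trig_periodn (n : nat) (t : R) :
  cos ((t + pi *+ 2) *+ n) = cos (t *+ n) /\
  sin ((t + pi *+ 2) *+ n) = sin (t *+ n).
Proof.
by rewrite mulrnDl (periodicn (@cosD2pi R)) (periodicn (@sinD2pi R)).
Qed.

Lemma cos_triple (x : R) : cos (x *+ 3) = 4 * cos x ^+ 3 - 3 * cos x.
Proof.
have e := sin2cos2 x.
rewrite (mulrnDr _ 1 2) mulr1n cosD cos_mulr2n sin_mulr2n.
ring: e.
Qed.

Lemma sin_triple (x : R) : sin (x *+ 3) = 3 * sin x - 4 * sin x ^+ 3.
Proof.
have e := sin2cos2 x.
rewrite (mulrnDr _ 1 2) mulr1n sinD cos_mulr2n sin_mulr2n.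
ring: e.
Qed.

End TrigonometricPolynomials.

Section Knot818.
Variable R : realType.

(* The closure of the 3-braid (sigma_1 sigma_2^-1)^4: over the ray of angle
   theta the three strands have radii 2 + cos(a) and heights sin(2 a) for three
   phases a at distance 2 pi / 3 from each other, which turn at constant speed.
   Its braid word is computed in knot_8_18_closure below. *)
Definition radius_8_18 (t : R) : R := 2 + cos (t *+ 4).

Definition curve_8_18 (t : R) : 'rV[R]_3 :=
  \row_(i < 3) nth 0 [:: radius_8_18 t * cos (t *+ 3);
                         radius_8_18 t * sin (t *+ 3); sin (t *+ 8)] i.

Lemma radius_8_18_gt0 t : 0 < radius_8_18 t.
Proof. by have := cos_geN1 (t *+ 4); rewrite /radius_8_18; lra. Qed.

Lemma curve_8_18_periodic t : curve_8_18 (t + pi *+ 2) = curve_8_18 t.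
Proof.
rewrite /curve_8_18 /radius_8_18.
have [-> _] := trig_periodn 4 t; have [-> ->] := trig_periodn 3 t.
by have [_ ->] := trig_periodn 8 t.
Qed.

Lemma curve_8_18_smooth i : smooth (fun t : R => curve_8_18 t 0 i).
Proof.
apply: trig_smooth.
have tr : trig radius_8_18 by apply: trig_add; [exact: trig_cst | exact: trig_cos].
case: i => [[|[|[|//]]]] h; under eq_fun do rewrite mxE /=.
- exact: trig_mul tr (trig_cos _ _).
- exact: trig_mul tr (trig_sin _ _).
- exact: trig_sin.
Qed.

Lemma is_derive_radius t :
  is_derive t (1 : R) radius_8_18 (- 4 * sin (t *+ 4)).
Proof.
have d := is_deriveD (is_derive_cst (2 : R) t (1 : R)) (is_derive_cosn 4 t).
by apply: (is_derive_eq d); rewrite add0r.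
Qed.

Lemma curve_8_18_immersion (t : R) :
  exists i, derive1 (fun u : R => curve_8_18 u 0 i) t != 0.
Proof.
have dr := is_derive_radius t.
have d0 := is_deriveM dr (is_derive_cosn 3 t).
have d1 := is_deriveM dr (is_derive_sinn 3 t).
have [e|] := eqVneq (derive1 (fun u : R => curve_8_18 u 0 0) t) 0; last by exists 0.
exists 1; apply/eqP => e'; move: e e'.
under eq_fun do rewrite mxE /=.
under [in X in _ -> X -> _]eq_fun do rewrite mxE /=.
rewrite !derive1E !derive_val /GRing.scale /= => e e'.
have rt := radius_8_18_gt0 t.
have cs := cos2Dsin2 (t *+ 3).
have h := congr1 (fun z => cos (t *+ 3) * z) e'.
have h' := congr1 (fun z => sin (t *+ 3) * z) e.
have := congr1 (fun z => radius_8_18 t * z) cs.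
lra.
Qed.


Lemma radius_cos_sin (r r' x y : R) : 0 < r -> 0 < r' ->
  r * cos x = r' * cos y -> r * sin x = r' * sin y ->
  [/\ r = r', cos x = cos y & sin x = sin y].
Proof.
move=> r0 r0' ec es.
have e2 : r ^+ 2 = r' ^+ 2.
  rewrite -[LHS]mulr1 -[RHS]mulr1 -{1}(cos2Dsin2 x) -(cos2Dsin2 y).
  by rewrite !mulrDr -!exprMn ec es.
have er : r = r' by apply/eqP; rewrite -(eqrXn2 (n := 2)) ?ltW // e2.
by subst r'; split=> //; apply: (mulfI (lt0r_neq0 r0)).
Qed.

Lemma curve_8_18_injective (s t : R) : curve_8_18 s = curve_8_18 t -> same_param s t.
Proof.
move=> /rowP E.
have := E 0; have := E 1; have := E 2; rewrite !mxE /= => ez ey ex.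
have [er ec es] := radius_cos_sin (radius_8_18_gt0 s) (radius_8_18_gt0 t) ex ey.
have ec4 : cos (s *+ 4) = cos (t *+ 4) by move: er; rewrite /radius_8_18; lra.
pose d := t - s.
have c3 : cos (d *+ 3) = 1 by rewrite mulrnBl cosB ec es -!expr2 cos2Dsin2.
have s3 : sin (d *+ 3) = 0 by rewrite mulrnBl sinB ec es mulrC subrr.
have cd4 : cos (d *+ 4) = cos d.
  by rewrite (mulrnDr _ 1 3) mulr1n cosD c3 s3 mulr0 mulr1 subr0.
have sd4 : sin (d *+ 4) = sin d.
  by rewrite (mulrnDr _ 1 3) mulr1n sinD c3 s3 mulr0 mulr1 addr0.
have t4 : t *+ 4 = s *+ 4 + d *+ 4 by rewrite -mulrnDl /d addrC subrK.
have ect : cos (t *+ 4) = cos (s *+ 4) * cos d - sin (s *+ 4) * sin d.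
  by rewrite t4 cosD cd4 sd4.
have est : sin (t *+ 4) = sin (s *+ 4) * cos d + cos (s *+ 4) * sin d.
  by rewrite t4 sinD cd4 sd4.
have e8 : cos (s *+ 4) * sin (s *+ 4) = cos (t *+ 4) * sin (t *+ 4).
  have e2 (u : R) : u *+ 8 = u *+ 4 *+ 2 by rewrite -mulrnA.
  by move: ez; rewrite !e2 !sin_mulr2n; lra.
have : (cos d - 1) * (2 * cos d + 1) ^+ 2 = 0.
  by move: c3; rewrite cos_triple; lra.
move/eqP; rewrite mulf_eq0 sqrf_eq0 => /orP[/eqP cd1|/eqP cd].
  have {cd1} cd1 : cos d = 1 by lra.
  have sd0 : sin d = 0 by apply: cos1sin0; rewrite cd1 normr1.
  have ets : t = s + d by rewrite /d addrC subrK.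
  apply: cos_sin_eq; first by rewrite ets cosD cd1 sd0 mulr0 mulr1 subr0.
  by rewrite ets sinD cd1 sd0 mulr0 mulr1 addr0.
have {cd} cd : cos d = - (1 / 2) by lra.
have cs := cos2Dsin2 (s *+ 4).
have := cos2Dsin2 d; rewrite cd => sd.
move: ect est e8; rewrite -ec4 cd => ect -> e8.
set c := cos (s *+ 4) in cs ect e8; set u := sin (s *+ 4) in cs ect e8.
set S := sin d in sd ect e8.
have h1 : u * S = - (3 / 2) * c by lra.
have h2 : c * (c * S - 3 / 2 * u) = 0 by lra.
have h3 : c ^+ 2 = 0.
  have := congr1 (fun z => z * S) h2; rewrite mul0r.
  have := congr1 (fun z => c * z) h1; have := congr1 (fun z => c ^+ 2 * z) sd.
  by lra.
have c0 : c = 0 by apply/eqP; rewrite -sqrf_eq0 h3.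
have := congr1 (fun z => z * u ^+ 2) sd.
have := congr1 (fun z => z ^+ 2) h1; move: cs; rewrite c0; lra.
Qed.

Definition knot_8_18 : knot R :=
  Knot curve_8_18_periodic curve_8_18_smooth curve_8_18_immersion
       curve_8_18_injective.

End Knot818.

Section Knot818Closure.
Variable R : realType.

Lemma sqr_sqrt3 : Num.sqrt 3 ^+ 2 = 3 :> R.
Proof. by rewrite sqr_sqrtr. Qed.

Lemma sqrt3_gt0 : 0 < Num.sqrt 3 :> R.
Proof. by rewrite sqrtr_gt0. Qed.

Lemma cos_pi3 : cos (pi / 3) = 1 / 2 :> R.
Proof.
have p0 := pi_gt0 R.
have c3 : cos (pi / 3 *+ 3) = -1 :> R by rewrite -mulr_natr divfK // cospi.
have c0 : 0 < cos (pi / 3) :> R by apply: cos_gt0_pihalf; lra.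
have : (cos (pi / 3) + 1) * (2 * cos (pi / 3) - 1) ^+ 2 = 0 :> R.
  by move: c3; rewrite cos_triple; lra.
by move/eqP; rewrite mulf_eq0 sqrf_eq0 => /orP[] /eqP; lra.
Qed.

Lemma sin_pi3 : sin (pi / 3) = Num.sqrt 3 / 2 :> R.
Proof.
have p0 := pi_gt0 R; have q0 := sqrt3_gt0.
have s0 : 0 < sin (pi / 3) :> R by apply: sin_gt0_pi; lra.
apply/eqP; rewrite -(eqrXn2 (n := 2)) ?ltW ?divr_gt0 //.
by rewrite sin2cos2 cos_pi3 !expr_div_n sqr_sqrt3; apply/eqP; field.
Qed.

Let cos_table (n : nat) : R :=
  nth 0 [:: 1; 1 / 2; - (1 / 2); -1; - (1 / 2); 1 / 2] (n %% 6).
Let sin_table (n : nat) : R :=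
  let h := Num.sqrt 3 / 2 in nth 0 [:: 0; h; h; 0; - h; - h] (n %% 6).

Lemma cos_sin_table (n : nat) :
  cos ((pi / 3) *+ n) = cos_table n /\ sin ((pi / 3) *+ n) = sin_table n.
Proof.
have p6 : (pi / 3) *+ 6 = pi *+ 2 :> R by field.
rewrite {1 3}(divn_eq n 6) addnC mulrnDr mulnC mulrnA p6.
rewrite (periodicn (@cosD2pi R)) (periodicn (@sinD2pi R)).
rewrite /cos_table /sin_table.
have q := sqr_sqrt3; have := ltn_pmod n (isT : (0 < 6)%N).
elim: (n %% 6)%N => [_|m IH lm]; first by rewrite mulr0n cos0 sin0.
have [] := IH (ltnW lm).
rewrite mulrSr cosD sinD cos_pi3 sin_pi3 => -> ->.
by move: m lm {IH} => [|[|[|[|[|]]]]] //= _; split; lra.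
Qed.

Let angle (i : nat) : R := (pi / 4) *+ i.

Lemma strand_angle i j : strand 3 (angle i) j *+ 4 = (pi / 3) *+ (i + 8 * j).
Proof. by rewrite /strand /angle; field. Qed.

Lemma radius_angle i j :
  radius_8_18 (strand 3 (angle i) j) = 2 + cos_table (i + 8 * j).
Proof.
by rewrite /radius_8_18 strand_angle; have [-> _] := cos_sin_table (i + 8 * j).
Qed.

Lemma dradius_angle i j :
  derive1 (@radius_8_18 R) (strand 3 (angle i) j) = - 4 * sin_table (i + 8 * j).
Proof.
rewrite derive1E (@derive_val _ _ _ _ _ _ _ (is_derive_radius _)).
by rewrite strand_angle; have [_ ->] := cos_sin_table (i + 8 * j).
Qed.

Lemma height_angle i j :
  height (knot_8_18 R) (strand 3 (angle i) j) = sin_table ((i + 8 * j) * 2).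
Proof.
rewrite /height /coord /= mxE /= (mulrnA _ 4 2) strand_angle -mulrnA.
by have [_ ->] := cos_sin_table ((i + 8 * j) * 2).
Qed.

Lemma letter_at3 (K : knot R) (r : R -> R) (theta : R) (j k l : 'I_3) :
    let s (i : 'I_3) := strand 3 theta i in
    uniq [:: j; k; l] -> r (s j) = r (s k) -> r (s l) != r (s j) ->
    derive1 r (s j) < 0 < derive1 r (s k) ->
    height K (s j) != height K (s k) ->
  letter_at K 3 r theta
    (((r (s l) < r (s j))%R : nat).+1, height K (s j) < height K (s k)).
Proof.
move=> s u rjk rlj dr hjk; exists j, k.
have I3 (i : 'I_3) : [|| i == j, i == k | i == l].
  have c3 : #|[:: j; k; l]| = #|'I_3| by rewrite card_ord; apply/card_uniqP.
  by have := subset_cardP c3 (subset_predT _) i; rewrite !inE.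
split=> //.
- have nl (i : 'I_3) : r (s l) = r (s i) -> i == l.
    move=> e; case/or3P: (I3 i) => // /eqP ei; move/eqP: rlj; case.
      by rewrite e ei.
    by rewrite e ei -rjk.
  move=> i i' ii' e; have li : i != l.
    apply/eqP => il; move: e ii'; rewrite il => /nl /eqP ->.
    by rewrite eqxx.
  have li' : i' != l.
    apply/eqP => il; move: e ii'; rewrite il => /esym /nl /eqP ->.
    by rewrite eqxx.
  move: (I3 i) (I3 i') ii'; rewrite (negbTE li) (negbTE li') !orbF.
  case/orP=> /eqP ->; case/orP=> /eqP ->; rewrite ?eqxx => ii'.
  + by move: ii'.
  + reflexivity.
  + exact: finset.setUC.
  + by move: ii'.
- congr _.+1; case: ltP => lj.
    apply/eqP/cards1P; exists l; apply/setP => i; rewrite !inE.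
    case/or3P: (I3 i) => /eqP ->; rewrite -/(s _) ?eqxx ?lj -?rjk ?ltxx //.
    + by apply/esym/eqP => jl; move: rlj; rewrite jl eqxx.
    + by apply/esym/eqP => kl; move: rlj; rewrite rjk kl eqxx.
  apply/eqP; rewrite cards_eq0; apply/eqP/setP => i; rewrite !inE.
  case/or3P: (I3 i) => /eqP ->; rewrite -/(s _) -?rjk ?ltxx //.
  by apply/negbTE; rewrite -leNgt.
Qed.

Section Letters.
Variables (i : nat) (j k l : 'I_3).

Lemma letter_1 :
    ((i + 8 * j) %% 6 = 2)%N -> ((i + 8 * k) %% 6 = 4)%N ->
    ((i + 8 * l) %% 6 = 0)%N ->
  letter_at (knot_8_18 R) 3 (@radius_8_18 R) (angle i) (1%N, true).
Proof.
move=> hj hk hl; have q := sqrt3_gt0.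
have := @letter_at3 (knot_8_18 R) (@radius_8_18 R) (angle i) j k l; cbv zeta.
rewrite !radius_angle !dradius_angle !height_angle /cos_table /sin_table.
rewrite -!(modnMml (i + 8 * _)) hj hk hl /=.
have -> : (2 + 1 < 2 + - (1 / 2) :> R) = false by clear hj hk hl; lra.
have -> : (- (Num.sqrt 3 / 2) < Num.sqrt 3 / 2 :> R) = true by clear hj hk hl; lra.
apply; [|by []|clear hj hk hl; lra..].
have ne (a b : 'I_3) : ((i + 8 * a) %% 6 != (i + 8 * b) %% 6)%N -> a != b.
  by apply: contra_neq => ->.
by rewrite /= !inE negb_or !ne ?hj ?hk ?hl.
Qed.

Lemma letter_2 :
    ((i + 8 * j) %% 6 = 1)%N -> ((i + 8 * k) %% 6 = 5)%N ->
    ((i + 8 * l) %% 6 = 3)%N ->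
  letter_at (knot_8_18 R) 3 (@radius_8_18 R) (angle i) (2%N, false).
Proof.
move=> hj hk hl; have q := sqrt3_gt0.
have := @letter_at3 (knot_8_18 R) (@radius_8_18 R) (angle i) j k l; cbv zeta.
rewrite !radius_angle !dradius_angle !height_angle /cos_table /sin_table.
rewrite -!(modnMml (i + 8 * _)) hj hk hl /=.
have -> : (2 + - 1 < 2 + 1 / 2 :> R) = true by clear hj hk hl; lra.
have -> : (Num.sqrt 3 / 2 < - (Num.sqrt 3 / 2) :> R) = false by clear hj hk hl; lra.
apply; [|by []|clear hj hk hl; lra..].
have ne (a b : 'I_3) : ((i + 8 * a) %% 6 != (i + 8 * b) %% 6)%N -> a != b.
  by apply: contra_neq => ->.
by rewrite /= !inE negb_or !ne ?hj ?hk ?hl.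
Qed.

End Letters.

Lemma angle_crossing (theta : R) (j k : 'I_3) : 0 <= theta < pi *+ 2 ->
    j != k -> radius_8_18 (strand 3 theta j) = radius_8_18 (strand 3 theta k) ->
  theta \in mkseq angle 8.
Proof.
move=> /andP[th0 th1] jk; have p0 := pi_gt0 R.
pose x (i : nat) := strand 3 theta i *+ 4; rewrite /radius_8_18 -!/(x _) => e.
have {e} cxy : cos (x j) = cos (x k) by lra.
have s3 i : sin (x i *+ 3) = sin (theta *+ 4).
  have -> : x i *+ 3 = theta *+ 4 + (pi *+ 2) *+ (i * 4).
    by rewrite /x /strand; field.
  exact: (periodicn (@sinD2pi R)).
have /eqP : (sin (x j) - sin (x k)) * (sin (x j) + sin (x k)) = 0.
  have := sin2cos2 (x j); have := sin2cos2 (x k); rewrite cxy; lra.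
rewrite mulf_eq0 => /orP[/eqP sxy|/eqP sxy].
  have {sxy} /(cos_sin_eq cxy)[m xm] : sin (x j) = sin (x k) by lra.
  have : 4 * (k : nat)%:Z - 4 * (j : nat)%:Z = 3 * m.
    apply: (@intr_inj R); rewrite !(rmorphB, rmorphM) /=.
    apply: (mulfI (lt0r_neq0 p0)).
    move: xm; rewrite /x /strand -(mulrzl _ m).
    rewrite -(mulr_natl _ j) -(mulr_natl _ k); lra.
  by move: jk; case: j k {cxy xm} => [[|[|[|//]]] jh] [[|[|[|//]]] kh] //= _; lia.
have s4 : sin (theta *+ 4) = 0.
  have := s3 j; have := s3 k; rewrite !sin_triple.
  have -> : sin (x j) = - sin (x k) by lra.
  lra.
have [m tm] : same_param 0 (theta *+ 4 *+ 2).
  apply: cos_sin_eq; first by rewrite cos_mulr2n cos2sin2 s4 cos0; lra.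
  by rewrite sin_mulr2n s4 sin0 mulr0 mul0rn.
have {}tm : theta = pi / 4 * m%:~R.
  by move: tm; rewrite add0r -(mulrzl _ m); lra.
have m0 : (0 <= m)%R.
  by rewrite -(ler0z R) -(pmulr_rge0 _ (_ : 0 < pi / 4)) -?tm // divr_gt0.
case: m m0 tm => // m _ tm.
have m8 : (m < 8)%N.
  rewrite -(ltr_nat R) -(ltr_pM2l (_ : 0 < pi / 4)) ?divr_gt0 //.
  by move: th1; rewrite tm; lra.
by apply/mapP; exists m; rewrite ?mem_iota // tm /angle mulr_natr.
Qed.

Lemma knot_8_18_closure :
  is_braid_closure 3 (flatten (nseq 4 [:: (1%N, true); (2%N, false)]))
    (knot_8_18 R).
Proof.
have p0 := pi_gt0 R.
exists (@radius_8_18 R); split.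
- move=> t; split; first exact: radius_8_18_gt0.
  by case: (is_derive_radius t).
- by move=> t; rewrite /coord /= !mxE.
exists (mkseq angle 8).
pose o0 := @Ordinal 3 0 isT; pose o1 := @Ordinal 3 1 isT.
pose o2 := @Ordinal 3 2 isT.
have letters i : (i < 8)%N ->
    letter_at (knot_8_18 R) 3 (@radius_8_18 R) (angle i)
      (nth (0%N, true)
        (flatten (nseq 4 [:: (1%N, true); (2%N, false)])) i).
  case: i => [_|[_|[_|[_|[_|[_|[_|[_|//]]]]]]]].
  - exact: (@letter_1 0 o1 o2 o0).
  - exact: (@letter_2 1 o0 o2 o1).
  - exact: (@letter_1 2 o0 o1 o2).
  - exact: (@letter_2 3 o2 o1 o0).
  - exact: (@letter_1 4 o2 o0 o1).
  - exact: (@letter_2 5 o1 o0 o2).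
  - exact: (@letter_1 6 o1 o2 o0).
  - exact: (@letter_2 7 o0 o2 o1).
split.
- by [].
- rewrite /mkseq sorted_map; apply: (sub_sorted _ (iota_ltn_sorted 0 8)).
  by move=> m n mn; rewrite /= /angle ltr_pMn2l ?divr_gt0.
- move=> theta; apply/idP/andP => [/mapP[i]|[th /asboolP[j [k [jk e]]]]]; last first.
    exact: angle_crossing th jk e.
  rewrite mem_iota /= => i8 ->; split.
    rewrite mulrn_wge0 ?divr_ge0 ?ltW //=.
    have : (i%:R < 8%:R :> R) by rewrite ltr_nat.
    rewrite -(ltr_pM2l (_ : 0 < pi / 4)) ?divr_gt0 // mulr_natr /angle; lra.
  apply/asboolP; have [j [k [[e /andP[dj dk]] _ _ _ _]]] := letters i i8.
  exists j, k; split=> //; apply: contraTneq dj => ->.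
  by rewrite -leNgt ltW.
- by move=> i i8; rewrite nth_mkseq //; exact: letters.
Qed.

End Knot818Closure.

(* Main.v *)
(* A map g from the line to R^3 whose difference with f satisfies
   |(g - f) t - (g - f) s| <= k |f t - f s| with k < 1 is ambient isotopic to f:
   by McShane's theorem (g - f) o f^-1 extends to a k-Lipschitz map w of R^3,
   and id + s w, for 0 <= s <= 1, is an isotopy of homeomorphisms carrying f to
   f + s (g - f).  This criterion, iterated, carries the knot to a closed
   96-gon, then through a list of integral 96-gons to the polygon [target], and
   finally to the smooth knot obtained by rounding the corners of [target].
   For two polygons the criterion is bilinear on each pair of edges, so that it
   follows from inequalities at the four corners, which are certified by
   integral linear forms; all the certificates are checked by computation.  The
   intermediate polygons come from an approximate gradient flow of a knot
   energy, started at the closed braid and at a matched diagram with 12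
   crossings, which lead to the same minimum.  The conditions on the final
   diagram are integral inequalities too, since the crossings lie on straight
   parts and the disks of the clasps are round. *)
From Stdlib Require Import ZArith.
From HB Require Import structures.
Require Import Defs.
From mathcomp Require Import all_boot all_order all_algebra.
From mathcomp Require Import all_classical all_reals all_analysis.
From mathcomp Require Import zify ssrZ ring lra.

Set Implicit Arguments.
Unset Strict Implicit.
Unset Printing Implicit Defensive.

Import Order.TTheory GRing.Theory Num.Theory.
Import numFieldNormedType.Exports.

Local Open Scope ring_scope.
Local Open Scope classical_set_scope.
Delimit Scope Z_scope with bz.

(** All distances are taken in the sup norm of ['rV[R]_3]. Extending a map coordinate by coordinate
    then costs nothing, the dual norm is the sum of the absolute values, and every certificate is a
    comparison of integers. The delicate point is the passage from the braid to the first polygon.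
    Linear forms bound distances from below on polygons, not on smooth curves, so the criterion is
    established there from the polygon towards the curve and has to be reversed; the reversal goes
    through the midpoint of the two curves and asks for a constant below 2/3 instead of 1. The
    height of the braid is halved beforehand, which brings its second derivative below those of the
    horizontal coordinates. Parametrizations only change by scalings of the line: all polygons of
    the list have 96 vertices, reached at the integers, in the unit of length 1/80. Embeddedness of
    the final curve is not read off its diagram: it is inherited from [curve_8_18_injective] through
    the homeomorphism. Orientation comes from the injectivity of each stage of the isotopies. *)

Lemma pair_continuous (T U W : topologicalType) (f : T -> U) (g : T -> W) :
  continuous f -> continuous g -> continuous (fun x => (f x, g x)).
Proof. by move=> cf cg x; exact: (cvg_pair (cf x) (cg x)). Qed.

Lemma fst_continuous (T U : topologicalType) : continuous (@fst T U).
Proof. by move=> x; exact: cvg_fst. Qed.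

Lemma snd_continuous (T U : topologicalType) : continuous (@snd T U).
Proof. by move=> x; exact: cvg_snd. Qed.

(* Needed for row vectors to form a complete normed module. *)
HB.instance Definition _ (R : realType) (m n : nat) :=
  Uniform_isComplete.Build 'M[R]_(m, n) (@cauchy_cvg 'M[R]_(m, n)).

(** * Ambient isotopies from Lipschitz perturbations of a curve *)

Section LipschitzIsotopy.
Variable R : realType.
Notation V := 'rV[R]_3.

Lemma row_norm_le (u : V) (c : R) : 0 <= c ->
  (`|u| <= c) = [forall i, `|u 0 i| <= c].
Proof.
move=> c0; rewrite {1}/Num.norm /= mx_normrE; apply/bigmax_leP/forallP.
  by case=> _ h i; exact: (h (0, i) isT).
by move=> h; split=> // -[i j] _ /=; rewrite (ord1 i).
Qed.

Lemma row_coord_le (u : V) i : `|u 0 i| <= `|u|.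
Proof.
have := row_norm_le u (normr_ge0 u); rewrite lexx => /esym /forallP; exact.
Qed.

Definition lip_rel (k : R) (f g : R -> V) : Prop :=
  forall s t, `|(g t - f t) - (g s - f s)| <= k * `|f t - f s|.

(** Each coordinate is extended separately, as an infimum of cones of slope [k] with apexes over the
    points [f t]. As the norm is the sup of the coordinates, putting them together does not enlarge
    [k]. The point [x0] keeps the infima over nonempty sets. *)
Lemma mcshane (X : Type) (f : X -> V) (d : X -> V) (x0 : X) (k : R) : 0 <= k ->
    (forall s t, `|d t - d s| <= k * `|f t - f s|) ->
  exists w : V -> V, (forall t, w (f t) = d t) /\
    (forall x y, `|w x - w y| <= k * `|x - y|).
Proof.
move=> k0 lip.
have lipi i s t : d t 0 i - d s 0 i <= k * `|f t - f s|.
  apply: le_trans (lip s t); apply: le_trans (row_coord_le _ i).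
  by rewrite !mxE ler_norm.
pose S i x := [set d t 0 i + k * `|x - f t| | t in [set: X]].
have hinf i x : has_inf (S i x).
  split; first by exists (d x0 0 i + k * `|x - f x0|), x0.
  (* The downward cone over [f x0] lies below all the upward cones, by the Lipschitz bound and the
     triangle inequality. *)
  exists (d x0 0 i - k * `|x - f x0|) => _ [t _ <-].
  have h := lipi i t x0.
  have tri : `|f x0 - f t| <= `|x - f x0| + `|x - f t|.
    by rewrite (distrC x (f x0)); exact: ler_distD.
  have := ler_wpM2l k0 tri; lra.
pose w x : V := \row_i inf (S i x).
have wle i x y : w x 0 i <= w y 0 i + k * `|x - y|.
  rewrite !mxE -lerBlDr; apply: lb_le_inf; first by have [] := hinf i y.
  move=> _ [t _ <-]; rewrite lerBlDr.
  apply: le_trans (_ : d t 0 i + k * `|x - f t| <= _).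
    by apply: ge_inf; [have [] := hinf i x | exists t].
  rewrite -addrA lerD2l -mulrDr ler_wpM2l //.
  by rewrite [leRHS]addrC; exact: ler_distD.
exists w; split.
  move=> t; apply/rowP => i; rewrite mxE; apply/eqP; rewrite eq_le; apply/andP.
  split.
    apply: le_trans (_ : d t 0 i + k * `|f t - f t| <= _).
      by apply: ge_inf; [have [] := hinf i (f t) | exists t].
    by rewrite subrr normr0 mulr0 addr0.
  apply: lb_le_inf; first by have [] := hinf i (f t).
  by move=> _ [s _ <-]; rewrite -lerBlDl; exact: lipi.
move=> x y; rewrite row_norm_le ?mulr_ge0 //; apply/forallP => i.
rewrite ler_norml !mxE; apply/andP; split.
  by have := wle i y x; rewrite !mxE distrC; lra.
by have := wle i x y; rewrite !mxE; lra.
Qed.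

(** Of the stages of the isotopy only injectivity is recorded: this suffices for
    [ambient_orientation], and it is stable under composition without any control of the inverses in
    the time variable. *)
Definition ambient (h : V -> V) : Prop :=
  homeomorphism h /\
  exists F : R * V -> V,
    [/\ continuous F, forall s, 0 <= s <= 1 -> injective (fun u => F (s, u)),
        forall u, F (0, u) = u & forall u, F (1, u) = h u].

Lemma ambient_comp (g h : V -> V) :
  ambient g -> ambient h -> ambient (g \o h).
Proof.
move=> [[cg [g' [cg' gK g'K]]] [G [cG iG G0 G1]]].
move=> [[ch [h' [ch' hK h'K]]] [H [cH iH H0 H1]]].
split; first split.
- by move=> x; apply: (@continuous_comp _ _ _ h g); [exact: ch | exact: cg].
- exists (h' \o g'); split.
  + by move=> x; apply: (@continuous_comp _ _ _ g' h'); [exact: cg' | exact: ch'].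
  + move=> x; rewrite /= ?gK ?hK ?g'K ?h'K //.
  + move=> x; rewrite /= ?gK ?hK ?g'K ?h'K //.
- exists (fun p => G (p.1, H p)); split.
  + move=> p; apply: (@continuous_comp _ _ _ (fun p => (p.1, H p)) G); last exact: cG.
    by apply: pair_continuous; [exact: fst_continuous | exact: cH].
  + by move=> s s01; apply: inj_comp (iG s s01) (iH s s01).
  + by move=> u /=; rewrite H0 G0.
  + by move=> u /=; rewrite H1 G1.
Qed.

(** Once the track of the origin is subtracted, injectivity says that [F (s, u) - F (s, 0)] vanishes
    only at [u = 0], so that it is a homotopy in the complement of the origin. *)
Lemma ambient_orientation (h : V -> V) : ambient h -> orientation_preserving h.
Proof.
move=> [_ [F [cF iF F0 F1]]].
exists (fun p => F p - F (p.1, 0)); split.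
- apply: continuous_subspaceT => p; apply: continuousB; first exact: cF.
  apply: (@continuous_comp _ _ _ (fun p : R * V => (p.1, 0 : V)) F); last exact: cF.
  by apply: pair_continuous; [exact: fst_continuous | exact: cst_continuous].
- move=> s u s01; apply: contra => /=; rewrite subr_eq0 => /eqP e.
  by apply/eqP; apply: (iF s s01).
- by move=> u _ /=; rewrite !F0 subr0.
- by move=> u _ /=; rewrite !F1.
Qed.

Lemma lip_continuous (w : V -> V) (k : R) :
  (forall x y, `|w x - w y| <= k * `|x - y|) -> continuous w.
Proof.
move=> lip x; apply/(@cvgrPdist_lt _ _ _ (nbhs x) (nbhs_filter x)) => e e0.
have k1 : 0 < `|k| + 1 by rewrite ltr_wpDl.
have ek : 0 < e / (`|k| + 1) by rewrite divr_gt0.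
have h : nbhs x [set y | `|x - y| < e / (`|k| + 1)].
  by have := nbhsx_ballx x _ ek; rewrite -ball_normE.
apply: filterS h => y /= xy; apply: le_lt_trans (lip x y) _.
apply: le_lt_trans (_ : (`|k| + 1) * `|x - y| < _).
  by rewrite ler_wpM2r // (le_trans (ler_norm k)) // lerDl.
by rewrite mulrC -ltr_pdivlMr.
Qed.

(** The map [id + s w] multiplies distances by at least [1 - k]: hence injectivity for every [s],
    and a Lipschitz inverse for [s = 1]. A preimage of [y] is a fixed point of the contraction
    [x |-> y - w x]. *)
Lemma ambient_id_add (w : V -> V) (k : R) : 0 <= k < 1 ->
    (forall x y, `|w x - w y| <= k * `|x - y|) ->
  ambient (fun x => x + w x).
Proof.
move=> /andP[k0 k1] lip.
have cw := lip_continuous lip.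
have expand s x y : 0 <= s <= 1 ->
    (1 - k) * `|x - y| <= `|(x + s *: w x) - (y + s *: w y)|.
  move=> /andP[s0 s1].
  have -> : (x + s *: w x) - (y + s *: w y) = (x - y) + s *: (w x - w y).
    by rewrite opprD addrACA scalerBr.
  have := lerB_normD (x - y) (s *: (w x - w y)); apply: le_trans.
  rewrite mulrBl mul1r lerB // normrZ ger0_norm //.
  by apply: le_trans (lip x y); rewrite ler_piMl.
have inj s : 0 <= s <= 1 -> injective (fun u => u + s *: w u).
  move=> s01 x y e; apply/eqP; rewrite -subr_eq0 -normr_le0.
  have := expand s x y s01; rewrite e subrr normr0 => h.
  have k1' : 0 < 1 - k by rewrite subr_gt0.
  by rewrite -(ler_pM2l k1') mulr0.
have surj y : exists x, x + w x = y.
  pose f x := y - w x.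
  have fT : set_fun [set: V] [set: V] f by [].
  pose F := HB.pack_for {fun [set: V] >-> [set: V]} f (isFun.Build _ _ _ _ f fT).
  have cf : is_contraction F.
    exists (NngNum k0); split => //= -[a b] _ /=.
    by rewrite /f opprB addrC addrA subrK distrC lip.
  have [p _ e] := @banach_fixed_point R V _ F cf closedT (ex_intro _ 0 I).
  by exists p; rewrite {1}e /= /f subrK.
pose g y := projT1 (cid (surj y)).
have gK y : g y + w (g y) = y by rewrite /g; case: cid.
have inj1 : injective (fun u => u + w u).
  move=> x y e; apply: (inj 1); first by rewrite ler01 lexx.
  by rewrite /= !scale1r.
split; first split.
- by move=> x; apply: continuousD; [exact: cvg_id | exact: cw].
- exists g; split => //; last by move=> x; apply: inj1; rewrite gK.
  apply: (@lip_continuous _ (1 - k)^-1) => x y.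
  rewrite mulrC ler_pdivlMr ?subr_gt0 // mulrC.
  have := expand 1 (g x) (g y); rewrite !scale1r !gK; apply.
  by rewrite ler01 lexx.
- exists (fun p => p.2 + p.1 *: w p.2); split.
  + move=> p; apply: continuousD; first exact: snd_continuous.
    apply: continuousZ; first exact: fst_continuous.
    by apply: (@continuous_comp _ _ _ snd w); [exact: snd_continuous | exact: cw].
  + exact: inj.
  + by move=> u /=; rewrite scale0r addr0.
  + by move=> u /=; rewrite scale1r.
Qed.

Definition isotopic (f g : R -> V) : Prop :=
  exists2 h, ambient h & forall t, g t = h (f t).

Lemma isotopic_trans (f g h : R -> V) :
  isotopic f g -> isotopic g h -> isotopic f h.
Proof.
move=> [a aa fg] [b ab gh]; exists (b \o a); first exact: ambient_comp.
by move=> t; rewrite gh fg.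
Qed.

Lemma lip_isotopic (f g : R -> V) (k : R) : 0 <= k < 1 ->
  lip_rel k f g -> isotopic f g.
Proof.
move=> k01 fg; have /andP[k0 _] := k01.
have [w [wf lw]] := @mcshane R f (fun t => g t - f t) 0 k k0 fg.
exists (fun x => x + w x); first exact: ambient_id_add k01 lw.
by move=> t; rewrite wf addrC subrK.
Qed.

Lemma isotopic_knot_equiv (K L : knot R) : isotopic K L -> knot_equiv K L.
Proof.
move=> [h ah e]; exists h, id; split => //; first by case: ah.
- exact: ambient_orientation.
- by split => // t; exact: cvg_id.
Qed.

End LipschitzIsotopy.

(** * Integral polygons and certificates on pairs of edges *)

Section IntegerPoints.
Local Open Scope Z_scope.

Definition zpt := (Z * Z * Z)%type.

Definition zsub (p q : zpt) : zpt :=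
  let: (a, b, c) := p in let: (d, e, f) := q in (a - d, b - e, c - f).
Definition zdot (p q : zpt) : Z :=
  let: (a, b, c) := p in let: (d, e, f) := q in a * d + b * e + c * f.
Definition zsup (p : zpt) : Z :=
  let: (a, b, c) := p in Z.max (Z.abs a) (Z.max (Z.abs b) (Z.abs c)).
(** The dual norm of [zsup]: [zdot l v] is at most [zsum l * zsup v], so that a linear form divided
    by its [zsum] bounds the norm from below. *)
Definition zsum (p : zpt) : Z :=
  let: (a, b, c) := p in Z.abs a + (Z.abs b + Z.abs c).

(* The boolean connectives of MathComp are strict under [vm_compute]. *)
Fixpoint lazy_all (T : Type) (a : T -> bool) (s : seq T) : bool :=
  if s is x :: s' then if a x then lazy_all a s' else false else true.
Fixpoint lazy_has (T : Type) (a : T -> bool) (s : seq T) : bool :=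
  if s is x :: s' then if a x then true else lazy_has a s' else false.
Fixpoint pairs_all (T : Type) (a : T -> T -> bool) (s : seq T) : bool :=
  if s is x :: s' then if lazy_all (a x) s' then pairs_all a s' else false
  else true.

Lemma lazy_allP (T : Type) (a : T -> bool) s : lazy_all a s = all a s.
Proof. by elim: s => //= x s ->; case: (a x). Qed.

Lemma lazy_hasP (T : Type) (a : T -> bool) s : lazy_has a s = has a s.
Proof. by elim: s => //= x s ->; case: (a x). Qed.

Lemma pairs_allP (T : Type) (a : T -> T -> bool) (x0 : T) s : pairs_all a s ->
  forall i j, (i < j < size s)%N -> a (nth x0 s i) (nth x0 s j).
Proof.
elim: s => [_ i j|x s IH /=]; first by rewrite ltn0 andbF.
case: ifP => //; rewrite lazy_allP => /(all_nthP x0) ax /IH h [|i] [|j] //=.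
  exact: ax.
exact: h.
Qed.

(** The linear forms tried as certificates, each with its dual norm. The filter removes zero and the
    unit vectors, which [axes] already lists. *)
Definition directions : seq (zpt * Z) :=
  let r := [:: -3; -2; -1; 0; 1; 2; 3] in
  let axes := [:: (-1, 0, 0); (0, -1, 0); (0, 0, 1); (0, 0, -1); (0, 1, 0);
                  (1, 0, 0)] in
  [seq (l, zsum l) | l <- axes ++
     [seq l <- flatten [seq [seq (x, y, z) | y <- r, z <- r] | x <- r] | Z.ltb 1 (zsum l)]].

Definition edges (F : seq zpt) : seq (zpt * zpt) := zip F (rot 1 F).

End IntegerPoints.

Section Lerp.
Variable R : realType.
Notation V := 'rV[R]_3.

Definition lerp (p q : V) (t : R) : V := p + t *: (q - p).

Definition dotr (l u : V) : R := \sum_i l 0 i * u 0 i.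

Lemma dotrD l u v : dotr l (u + v) = dotr l u + dotr l v.
Proof. by rewrite -big_split; apply: eq_bigr => i _; rewrite !mxE mulrDr. Qed.

Lemma dotrZ l a u : dotr l (a *: u) = a * dotr l u.
Proof. by rewrite mulr_sumr; apply: eq_bigr => i _; rewrite !mxE mulrCA. Qed.

Lemma dotrN l u : dotr l (- u) = - dotr l u.
Proof. by rewrite -scaleN1r dotrZ mulN1r. Qed.

Lemma dotrB l u v : dotr l (u - v) = dotr l u - dotr l v.
Proof. by rewrite dotrD dotrN. Qed.

Lemma dotr_le (l u : V) : dotr l u <= (\sum_i `|l 0 i|) * `|u|.
Proof.
rewrite mulr_suml; apply: ler_sum => i _; apply: le_trans (ler_norm _) _.
by rewrite normrM ler_wpM2l // row_coord_le.
Qed.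

(* The bound is bilinear in [(s, t)], hence follows from the four corners. *)
Lemma lerp_lip (p0 p1 q0 q1 a0 a1 b0 b1 l : V) (W k s t : R) :
    0 <= s <= 1 -> 0 <= t <= 1 -> 0 < W -> \sum_i `|l 0 i| <= W -> 0 <= k ->
    W * `|b0 - a0| <= k * dotr l (q0 - p0) ->
    W * `|b1 - a0| <= k * dotr l (q1 - p0) ->
    W * `|b0 - a1| <= k * dotr l (q0 - p1) ->
    W * `|b1 - a1| <= k * dotr l (q1 - p1) ->
  `|lerp b0 b1 t - lerp a0 a1 s| <= k * `|lerp q0 q1 t - lerp p0 p1 s|.
Proof.
move=> /andP[s0 s1] /andP[t0 t1] W0 lW k0 h00 h10 h01 h11.
have split4 (x0 x1 y0 y1 : V) : lerp y0 y1 t - lerp x0 x1 s =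
    ((1 - s) * (1 - t)) *: (y0 - x0) + ((1 - s) * t) *: (y1 - x0) +
    ((s * (1 - t)) *: (y0 - x1) + (s * t) *: (y1 - x1)).
  by apply/rowP => i; rewrite !mxE; ring.
rewrite -(ler_pM2l W0) mulrCA.
apply: le_trans (_ : k * dotr l (lerp q0 q1 t - lerp p0 p1 s) <= _); last first.
  rewrite ler_wpM2l //; apply: le_trans (dotr_le _ _) _.
  by rewrite ler_wpM2r.
rewrite !split4 !dotrD !dotrZ.
have c00 : 0 <= (1 - s) * (1 - t) by rewrite mulr_ge0 ?subr_ge0.
have c10 : 0 <= (1 - s) * t by rewrite mulr_ge0 ?subr_ge0.
have c01 : 0 <= s * (1 - t) by rewrite mulr_ge0 ?subr_ge0.
have c11 : 0 <= s * t by rewrite mulr_ge0.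
set A := _ *: (b0 - a0); set B := _ *: (b1 - a0); set C := _ *: (b0 - a1).
set D := _ *: (b1 - a1).
have : W * `|A + B + (C + D)| <= W * (`|A| + `|B| + (`|C| + `|D|)).
  rewrite ler_pM2l //; apply: le_trans (ler_normD _ _) _.
  by rewrite lerD // ler_normD.
move=> /le_trans; apply; rewrite !normrZ !ger0_norm ?subr_ge0 //.
have := ler_wpM2l c00 h00; have := ler_wpM2l c10 h10.
have := ler_wpM2l c01 h01; have := ler_wpM2l c11 h11; lra.
Qed.

End Lerp.

Section Real_of_Z.
Variable R : realType.

Definition zr (z : Z) : R := (int_of_Z z)%:~R.

Lemma zrD (x y : Z) : zr (x + y)%bz = zr x + zr y.
Proof. by rewrite /zr -intrD; congr _%:~R; lia. Qed.

Lemma zrN (x : Z) : zr (- x)%bz = - zr x.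
Proof. by rewrite /zr -mulrNz; congr _%:~R; lia. Qed.

Lemma zrB (x y : Z) : zr (x - y)%bz = zr x - zr y.
Proof. by rewrite /zr -intrB; congr _%:~R; lia. Qed.

Lemma zrM (x y : Z) : zr (x * y)%bz = zr x * zr y.
Proof. by rewrite /zr -intrM; congr _%:~R; lia. Qed.

Lemma zr_le (x y : Z) : (x <=? y)%bz = (zr x <= zr y).
Proof. by rewrite /zr ler_int; lia. Qed.

Lemma zr_lt (x y : Z) : (x <? y)%bz = (zr x < zr y).
Proof. by rewrite /zr ltr_int; lia. Qed.

Lemma zr_abs (x : Z) : zr (Z.abs x) = `|zr x|.
Proof. by rewrite /zr -intr_norm; congr _%:~R; lia. Qed.

Lemma zr_max (x y : Z) : zr (Z.max x y) = Num.max (zr x) (zr y).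
Proof.
rewrite /Num.max -zr_lt; case: ifP => h; congr zr; lia.
Qed.

Definition zvec (u : R) (p : zpt) : 'rV[R]_3 :=
  let: (a, b, c) := p in \row_(i < 3) (u * nth 0 [:: zr a; zr b; zr c] i).

Lemma zvecB u p q : zvec u (zsub p q) = zvec u p - zvec u q.
Proof.
case: p q => [[a b] c] [[d e] f]; apply/rowP => i; rewrite !mxE -mulrBr.
by congr (_ * _); case: i => [[|[|[|]]]] //= _; rewrite zrB.
Qed.

Lemma zvec_norm u p : 0 <= u -> `|zvec u p| = u * zr (zsup p).
Proof.
move=> u0; case: p => [[a b] c]; rewrite /zsup !zr_max !zr_abs.
apply/eqP; rewrite eq_le; apply/andP; split.
  rewrite row_norm_le ?mulr_ge0 // ?le_max ?normr_ge0 //.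
  apply/forallP => -[[|[|[|//]]] h]; rewrite mxE /= normrM (ger0_norm u0).
  - by rewrite ler_wpM2l // le_max lexx.
  - by rewrite ler_wpM2l // !le_max lexx orbT.
  - by rewrite ler_wpM2l // !le_max lexx !orbT.
have h i := row_coord_le (zvec u (a, b, c)) i.
have := h 0; have := h 1; have := h 2.
rewrite !mxE /= !normrM !(ger0_norm u0) => h2 h1 h0.
by rewrite /Num.max; case: ifP => _; [case: ifP|].
Qed.

Lemma zvec_dot u l p : dotr (zvec 1 l) (zvec u p) = u * zr (zdot l p).
Proof.
case: l p => [[a b] c] [[d e] f].
rewrite /dotr !big_ord_recl big_ord0 !mxE /= !zrD !zrM; ring.
Qed.

Lemma zvec_sum l : \sum_i `|zvec 1 l 0 i| = zr (zsum l).
Proof.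
case: l => [[a b] c].
rewrite !big_ord_recl big_ord0 !mxE /= !zrD !zr_abs !mul1r; ring.
Qed.

End Real_of_Z.

Section Polygons.
Variable R : realType.
Notation V := 'rV[R]_3.

Definition zmod_nat (n : nat) (i : int) : nat := absz (modz i n).

Lemma zmod_natE n i : (0 < n)%N -> zmod_nat n i = modz i n :> int.
Proof. by move=> n0; rewrite /zmod_nat gez0_abs // modz_ge0 // -lt0n. Qed.

Lemma zmod_nat_lt n i : (0 < n)%N -> (zmod_nat n i < n)%N.
Proof. by move=> n0; rewrite -ltz_nat zmod_natE // ltz_pmod. Qed.

Lemma zmod_natS n i : (0 < n)%N ->
  zmod_nat n (i + 1) = ((zmod_nat n i).+1 %% n)%N.
Proof.
move=> n0; apply/eqP; rewrite -eqz_nat -modz_nat zmod_natE // -addn1 PoszD.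
by rewrite zmod_natE // modzDml.
Qed.

Definition vertex (F : seq zpt) (i : int) : zpt :=
  nth (0, 0, 0)%bz F (zmod_nat (size F) i).

(* The closed polygon [F], scaled by [u]; its edges are run through over the
   intervals [i, i + 1]. *)
Definition polygon (u : R) (F : seq zpt) (x : R) : V :=
  let i := Num.floor x in
  lerp (zvec u (vertex F i)) (zvec u (vertex F (i + 1))) (x - i%:~R).

Definition p0 : zpt := (0, 0, 0)%bz.

Definition pvertex (F : seq zpt) (a : nat) : zpt := nth p0 F a.
Definition nvertex (F : seq zpt) (a : nat) : zpt := nth p0 F (a.+1 %% size F).

Lemma nth_edges F a : (a < size F)%N ->
  nth (p0, p0) (edges F) a = (pvertex F a, nvertex F a).
Proof.
move=> aF; rewrite /edges nth_zip ?size_rot //; congr (_, _).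
rewrite /nvertex; case: F aF => [//|x s] aF; rewrite rot1_cons nth_rcons.
move: aF; rewrite /= ltnS leq_eqVlt => /orP[/eqP ->|h].
  by rewrite ltnn eqxx modnn.
by rewrite h modn_small.
Qed.

Lemma frac_itv (x : R) : 0 <= x - (Num.floor x)%:~R <= 1.
Proof.
have /andP[h1 h2] := floor_itv x; rewrite subr_ge0 h1 /=.
by rewrite lerBlDl -[X in _ + X]/(1%:~R) -intrD ltW.
Qed.

Lemma polygonE u F x (a := zmod_nat (size F) (Num.floor x)) : (0 < size F)%N ->
  polygon u F x =
    lerp (zvec u (pvertex F a)) (zvec u (nvertex F a)) (x - (Num.floor x)%:~R).
Proof. by move=> F0; rewrite /polygon /vertex zmod_natS. Qed.

End Polygons.

Section PolygonStep.
Variable R : realType.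
Notation V := 'rV[R]_3.

(* The corners of a pair of edges of a polygon [A], with the bounds of the
   relative displacements towards the polygon [B], for [k = 49/50]. *)
Definition corner (x y : zpt * zpt) : zpt * Z :=
  (zsub y.1 x.1, 50 * zsup (zsub y.2 x.2))%bz.

Definition corner_ok (lw : zpt * Z) (g : zpt * Z) : bool :=
  (lw.2 * g.2 <=? 49 * zdot lw.1 g.1)%bz.

(** One linear form has to serve the four corners. Adjacent edges are no exception: at their common
    vertex both the difference and the relative displacement are zero, and the test reads
    [0 <= 0]. *)
Definition pair_ok (e f : (zpt * zpt) * (zpt * zpt)) : bool :=
  let g00 := corner e.1 f.1 in let g10 := corner e.1 f.2 in
  let g01 := corner e.2 f.1 in let g11 := corner e.2 f.2 in
  lazy_has (fun lw => if corner_ok lw g00 then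
                      if corner_ok lw g10 then
                      if corner_ok lw g01 then corner_ok lw g11
                      else false else false else false) directions.

(** Two points of one edge differ by a multiple of the edge, and their displacements by the same
    multiple of the difference of the end displacements, so that norms are compared without any
    linear form. *)
Definition edge_ok (e : (zpt * zpt) * (zpt * zpt)) : bool :=
  (50 * zsup (zsub e.2.2 e.1.2) <=? 49 * zsup (zsub e.2.1 e.1.1))%bz.

Definition moving_edges (A B : seq zpt) :=
  let d := [seq (x.1, zsub x.2 x.1) | x <- zip A B] in zip d (rot 1 d).

Definition step_ok (A B : seq zpt) : bool :=
  let e := moving_edges A B in
  if lazy_all edge_ok e then pairs_all pair_ok e else false.

Definition steps_ok (n : nat) (A : seq zpt) (s : seq (seq zpt)) : bool :=
  (fix loop A s := if s is B :: s' then
     if size B == n then if step_ok A B then loop B s' else false else false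
     else true) A s.

Lemma directionsP lw : lw \in directions -> lw.2 = zsum lw.1 /\ (0 <? zsum lw.1)%bz.
Proof.
move=> /mapP[l ll ->]; split=> //; move: l ll; apply/allP.
by vm_compute.
Qed.

End PolygonStep.

Section PolygonStepSound.
Variable R : realType.
Variables (u : R) (u0 : 0 < u).
Notation V := 'rV[R]_3.

Lemma zsup_norm (p : zpt) (a b : Z) :
  (b * zsup p <=? a)%bz -> zr R b * `|zvec u p| <= u * zr R a.
Proof.
by rewrite (zr_le R) zrM (zvec_norm _ (ltW u0)) mulrCA ler_pM2l.
Qed.

Lemma corner_okP (lw : zpt * Z) (x y : zpt * zpt) : lw.2 = zsum lw.1 ->
    corner_ok lw (corner x y) ->
  zr R (zsum lw.1) * `|zvec u y.2 - zvec u x.2| <=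
    49 / 50 * dotr (zvec 1 lw.1) (zvec u y.1 - zvec u x.1).
Proof.
move=> e; rewrite /corner_ok e -!zvecB zvec_dot [(_ * (50 * _))%bz]BinInt.Z.mul_assoc.
move=> /zsup_norm; rewrite !zrM.
have -> : zr R 50 = 50 by rewrite /zr.
have -> : zr R 49 = 49 by rewrite /zr.
by lra.
Qed.

Lemma pair_okP e f s t : pair_ok e f -> 0 <= s <= 1 -> 0 <= t <= 1 ->
  `|lerp (zvec u f.1.2) (zvec u f.2.2) t - lerp (zvec u e.1.2) (zvec u e.2.2) s|
   <= 49 / 50 *
  `|lerp (zvec u f.1.1) (zvec u f.2.1) t - lerp (zvec u e.1.1) (zvec u e.2.1) s|.
Proof.
rewrite /pair_ok lazy_hasP => /hasP[lw /directionsP[lw2 lw0]].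
do 3!case: ifP => //; move=> h01 h10 h00 h11 s01 t01.
apply: (@lerp_lip _ _ _ _ _ _ _ _ _ (zvec 1 lw.1) (zr R (zsum lw.1))) => //.
- by move: lw0; rewrite (zr_lt R).
- by rewrite zvec_sum.
- exact: corner_okP.
- exact: corner_okP.
- exact: corner_okP.
- exact: corner_okP.
Qed.

Lemma edge_okP e s t : edge_ok e ->
  `|lerp (zvec u e.1.2) (zvec u e.2.2) t - lerp (zvec u e.1.2) (zvec u e.2.2) s|
   <= 49 / 50 *
  `|lerp (zvec u e.1.1) (zvec u e.2.1) t - lerp (zvec u e.1.1) (zvec u e.2.1) s|.
Proof.
have lerpB (p q : V) : lerp p q t - lerp p q s = (t - s) *: (q - p).
  by apply/rowP => i; rewrite !mxE; ring.
rewrite !lerpB !normrZ -!zvecB /edge_ok (zr_le R) !zrM !(zvec_norm _ (ltW u0)).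
have -> : zr R 50 = 50 by rewrite /zr.
have -> : zr R 49 = 49 by rewrite /zr.
have tu : 0 <= `|t - s| * u by rewrite mulr_ge0 // ltW.
by move=> /(ler_wpM2l tu); lra.
Qed.

Lemma nth_moving_edges (A B : seq zpt) a : size B = size A -> (a < size A)%N ->
  nth ((p0, p0), (p0, p0)) (moving_edges A B) a =
   ((pvertex A a, zsub (pvertex B a) (pvertex A a)),
    (nvertex A a, zsub (nvertex B a) (nvertex A a))).
Proof.
move=> sAB aA; rewrite /moving_edges; set d := map _ _.
have sd : size d = size A by rewrite size_map size_zip sAB minnn.
have nd i : (i < size A)%N ->
    nth (p0, p0) d i = (pvertex A i, zsub (pvertex B i) (pvertex A i)).
  by move=> iA; rewrite (nth_map (p0, p0)) ?size_zip ?sAB ?minnn // nth_zip.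
rewrite nth_zip ?size_rot // nd //; congr (_, _).
have A0 : (0 < size A)%N by apply: leq_ltn_trans aA.
rewrite /nvertex sAB -nd ?ltn_mod // -sd.
move: aA; rewrite -sd; case: d {sd nd} => [//|x s] aF.
rewrite rot1_cons nth_rcons; move: aF; rewrite /= ltnS leq_eqVlt.
case/orP => [/eqP ->|h]; first by rewrite ltnn eqxx modnn.
by rewrite h modn_small.
Qed.

Lemma zvec_lerpB p q p' q' t :
  lerp (zvec u p') (zvec u q') t - lerp (zvec u p) (zvec u q) t =
  lerp (zvec u (zsub p' p)) (zvec u (zsub q' q)) t.
Proof. by rewrite !zvecB; apply/rowP => i; rewrite !mxE; ring. Qed.

Lemma step_lip (A B : seq zpt) : size B = size A -> (0 < size A)%N ->
  step_ok A B -> lip_rel (49 / 50) (polygon u A) (polygon u B).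
Proof.
move=> sAB A0; rewrite /step_ok; case: ifP => // he hp s t.
have B0 : (0 < size B)%N by rewrite sAB.
rewrite !polygonE // sAB !zvec_lerpB.
set a := zmod_nat _ (Num.floor s); set b := zmod_nat _ (Num.floor t).
have al : (a < size A)%N by exact: zmod_nat_lt.
have bl : (b < size A)%N by exact: zmod_nat_lt.
have sm : size (moving_edges A B) = size A.
  by rewrite size_zip size_rot size_map size_zip sAB !minnn.
have [s01 t01] := (frac_itv s, frac_itv t).
move: s01 t01; set x := s - _; set y := t - _ => x01 y01.
have na := nth_moving_edges sAB al; have nb := nth_moving_edges sAB bl.
have pr i j : (i < j < size A)%N ->
    pair_ok (nth ((p0, p0), (p0, p0)) (moving_edges A B) i)
            (nth ((p0, p0), (p0, p0)) (moving_edges A B) j).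
  by move=> ij; apply: pairs_allP hp _ _ _; rewrite sm.
(* [pairs_all] only tests pairs of increasing indices; the other order follows by exchanging the two
   points. *)
case: (ltngtP a b) => [ab|ba|e].
- have /pr := (introT andP (conj ab bl)).
  by rewrite na nb => /pair_okP; apply.
- have /pr := (introT andP (conj ba al)).
  rewrite na nb => /pair_okP h; rewrite distrC [X in _ <= _ * X]distrC.
  exact: h.
- rewrite -e.
  have : edge_ok (nth ((p0, p0), (p0, p0)) (moving_edges A B) a).
    by move: he; rewrite lazy_allP => /all_nthP; apply; rewrite sm.
  by rewrite na => /edge_okP; apply.
Qed.

Lemma steps_isotopic (A : seq zpt) (s : seq (seq zpt)) : (0 < size A)%N ->
    steps_ok (size A) A s ->
  isotopic (polygon u A) (polygon u (last A s)).
Proof.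
move=> A0; set n := size A; have : size A = n by []; move: n => n sA.
elim: s A A0 sA => [|B s IH] A A0 sA /=.
  move=> _; exists id => //; split.
    by split; [move=> x; exact: cvg_id | exists id; split=> // x; exact: cvg_id].
  exists (@snd R V); split.
  + exact: snd_continuous.
  + by move=> x _ a b.
  + by [].
  + by [].
case: ifP => // /eqP sB; case: ifP => // hs h.
have k01 : 0 <= (49 / 50 : R) < 1 by apply/andP; split; lra.
have AB := step_lip (etrans sB (esym sA)) A0 hs.
apply: isotopic_trans (@lip_isotopic _ _ _ _ k01 AB) _.
by apply: IH h; rewrite ?sB // -sA.
Qed.

End PolygonStepSound.

(** * Smooth functions: flat functions, a smooth step and its integral *)

Section FlatFunctions.
Variable R : realType.

(** For a power, [y / n <= 1 + y / n <= exp (y / n)], raised to the power [n]; the coefficients then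
    add up. *)
Lemma poly_le_exp (p : {poly R}) :
  exists2 C, 0 <= C & forall y, 0 <= y -> `|p.[y]| <= C * expR y.
Proof.
have pow (n : nat) (y : R) : 0 <= y -> y ^+ n <= n%:R ^+ n * expR y.
  case: n => [|n] y0; first by rewrite !expr0 mul1r -expR0 ler_expR.
  have n0 : 0 < n.+1%:R :> R by [].
  have -> : y = n.+1%:R * (y / n.+1%:R) by rewrite mulrCA mulfV ?mulr1 ?gt_eqF.
  rewrite expRM_natl exprMn ler_wpM2l ?exprn_ge0 // lerXn2r ?nnegrE ?divr_ge0 ?expR_ge0 //.
  by apply: le_trans (expR_ge1Dx _); rewrite lerDr.
exists (\sum_(i < size p) `|p`_i| * i%:R ^+ i).
  by apply: sumr_ge0 => i _; rewrite mulr_ge0 ?exprn_ge0.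
move=> y y0; rewrite horner_coef mulr_suml.
apply: le_trans (ler_norm_sum _ _ _) _; apply: ler_sum => i _.
rewrite normrM -mulrA ler_wpM2l // ger0_norm ?exprn_ge0 //; exact: pow.
Qed.

(* The functions P(1/x) exp(-1/x), extended by 0 to x <= 0, are stable under
   derivation. *)
Definition flat (p : {poly R}) (x : R) : R :=
  if 0 < x then p.[x^-1] * expR (- x^-1) else 0.

Lemma flat_gt0 p x : 0 < x -> flat p x = p.[x^-1] * expR (- x^-1).
Proof. by rewrite /flat => ->. Qed.

Lemma flat_le0 p x : x <= 0 -> flat p x = 0.
Proof. by rewrite /flat leNgt => /negbTE ->. Qed.

(** The bound of [poly_le_exp] for ['X^2 * p] at [1/x]. A quadratic bound is what makes the
    derivative at 0 exist and vanish. *)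
Lemma flat_sqr_bound p : exists2 C, 0 <= C & forall x, `|flat p x| <= C * x ^+ 2.
Proof.
have [C C0 hC] := poly_le_exp ('X^2 * p).
exists C => // x; have [x0|x0] := ltP 0 x; last first.
  by rewrite flat_le0 // normr0 mulr_ge0 // sqr_ge0.
have xi0 : 0 <= x^-1 by rewrite invr_ge0 ltW.
have h := hC _ xi0; rewrite hornerM hornerXn normrM in h.
rewrite (ger0_norm (exprn_ge0 2 xi0)) in h.
rewrite flat_gt0 // normrM (ger0_norm (expR_ge0 _)) expRN.
have x2 : x ^+ 2 != 0 by rewrite expf_neq0 // gt_eqF.
rewrite ler_pdivrMr ?expR_gt0 //.
have := ler_wpM2l (sqr_ge0 x) h; rewrite exprVn mulrA mulfV // mul1r.
by move=> /le_trans; apply; rewrite mulrA (mulrC C).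
Qed.

Lemma is_derive_sqr_bound (f : R -> R) (C : R) : 0 <= C ->
  (forall x, `|f x| <= C * x ^+ 2) -> is_derive (0 : R) (1 : R) f 0.
Proof.
move=> C0 hf; have f0 : f 0 = 0.
  by apply/eqP; rewrite -normr_le0; have := hf 0; rewrite expr0n mulr0.
have lim0 : h^-1 *: ((f \o shift 0) (h *: (1 : R)) - f 0) @[h --> 0^'] --> (0 : R).
  apply/cvgrPdist_lt => e e0; near=> h.
  have hn0 : h != 0 by near: h; exact: nbhs_dnbhs_neq.
  rewrite sub0r normrN /= f0 subr0 addr0 /GRing.scale /= mulr1 normrM normfV.
  have h0 : 0 < `|h| by rewrite normr_gt0.
  rewrite mulrC ltr_pdivrMr //; apply: le_lt_trans (hf h) _.
  rewrite -(real_normK (num_real h)) expr2 mulrA ltr_pM2r //.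
  apply: le_lt_trans (_ : (C + 1) * `|h| < _).
    by rewrite ler_wpM2r // lerDl.
  rewrite mulrC -ltr_pdivlMr ?ltr_wpDl //; near: h.
  have := @dnbhs0_lt R R (e / (C + 1)); apply.
  by rewrite divr_gt0 // ltr_wpDl.
by split; [apply/cvg_ex; exists 0 | exact: cvg_lim].
Unshelve. all: by end_near. Qed.

Lemma is_derive_flat p (x : R) :
  is_derive x (1 : R) (flat p) (flat ('X^2 * (p - p^`())) x).
Proof.
have [x0|x0|->] := ltgtP x 0.
- rewrite flat_le0 ?ltW //.
  apply: (@near_eq_is_derive _ _ _ (fun=> 0 : R)).
  near=> y; rewrite flat_le0 // ltW //; near: y; exact: lt_nbhsl.
- suff d : is_derive x (1 : R) (fun y => p.[y^-1] * expR (- y^-1))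
      (flat ('X^2 * (p - p^`())) x).
    apply: near_eq_is_derive d; near=> y; rewrite flat_gt0 //; near: y; exact: lt_nbhsr.
  have xn0 : x != 0 by rewrite gt_eqF.
  have dV := is_deriveV xn0 (is_derive_id x (1 : R)).
  have dp := is_derive1_comp (is_derive_poly p x^-1) dV.
  have dN : is_derive x (1 : R) (fun y : R => - y^-1) (- (- x ^- 2 *: 1)).
    exact: is_deriveN dV.
  have de := @is_derive1_comp R expR _ x _ _ (is_derive_expR (- x^-1)) dN.
  apply: (is_derive_eq (is_deriveM dp de)).
  rewrite flat_gt0 // hornerM hornerXn hornerD hornerN /GRing.scale /=.
  by rewrite exprVn; ring.
- rewrite flat_le0 //; have [C C0 hC] := flat_sqr_bound p.
  exact: is_derive_sqr_bound C0 hC.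
Unshelve. all: by end_near. Qed.

(** A class closed under derivation, so that smoothness of every order is a single induction. The
    affine argument of [flat] lets the class absorb translations and changes of time scale. *)
Inductive smooth_expr : (R -> R) -> Prop :=
| smooth_flat p a b : smooth_expr (fun t => flat p (a * t + b))
| smooth_cst c : smooth_expr (fun=> c)
| smooth_add f g : smooth_expr f -> smooth_expr g ->
    smooth_expr (fun t => f t + g t)
| smooth_mul f g : smooth_expr f -> smooth_expr g ->
    smooth_expr (fun t => f t * g t)
| smooth_inv f : (forall t, f t != 0) -> smooth_expr f ->
    smooth_expr (fun t => (f t)^-1).

Lemma is_derive_affine (a b t : R) :
  is_derive t (1 : R) (fun t => a * t + b) a.
Proof.
have d := is_deriveD (is_deriveM (is_derive_cst a t (1 : R)) (is_derive_id t (1 : R)))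
  (is_derive_cst b t (1 : R)).
by apply: (is_derive_eq d); rewrite /GRing.scale /= !(mulr0, addr0, mulr1).
Qed.

Lemma smooth_expr_derive f : smooth_expr f ->
  exists2 g, smooth_expr g & forall t, is_derive t (1 : R) f (g t).
Proof.
elim=> {f} [p a b|c|f g _ [f' sf' df] _ [g' sg' dg]|
            f g sf [f' sf' df] sg [g' sg' dg]|f fn0 sf [f' sf' df]].
- exists (fun t => flat ('X^2 * (p - p^`())) (a * t + b) * a).
    by apply: smooth_mul (smooth_cst _); exact: smooth_flat.
  move=> t; exact: is_derive1_comp (is_derive_flat _ _) (is_derive_affine _ _ _).
- by exists (fun=> 0); [exact: smooth_cst | move=> t; exact: is_derive_cst].
- exists (fun t => f' t + g' t); first exact: smooth_add.
  by move=> t; exact: is_deriveD.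
- exists (fun t => f t * g' t + g t * f' t).
    by apply: smooth_add; apply: smooth_mul.
  by move=> t; exact: is_deriveM.
- exists (fun t => -1 * (((f t)^-1 * (f t)^-1) * f' t)).
    apply: smooth_mul (smooth_cst _) _; apply: smooth_mul => //.
    by apply: smooth_mul; exact: smooth_inv.
  move=> t; apply: (is_derive_eq (is_deriveV (fn0 t) (df t))).
  by rewrite /GRing.scale /= expr2 invfM; ring.
Qed.

Lemma smooth_derive (f g : R -> R) :
  (forall t, is_derive t (1 : R) f (g t)) -> smooth g -> smooth f.
Proof.
move=> df sg n; have fg : derive1 f = g.
  by apply/funext => t; rewrite derive1E; exact: derive_val.
case: n => [|n] t; first by case: (df t).
rewrite /derive1n iterSr fg; exact: sg.
Qed.

Lemma smooth_expr_smooth f : smooth_expr f -> smooth f.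
Proof.
move=> sf n; suff: smooth_expr (derive1n n f).
  by case/smooth_expr_derive => g _ dg t; case: (dg t).
elim: n => [//|n]; rewrite derive1nS => /smooth_expr_derive[g sg dg].
suff -> : derive1 (derive1n n f) = g by [].
by apply/funext => t; rewrite derive1E; exact: derive_val.
Qed.

(** Smoothness is local: this is how the rounded curve, given by another formula around each vertex,
    is handled. *)
Lemma smooth_near (f : R -> R) :
    (forall t : R, exists2 g : R -> R, smooth g & (\near t, g t = f t)) ->
  smooth f.
Proof.
move=> loc n t; have [g sg gf] := loc t.
suff h : \near t, derive1n n g t = derive1n n f t.
  by apply: near_eq_derivable h _; exact: sg.
elim: n => [//|n IH]; rewrite !derive1nS.
have := near_join IH; apply: filterS => x hx.
by rewrite !derive1E; exact: near_eq_derive.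
Qed.

End FlatFunctions.

Section CornerFunction.
Variable R : realType.

Let psi : R -> R := flat 1%:P.

Let psi_ge0 x : 0 <= psi x.
Proof.
by rewrite /psi /flat; case: ifP => // _; rewrite hornerC mul1r expR_ge0.
Qed.

Let psi_gt0 x : 0 < x -> 0 < psi x.
Proof. by move=> x0; rewrite /psi flat_gt0 // hornerC mul1r expR_gt0. Qed.

Let psi_le x y : x <= y -> psi x <= psi y.
Proof.
move=> xy; have [x0|x0] := ltP 0 x; last by rewrite {1}/psi flat_le0.
have y0 := lt_le_trans x0 xy.
by rewrite /psi !flat_gt0 // !hornerC !mul1r ler_expR lerN2 lef_pV2.
Qed.

(** The usual quotient of flat functions, rising from 0 to 1 across [[-1/4, 1/4]]. The factors [1]
    and [-1] give the arguments the shape [a * t + b] of [smooth_flat]. *)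
Definition step (x : R) : R :=
  psi (1 * x + 1 / 4) / (psi (1 * x + 1 / 4) + psi (-1 * x + 1 / 4)).

Let den_gt0 x : 0 < psi (1 * x + 1 / 4) + psi (-1 * x + 1 / 4).
Proof.
have [x0|x0] := leP 0 x; first by rewrite ltr_pwDl // psi_gt0 //; lra.
by rewrite ltr_wpDl // psi_gt0 //; lra.
Qed.

Lemma step_itv x : 0 <= step x <= 1.
Proof.
rewrite /step divr_ge0 //=; last exact: ltW.
by rewrite ler_pdivrMr // [1 * (_ + _)]mul1r lerDl.
Qed.

Lemma step_le0 x : x <= - (1 / 4) -> step x = 0.
Proof. by move=> h; rewrite /step {1}/psi flat_le0 ?mul0r //; lra. Qed.

Lemma step_half x : 0 <= x -> 1 / 2 <= step x.
Proof.
move=> x0; rewrite /step ler_pdivlMr //.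
have : psi (-1 * x + 1 / 4) <= psi (1 * x + 1 / 4) by apply: psi_le; lra.
by lra.
Qed.

Lemma stepN x : step (- x) = 1 - step x.
Proof.
rewrite /step; have := den_gt0 x => /lt0r_neq0 d0.
rewrite !mulrN mulN1r mul1r opprK -[X in psi (X + _) / _]mul1r.
rewrite !mul1r !mulN1r in d0 *.
by rewrite [in X in _ / X = _]addrC; field.
Qed.

Lemma smooth_step : smooth_expr step.
Proof.
apply: smooth_mul; first exact: smooth_flat.
apply: smooth_inv; first by move=> t; rewrite gt_eqF.
by apply: smooth_add; exact: smooth_flat.
Qed.

End CornerFunction.

Section MeanValue.
Variable R : realType.

Lemma is_derive_continuous (f : R -> R) (x df : R) :
  is_derive x (1 : R) f df -> {for x, continuous f}.
Proof.
by move=> d; apply: differentiable_continuous; apply/derivable1_diffP; case: d.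
Qed.

Lemma mean_value (f df : R -> R) (m M x y : R) : x <= y ->
    (forall t, is_derive t (1 : R) f (df t)) ->
    (forall t, x <= t <= y -> m <= df t <= M) ->
  m * (y - x) <= f y - f x <= M * (y - x).
Proof.
move=> xy d b.
have [c cxy ->] : exists2 c, c \in `[x, y]%R & f y - f x = df c * (y - x).
  apply: MVT_segment => //.
  by apply: continuous_subspaceT => t; exact: is_derive_continuous (d t).
have /b /andP[h1 h2] : x <= c <= y by move: cxy; rewrite in_itv.
by rewrite !ler_wpM2r // subr_ge0.
Qed.

End MeanValue.

Section Ramp.
Variable R : realType.
Notation mu := (@lebesgue_measure R).
Notation step := (@step R).

(* A smooth function equal to [max 0 x] outside of [-1/4, 1/4]. *)
Definition ramp (x : R) : R :=
  if x <= - (1 / 2) then 0 else (\int[mu]_(t in `[(-1 : R), x]) step t)%R.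

Lemma step_continuous : continuous step.
Proof.
by move=> x; have [g _ d] := smooth_expr_derive (smooth_step R);
  exact: is_derive_continuous (d x).
Qed.

Lemma ramp_le x : x <= - (1 / 4) -> ramp x = 0.
Proof.
move=> h; rewrite /ramp; case: ifP => // _.
rewrite (@eq_Rintegral _ _ _ mu _ (fun=> 0)); first by rewrite /Rintegral integral0.
move=> t; rewrite inE /= in_itv /= => /andP[_ tx].
by rewrite step_le0 // (le_trans tx).
Qed.

Lemma ramp_derive x : is_derive x (1 : R) ramp (step x).
Proof.
have [x0|x0] := ltP x (- (1 / 4)).
  rewrite step_le0 ?ltW //; apply: (@near_eq_is_derive _ _ _ (fun=> 0 : R)).
  near=> y; rewrite ramp_le // ltW //; near: y; exact: lt_nbhsl.
have [| | |dF eF] := @continuous_FTC1_closed R step (-1) x (x + 1) _ _ _ (@step_continuous x).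
- by rewrite ltrDl.
- apply: continuous_compact_integrable; first exact: segment_compact.
  by apply: continuous_subspaceT; exact: step_continuous.
- by apply: lt_le_trans x0; lra.
have d : is_derive x (1 : R)
    (fun x => (\int[mu]_(t in `[(-1 : R), x]) step t)%R) (step x).
  by split; [exact: dF | rewrite -derive1E; exact: eF].
(* The branch of [ramp] changes at -1/2, strictly to the left of [x >= -1/4], so that near [x] only
   the integral is seen. *)
apply: near_eq_is_derive d; near=> y; rewrite /ramp ifN // -ltNge; near: y.
by apply: lt_nbhsr; lra.
Unshelve. all: by end_near. Qed.

(** The difference of the two sides vanishes at 0 and has derivative 0, by the symmetry [stepN]. It
    transfers the vanishing of [ramp] on the left to its linearity on the right. *)
Lemma rampN x : ramp (- x) = ramp x - x.
Proof.
pose f x := ramp x + -1 * ramp (-1 * x + 0) + (-1 * x + 0).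
have df (t : R) : is_derive t (1 : R) f 0.
  have d1 := @is_derive1_comp R ramp _ t _ _ (ramp_derive (-1 * t + 0))
    (is_derive_affine _ _ _).
  have d := is_deriveD (is_deriveD (ramp_derive t)
    (is_deriveM (is_derive_cst (-1 : R) t (1 : R)) d1)) (is_derive_affine (-1) 0 t).
  apply: (is_derive_eq d); rewrite /GRing.scale /= mulN1r addr0 stepN; ring.
have := @is_derive_0_is_cst R f x 0 df.
rewrite /f !mulr0 !addr0 !mulN1r; lra.
Qed.

Lemma ramp_ge x : 1 / 4 <= x -> ramp x = x.
Proof. by move=> h; have := rampN x; rewrite (@ramp_le (- x)); lra. Qed.

Lemma ramp_lip x y : x <= y -> 0 <= ramp y - ramp x <= y - x.
Proof.
move=> xy; have := mean_value xy ramp_derive (fun t _ => step_itv t).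
by rewrite mul0r mul1r.
Qed.

Lemma ramp_itv x : 0 <= ramp x /\ x <= ramp x.
Proof.
split; last first.
  have [h|h] := leP x (- (1 / 4)); first by rewrite ramp_le //; lra.
  have [h'|h'] := leP (1 / 4) x; first by rewrite ramp_ge.
  have /andP[_] := ramp_lip (ltW h'); rewrite (@ramp_ge (1 / 4)) //; lra.
have [h|h] := leP x (- (1 / 4)); first by rewrite ramp_le.
by have /andP[] := ramp_lip (ltW h); rewrite (@ramp_le (- (1 / 4))) // subr0.
Qed.

(* The distance from the corner to the rounded corner, as a function of the
   distance to the corner in the parameter. *)
Definition bump (a : R) : R := ramp (- a).

(** On the negative half-line the slope [step] is at most 1/2. Hence a rounded corner departs from
    the polygon with a speed of at most half the turn. *)
Lemma bump_lip a b : 0 <= a <= b -> 0 <= bump a - bump b <= 1 / 2 * (b - a).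
Proof.
move=> /andP[a0 ab]; have ba : - b <= - a by lra.
have : forall t, - b <= t <= - a -> 0 <= step t <= 1 / 2.
  move=> t /andP[_ ta]; have /andP[-> _] := step_itv t.
  have := @step_half R (- t); rewrite stepN; lra.
move=> /(mean_value ba ramp_derive); rewrite /bump; lra.
Qed.

Lemma bump_itv a : 0 <= a -> 0 <= bump a <= 1 / 8.
Proof.
move=> a0; rewrite /bump; have [-> _] := ramp_itv (- a) => /=.
have [h|h] := leP (1 / 4) a; first by rewrite ramp_le; lra.
have := @bump_lip a (1 / 4); rewrite /bump (@ramp_le (- (1 / 4))) //; lra.
Qed.

End Ramp.

(** * Curves that follow a polygon with a small deviation *)

Section Deviation.
Local Open Scope Z_scope.

(* [kn / kd] is the Lipschitz constant; the edge [e.1] is traversed with a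
   deviation of Lipschitz constant [e.2 / D], and the deviation is at most
   [eps / D] at the vertices. *)
Variables (kn kd D eps : Z).

Definition dev_edge (e : (zpt * zpt) * Z) : bool :=
  kd * e.2 <=? kn * D * zsup (zsub e.1.2 e.1.1).

(** Both deviations are compared with the one at the common vertex, which cancels: [eps] does not
    enter. A form that is large enough on both edges is large enough on their nonnegative
    combinations. *)
Definition dev_adjacent (ef : ((zpt * zpt) * Z) * ((zpt * zpt) * Z)) : bool :=
  let: (e, f) := ef in
  let u := zsub e.1.2 e.1.1 in let v := zsub f.1.2 f.1.1 in
  lazy_has (fun lw => if lw.2 * (kd * e.2) <=? kn * D * zdot lw.1 u
                      then lw.2 * (kd * f.2) <=? kn * D * zdot lw.1 v
                      else false) directions.

(** On an edge the deviation is at most half its Lipschitz constant plus [eps], since some end is at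
    distance at most 1/2. The sum over two edges, doubled to stay integral, gives
    [e.2 + f.2 + 4 * eps]. *)
Definition dev_far (e f : (zpt * zpt) * Z) : bool :=
  let b := kd * (e.2 + f.2 + 4 * eps) in
  let g00 := zsub f.1.1 e.1.1 in let g10 := zsub f.1.2 e.1.1 in
  let g01 := zsub f.1.1 e.1.2 in let g11 := zsub f.1.2 e.1.2 in
  let ok lw g := lw.2 * b <=? 2 * (kn * D) * zdot lw.1 g in
  lazy_has (fun lw => if ok lw g00 then if ok lw g10 then
                      if ok lw g01 then ok lw g11 else false
                      else false else false) directions.

#[local] Opaque directions.

Fixpoint dev_far_from (s : seq ((zpt * zpt) * Z)) : bool :=
  if s is x :: ((_ :: s') as t) then
    if lazy_all (dev_far x) s' then dev_far_from t else false
  else true.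

(** The first edge is adjacent to the last one too: [take] removes the last edge from those compared
    with [x] by [dev_far]. *)
Definition dev_ok (F : seq zpt) (beta : seq Z) : bool :=
  let es := zip (edges F) beta in
  if lazy_all dev_edge es then
  if lazy_all dev_adjacent (zip es (rot 1 es)) then
  if es is x :: ((_ :: s) as t) then
    if lazy_all (dev_far x) (take (size s).-1 s) then dev_far_from t else false
  else false else false else false.

Lemma dev_far_fromP e0 s : dev_far_from s ->
  forall i j, (i.+1 < j < size s)%N -> dev_far (nth e0 s i) (nth e0 s j).
Proof.
elim: s => [_ i j|x [|y s] IH]; first by rewrite ltn0 andbF.
  by move=> _ i [|[|j]]; rewrite ?andbF // ltnS ltn0 andbF.
have -> : dev_far_from [:: x, y & s] =
  if lazy_all (dev_far x) s then dev_far_from (y :: s) else false by [].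
case: ifP => [xs h|_ h]; last by discriminate h.
move: xs; rewrite lazy_allP => /(all_nthP e0) xs.
case=> [|i] [|[|j]] /andP[ij js].
- by rewrite ltn0 in ij.
- by rewrite ltnn in ij.
- exact: xs.
- by rewrite ltn0 in ij.
- by rewrite ltnS ltn0 in ij.
- by apply: (IH h i j.+1); rewrite -ltnS ij.
Qed.

Lemma dev_okP F beta e0 (es := zip (edges F) beta) : size beta = size F ->
    dev_ok F beta ->
  [/\ all dev_edge es,
      forall a, (a < size F)%N ->
        dev_adjacent (nth e0 es a, nth e0 es (a.+1 %% size F)) &
      forall a b, (a.+1 < b < size F)%N -> (0 < a)%N || (b.+1 < size F)%N ->
        dev_far (nth e0 es a) (nth e0 es b)].
Proof.
move=> sb; rewrite /dev_ok -/es; have ses : size es = size F.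
  by rewrite size_zip size_zip size_rot sb !minnn.
case: ifP => //; rewrite lazy_allP => h1; case: ifP => //; rewrite lazy_allP => h2 h3.
split=> //.
  move=> a aF; move/(all_nthP (e0, e0)): h2 => /(_ a).
  rewrite size_zip size_rot minnn ses nth_zip ?size_rot // => /(_ aF).
  congr (dev_adjacent (_, _)); case: (es) ses aF => [|x s] <- //= aF.
  rewrite rot1_cons nth_rcons; move: aF; rewrite ltnS leq_eqVlt.
  case/orP => [/eqP ->|h]; first by rewrite ltnn eqxx modnn.
  by rewrite h modn_small.
move=> a b; rewrite -ses; case: (es) h3 => [|x [|y s]] //.
case: ifP => //; rewrite lazy_allP => /(all_nthP e0) xs h.
case: a b => [|a] [|[|b]] // /andP[ab bs]; last first.
  move=> _; have := dev_far_fromP e0 h (i := a) (j := b.+1).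
  by apply; rewrite -ltnS ab.
rewrite /=.
rewrite !ltnS => bs'; rewrite -[nth e0 s b](@nth_take (size s).-1) //.
  by apply: xs; rewrite size_takel ?leq_pred // -ltnS prednK // (leq_ltn_trans _ bs').
by rewrite -ltnS prednK // (leq_ltn_trans _ bs').
Qed.

End Deviation.

Section Periodicity.
Variable R : realType.

Lemma periodic_int (T : Type) (f : R -> T) (p : R) : (forall x, f (x + p) = f x) ->
  forall (m : int) x, f (x + p *~ m) = f x.
Proof.
move=> fp; have fn (k : nat) x : f (x + p *+ k) = f x.
  by elim: k => [|k IH]; rewrite ?mulr0n ?addr0 // mulrSr addrA fp.
case=> k x; first exact: fn.
by rewrite NegzE mulrNz -[LHS](fn k.+1) subrK.
Qed.

Lemma polygon_periodic (u : R) (F : seq zpt) : (0 < size F)%N ->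
  forall x, polygon u F (x + (size F)%:R) = polygon u F x.
Proof.
move=> F0 x; have fl : Num.floor (x + (size F)%:R) = Num.floor x + (size F)%:Z.
  apply: floor_def; rewrite addrAC !intrD -[(size F)%:~R]/((size F)%:R).
  by have := floor_itv x; rewrite intrD; lra.
rewrite !polygonE // fl; have -> : zmod_nat (size F) (Num.floor x + size F) =
    zmod_nat (size F) (Num.floor x) by rewrite /zmod_nat modzDr.
by congr lerp; rewrite intrD opprD addrACA subrr addr0.
Qed.

End Periodicity.

Section DeviationSound.
Variable R : realType.
Notation V := 'rV[R]_3.

Lemma dotr_bound (l g : V) (W k c : R) : 0 < W -> \sum_i `|l 0 i| <= W ->
  0 <= k -> W * c <= k * dotr l g -> c <= k * `|g|.
Proof.
move=> W0 lW k0 h; rewrite -(ler_pM2l W0) mulrCA; apply: le_trans h _.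
by rewrite ler_wpM2l // (le_trans (dotr_le _ _)) // ler_wpM2r.
Qed.

Lemma lerp_far (p0 p1 q0 q1 l : V) (W k c s t : R) :
    0 <= s <= 1 -> 0 <= t <= 1 -> 0 < W -> \sum_i `|l 0 i| <= W -> 0 <= k ->
    W * c <= k * dotr l (q0 - p0) -> W * c <= k * dotr l (q1 - p0) ->
    W * c <= k * dotr l (q0 - p1) -> W * c <= k * dotr l (q1 - p1) ->
  c <= k * `|lerp q0 q1 t - lerp p0 p1 s|.
Proof.
move=> /andP[s0 s1] /andP[t0 t1] W0 lW k0 h00 h10 h01 h11.
apply: (dotr_bound W0 lW k0).
have c00 : 0 <= (1 - s) * (1 - t) by rewrite mulr_ge0 ?subr_ge0.
have c10 : 0 <= (1 - s) * t by rewrite mulr_ge0 ?subr_ge0.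
have c01 : 0 <= s * (1 - t) by rewrite mulr_ge0 ?subr_ge0.
have c11 : 0 <= s * t by rewrite mulr_ge0.
have := ler_wpM2l c00 h00; have := ler_wpM2l c10 h10.
have := ler_wpM2l c01 h01; have := ler_wpM2l c11 h11.
by rewrite /lerp !(dotrD, dotrN, dotrZ); lra.
Qed.

(** The vector between the two points is [(1 - s) (q - p) + t (r - q)], where both coefficients are
    nonnegative. *)
Lemma lerp_adjacent (p q r l : V) (W k b c s t : R) :
    0 <= s <= 1 -> 0 <= t <= 1 -> 0 < W -> \sum_i `|l 0 i| <= W -> 0 <= k ->
    W * b <= k * dotr l (q - p) -> W * c <= k * dotr l (r - q) ->
  b * (1 - s) + c * t <= k * `|lerp q r t - lerp p q s|.
Proof.
move=> /andP[s0 s1] /andP[t0 t1] W0 lW k0 hb hc.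
apply: (dotr_bound W0 lW k0).
have s1' : 0 <= 1 - s by rewrite subr_ge0.
have := ler_wpM2l s1' hb; have := ler_wpM2l t0 hc.
by rewrite /lerp !(dotrD, dotrN, dotrZ); lra.
Qed.

(** Half the sum of the bounds obtained from the two ends of the interval, whose distances to [x]
    add up to 1. *)
Lemma deviation_bound (d : R -> V) (i c e x : R) :
    (forall x y, i <= x <= i + 1 -> i <= y <= i + 1 -> `|d x - d y| <= c * `|x - y|) ->
    `|d i| <= e -> `|d (i + 1)| <= e -> i <= x <= i + 1 ->
  `|d x| <= c / 2 + e.
Proof.
move=> lip d0 d1 x01; have /andP[x0 x1] := x01.
have h1 : `|d x| <= `|d i| + `|d x - d i|.
  by rewrite addrC -{1}(subrK (d i) (d x)) ler_normD.
have h2 : `|d x| <= `|d (i + 1)| + `|d x - d (i + 1)|.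
  by rewrite addrC -{1}(subrK (d (i + 1)) (d x)) ler_normD.
have l0 : `|d x - d i| <= c * (x - i).
  by rewrite -(ger0_norm (_ : 0 <= x - i)) ?subr_ge0 // lip // lexx lerDl ler01.
have l1 : `|d x - d (i + 1)| <= c * (i + 1 - x).
  rewrite -(ger0_norm (_ : 0 <= i + 1 - x)) ?subr_ge0 // -[in leRHS]distrC.
  by rewrite lip // lexx lerDl ler01.
have := le_trans h1 (lerD d0 l0); have := le_trans h2 (lerD d1 l1).
by clear lip h1 h2 l0 l1 d0 d1; lra.
Qed.

Lemma frac_le (a c e x y : R) : 0 < c -> 0 < e -> c * x <= a * e * y ->
  x / e <= a / c * y.
Proof.
move=> c0 e0 h; rewrite ler_pdivrMr //.
have -> : a / c * y * e = (a * e * y) / c by ring.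
by rewrite ler_pdivlMr // mulrC.
Qed.

Variables (u : R) (u0 : 0 < u) (kn kd D eps : Z).
Hypotheses (kn0 : (0 <=? kn)%bz) (kd0 : (0 <? kd)%bz) (D0 : (0 <? D)%bz).
Hypothesis (eps0 : (0 <=? eps)%bz).
Variables (F : seq zpt) (beta : seq Z) (f : R -> V).
Let n := size F.
Hypotheses (sb : size beta = n) (n3 : (3 <= n)%N) (ok : dev_ok kn kd D eps F beta).
Hypothesis (fper : forall x, f (x + n%:R) = f x).

Let b (a : nat) : R := zr R (nth 0%bz beta a) / zr R D.
Let d (x : R) : V := f x - polygon u F x.

Hypothesis dlip : forall (i : int) x y, i%:~R <= x <= i%:~R + 1 ->
  i%:~R <= y <= i%:~R + 1 -> `|d x - d y| <= u * b (zmod_nat n i) * `|x - y|.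
Hypothesis d_bound : forall (i : int) x, i%:~R <= x <= i%:~R + 1 ->
  `|d x| <= u * (b (zmod_nat n i) / 2 + zr R eps / zr R D).

Let k := zr R kn / zr R kd.

Let zkd : 0 < zr R kd. Proof. by move: kd0; rewrite (zr_lt R). Qed.
Let zD : 0 < zr R D. Proof. by move: D0; rewrite (zr_lt R). Qed.
Let zkn : 0 <= zr R kn. Proof. by move: kn0; rewrite (zr_le R). Qed.
Let k0 : 0 <= k. Proof. by rewrite divr_ge0 // ltW. Qed.
Let n0 : (0 < n)%N. Proof. exact: leq_trans n3. Qed.

Let P a : V := zvec u (pvertex F a).
Let Q a : V := zvec u (nvertex F a).
Let e0 : (zpt * zpt) * Z := ((p0, p0), 0%bz).
Let es := zip (edges F) beta.

Let nth_es a : (a < n)%N ->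
  nth e0 es a = ((pvertex F a, nvertex F a), nth 0%bz beta a).
Proof.
move=> an; rewrite nth_zip ?nth_edges // size_zip size_rot minnn.
by rewrite sb.
Qed.

Let same_bound a : (a < n)%N -> b a * u <= k * `|Q a - P a|.
Proof.
move=> an; have [h _ _] := dev_okP e0 sb ok.
have /(all_nthP e0)/(_ a) := h.
rewrite size_zip size_zip size_rot sb !minnn => /(_ an); rewrite nth_es //.
rewrite /dev_edge /= (zr_le R) !zrM -zvecB (zvec_norm _ (ltW u0)).
move=> {}h; have -> : b a * u = (u * zr R (nth 0%bz beta a)) / zr R D.
  by rewrite /b; ring.
by apply: frac_le => //; have := ler_wpM2l (ltW u0) h; lra.
Qed.

Let adj_bound a s t : (a < n)%N -> 0 <= s <= 1 -> 0 <= t <= 1 ->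
  u * b a * (1 - s) + u * b (a.+1 %% n)%N * t <=
  k * `|lerp (P (a.+1 %% n)%N) (Q (a.+1 %% n)%N) t - lerp (P a) (Q a) s|.
Proof.
move=> an s01 t01; have [_ h _] := dev_okP e0 sb ok.
have := h a an; rewrite -/n !nth_es ?ltn_mod // /dev_adjacent lazy_hasP.
move=> /hasP[lw /directionsP[lw2 lw0]] /=; case: ifP => //; rewrite lw2.
rewrite !(zr_le R) !zrM => h1 h2.
have -> : P (a.+1 %% n)%N = Q a by [].
apply: (@lerp_adjacent _ _ _ (zvec 1 lw.1) (zr R (zsum lw.1))) => //.
- by move: lw0; rewrite (zr_lt R).
- by rewrite zvec_sum.
- rewrite -zvecB zvec_dot /b (mulrA u) (mulrA (zr R (zsum _))); apply: frac_le => //.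
  by have := ler_wpM2l (ltW u0) h1; lra.
- rewrite -zvecB zvec_dot /b (mulrA u) (mulrA (zr R (zsum _))); apply: frac_le => //.
  by have := ler_wpM2l (ltW u0) h2; lra.
Qed.

Let far_bound a c s t : (a.+1 < c < n)%N -> (0 < a)%N || (c.+1 < n)%N ->
    0 <= s <= 1 -> 0 <= t <= 1 ->
  u * ((b a + b c) / 2 + 2 * (zr R eps / zr R D)) <=
  k * `|lerp (P c) (Q c) t - lerp (P a) (Q a) s|.
Proof.
move=> /andP[ac cn] acn s01 t01; have [_ _ h] := dev_okP e0 sb ok.
have an : (a < n)%N by apply: ltn_trans cn; apply: ltn_trans ac.
have := h a c; rewrite -/n ac cn acn => /(_ isT isT).
rewrite !nth_es // /dev_far lazy_hasP => /hasP[lw /directionsP[lw2 lw0]].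
rewrite /= !lw2.
have conv g : (zsum lw.1 * (kd * (nth 0 beta a + nth 0 beta c + 4 * eps)) <=?
      2 * (kn * D) * zdot lw.1 g)%bz ->
    zr R (zsum lw.1) * (u * ((b a + b c) / 2 + 2 * (zr R eps / zr R D))) <=
    k * dotr (zvec 1 lw.1) (zvec u g).
  rewrite (zr_le R) !(zrM, zrD) zvec_dot /b /k.
  have -> : zr R 4 = 4 by rewrite /zr.
  have -> : zr R 2 = 2 by rewrite /zr.
  move=> {}h; have -> x y z : (x / zr R D + y / zr R D) / 2 + 2 * (z / zr R D) =
      (x + y + 4 * z) / (2 * zr R D) :> R.
    by field; rewrite gt_eqF.
  rewrite (mulrA u) (mulrA (zr R (zsum _))); apply: frac_le; rewrite ?mulr_gt0 //.
  by have := ler_wpM2l (ltW u0) h; lra.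
do 3!case: ifP => //; move=> /conv h01 /conv h10 /conv h00 /conv h11.
rewrite !zvecB in h00 h01 h10 h11.
apply: (@lerp_far _ _ _ _ (zvec 1 lw.1) (zr R (zsum lw.1))) => //.
- by move: lw0; rewrite (zr_lt R).
- by rewrite zvec_sum.
Qed.

Let d_periodic m x : d (x + n%:R *~ m) = d x.
Proof.
rewrite /d (periodic_int (polygon_periodic u n0)).
by rewrite (periodic_int fper).
Qed.

(** Parameters are sorted by their edges modulo [n]: same edge, consecutive edges, or far edges. In
    the first two cases one parameter is moved by a multiple of the period until the unit intervals
    coincide or are consecutive. *)
Lemma deviation_lip : lip_rel k (polygon u F) f.
Proof.
move=> s t; rewrite -/(d s) -/(d t).
have piece (x : R) : [/\ (Num.floor x)%:~R <= x <= (Num.floor x)%:~R + 1,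
    (zmod_nat n (Num.floor x) < n)%N & polygon u F x =
    lerp (P (zmod_nat n (Num.floor x))) (Q (zmod_nat n (Num.floor x)))
      (x - (Num.floor x)%:~R)].
  split; [|exact: zmod_nat_lt|exact: polygonE].
  by have := frac_itv x; rewrite subr_ge0 lerBlDl.
pose a (x : R) := zmod_nat n (Num.floor x).
have shift (i j : int) : zmod_nat n i = zmod_nat n j ->
    exists m, j%:~R = i%:~R + n%:R *~ m :> R.
  move=> e; have : (n %| j - i)%Z.
    by rewrite -eqz_mod_dvd; apply/eqP; rewrite -!zmod_natE // e.
  move=> /dvdzP[m em]; exists m; rewrite -(mulrzr n%:R m) -[n%:R]/(n%:Z%:~R) -intrM.
  by rewrite mulrC -em -intrD addrC subrK.
have same (x y : R) : a x = a y -> `|d y - d x| <= k * `|polygon u F y - polygon u F x|.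
  move=> e; have [m em] := shift _ _ e.
  have [x01 ax ->] := piece x; have [y01 ay ->] := piece y.
  rewrite -/(a x) -/(a y) -e; set p := P _; set q := Q _.
  have -> : lerp p q (y - (Num.floor y)%:~R) - lerp p q (x - (Num.floor x)%:~R)
      = ((y - n%:R *~ m) - x) *: (q - p).
    by apply/rowP => i; rewrite !mxE em; ring.
  rewrite normrZ -(@d_periodic (- m) y) mulrNz.
  have y01' : (Num.floor x)%:~R <= y - n%:R *~ m <= (Num.floor x)%:~R + 1.
    by move: y01; rewrite em; lra.
  apply: le_trans (dlip y01' x01) _; have := same_bound ax.
  by move=> /(ler_wpM2r (normr_ge0 (y - n%:R *~ m - x))); rewrite /p /q /a; lra.
have adj (x y : R) : a y = ((a x).+1 %% n)%N ->
    `|d y - d x| <= k * `|polygon u F y - polygon u F x|.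
  move=> e; have [x01 ax ->] := piece x; have [y01 ay ->] := piece y.
  rewrite -/(a x) -/(a y) e; have [m em] : exists m, (Num.floor y)%:~R =
      (Num.floor x + 1)%:~R + n%:R *~ m :> R.
    by apply: shift; rewrite zmod_natS.
  have := frac_itv x; have := frac_itv y => fy fx.
  apply: le_trans (adj_bound ax fx fy).
  have i1 : (Num.floor x + 1)%:~R = (Num.floor x)%:~R + 1 :> R by rewrite intrD.
  rewrite -(@d_periodic (- m) y) mulrNz; set y' := y - _.
  have y01' : (Num.floor x + 1)%:~R <= y' <= (Num.floor x + 1)%:~R + 1.
    by move: y01; rewrite em /y'; lra.
  have e1 := @dlip (Num.floor x + 1) y' (Num.floor x + 1)%:~R y01'.
  have e2 := @dlip (Num.floor x) (Num.floor x + 1)%:~R x.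
  rewrite lexx lerDl ler01 in e1; rewrite i1 lexx lerDl ler01 x01 in e2.
  move: e1 e2 => /(_ isT) + /(_ isT isT); rewrite zmod_natS // -/(a x).
  (* The comparison goes through the common vertex, at time [floor x + 1]. *)
  rewrite i1 => e1 e2; apply: le_trans (ler_distD (d ((Num.floor x)%:~R + 1)) _ _) _.
  move: e1 e2 y01'; rewrite i1 => e1 e2 /andP[y0 y1].
  rewrite (ger0_norm (_ : 0 <= y' - _)) ?subr_ge0 // in e1.
  rewrite (ger0_norm (_ : 0 <= _ + 1 - x)) in e2; last by move: fx; lra.
  have -> : y - (Num.floor y)%:~R = y' - ((Num.floor x)%:~R + 1).
    by rewrite em i1 /y'; ring.
  by apply: le_trans (lerD e1 e2) _; rewrite le_eqVlt; apply/orP; left; apply/eqP; ring.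
have far (x y : R) : ((a x).+1 < a y)%N -> (0 < a x)%N || ((a y).+1 < n)%N ->
    `|d y - d x| <= k * `|polygon u F y - polygon u F x|.
  move=> axy en; have [x01 ax ->] := piece x; have [y01 ay ->] := piece y.
  have := frac_itv x; have := frac_itv y => fy fx.
  have axyn : ((a x).+1 < a y < n)%N by rewrite axy.
  apply: le_trans (far_bound axyn en fx fy).
  apply: le_trans (ler_normB _ _) _.
  by have := d_bound x01; have := d_bound y01; rewrite -/(a x) -/(a y); lra.
have sym (x y : R) : `|d x - d y| <= k * `|polygon u F x - polygon u F y| ->
    `|d y - d x| <= k * `|polygon u F y - polygon u F x|.
  by rewrite distrC [X in _ <= _ * X -> _]distrC.
have main (x y : R) : (a x < a y)%N ->
    `|d y - d x| <= k * `|polygon u F y - polygon u F x|.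
  move=> axy; have [_ ay _] := piece y; rewrite -/(a y) in ay.
  have [e|ne] := eqVneq (a y) (a x).+1; first by apply: adj; rewrite e modn_small // -e.
  (* The edges 0 and [n - 1] are consecutive in the opposite order, which [sym] restores. *)
  have [/andP[/eqP a0 /eqP an]|h] := boolP ((a x == 0) && ((a y).+1 == n))%N.
    by apply: sym; apply: adj; rewrite an modnn.
  apply: far; first by rewrite ltn_neqAle eq_sym ne.
  by move: h; rewrite negb_and -lt0n [((a y).+1 < n)%N]ltn_neqAle ay andbT.
have [h|h|h] := ltngtP (a s) (a t); [exact: main | | exact: same].
by apply: sym; exact: main.
Qed.

End DeviationSound.

(** * Rounding the corners of a polygon *)

Section Rounding.
Variable R : realType.
Notation V := 'rV[R]_3.
Variables (u : R) (F : seq zpt).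
Hypothesis F0 : (0 < size F)%N.

Definition zadd (p q : zpt) : zpt :=
  let: (a, b, c) := p in let: (d, e, f) := q in (a + d, b + e, c + f)%bz.

Definition edge_vec (i : int) : zpt := zsub (vertex F (i + 1)) (vertex F i).
Definition turn (i : int) : zpt := zsub (edge_vec i) (edge_vec (i - 1)).

(* For [ramp] replaced by [max 0] this parametrizes the two edges of the
   polygon [F] at its vertex [i]. *)
Definition corner_piece (i : int) (x : R) : V :=
  zvec u (vertex F i) + (x - i%:~R) *: zvec u (edge_vec (i - 1)) +
  ramp (x - i%:~R) *: zvec u (turn i).

Definition rounded (x : R) : V := corner_piece (Num.floor (x + 1 / 2)) x.

Lemma edge_vecE i : zvec u (edge_vec i) =
  zvec u (vertex F (i + 1)) - zvec u (vertex F i) :> V.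
Proof. exact: zvecB. Qed.

(** There the ramp of the vertex [i] is already linear and that of [i + 1] is still zero: both
    formulas describe the straight edge. *)
Lemma corner_pieceS i x : 1 / 4 <= x - i%:~R <= 3 / 4 ->
  corner_piece i x = corner_piece (i + 1) x.
Proof.
move=> /andP[h1 h2]; rewrite /corner_piece intrD.
have -> : ramp (x - i%:~R) = x - i%:~R by rewrite ramp_ge //; lra.
have -> : ramp (x - (i%:~R + 1%:~R)) = 0 :> R.
  by rewrite ramp_le // -[1%:~R]/(1 : R); lra.
rewrite /turn zvecB addrK scale0r addr0 !(edge_vecE i) -[1%:~R]/(1 : R).
by apply/rowP => j; rewrite !mxE; ring.
Qed.

(** Although [rounded] switches formulas at distance 1/2 from a vertex, each formula stays valid up
    to 3/4; this overlap makes the curve agree with a single piece around every parameter. *)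
Lemma rounded_piece i x : - (3 / 4) <= x - i%:~R <= 3 / 4 ->
  rounded x = corner_piece i x.
Proof.
move=> /andP[h1 h2]; rewrite /rounded; set j := Num.floor _.
have /andP[] := floor_itv (x + 1 / 2); rewrite -/j intrD -[1%:~R]/(1 : R) => j1 j2.
have ij : i - 2 < j by rewrite -(ltr_int R) intrB -[2%:~R]/(2 : R); lra.
have ji : j < i + 2 by rewrite -(ltr_int R) intrD -[2%:~R]/(2 : R); lra.
have [e|[e|e]] : j = i - 1 \/ j = i \/ j = i + 1 by lia.
- have je : j%:~R = i%:~R - 1 :> R by rewrite e intrB.
  have -> : corner_piece i x = corner_piece (j + 1) x by congr corner_piece; lia.
  by apply: corner_pieceS; rewrite je; lra.
- by rewrite e.
- have je : j%:~R = i%:~R + 1 :> R by rewrite e intrD.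
  by have := @corner_pieceS i x; rewrite -e => -> //; lra.
Qed.

(** After the vertex, [ramp t = t + ramp (- t)]. So on both sides the piece is the polygon plus a
    multiple of the turn depending only on the distance to the vertex. *)
Lemma corner_pieceE i x : corner_piece i x =
    (if x < i%:~R
     then zvec u (vertex F i) + (x - i%:~R) *: zvec u (edge_vec (i - 1))
     else zvec u (vertex F i) + (x - i%:~R) *: zvec u (edge_vec i)) +
    bump `|x - i%:~R| *: zvec u (turn i).
Proof.
rewrite /corner_piece /bump; case: ltP => h.
  have h' : x - i%:~R < 0 by rewrite subr_lt0.
  by rewrite (ltr0_norm h') opprK.
have h' : 0 <= x - i%:~R by rewrite subr_ge0.
rewrite (ger0_norm h') rampN scalerBl /turn !zvecB.
by apply/rowP => j; rewrite !mxE; ring.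
Qed.

Lemma vertex_periodic i (m : int) : vertex F (i + (size F)%:Z * m) = vertex F i.
Proof. by rewrite /vertex /zmod_nat addrC mulrC modzMDl. Qed.

Lemma rounded_periodic x : rounded (x + (size F)%:R) = rounded x.
Proof.
rewrite /rounded; set i := Num.floor (x + 1 / 2).
have -> : Num.floor (x + (size F)%:R + 1 / 2) = i + (size F)%:Z.
  apply: floor_def; rewrite addrAC !intrD -[(size F)%:~R]/((size F)%:R).
  by have := floor_itv (x + 1 / 2); rewrite intrD -/i; lra.
have vp j : vertex F (j + (size F)%:Z) = vertex F j.
  by have := vertex_periodic j 1; rewrite mulr1.
have ep j : edge_vec (j + (size F)%:Z) = edge_vec j.
  by rewrite /edge_vec [j + _ + 1]addrAC !vp.
have ep1 : edge_vec (i + (size F)%:Z - 1) = edge_vec (i - 1).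
  by rewrite [i + _ - 1]addrAC ep.
rewrite /corner_piece /turn ep1 ep vp.
have -> : x + (size F)%:R - (i + (size F)%:Z)%:~R = x - i%:~R.
  by rewrite intrD -[(size F)%:Z%:~R]/((size F)%:R : R); ring.
by [].
Qed.

Definition nvtx (a : nat) : zpt := nth p0 F (a %% size F).
Definition nturn (a : nat) : zpt :=
  zsub (zsub (nvtx a.+1) (nvtx a)) (zsub (nvtx a) (nvtx (a + size F).-1)).
(** Vertices and midpoints alternately, doubled to stay integral, hence the unit [u / 2]. On each
    half-edge only one corner is rounded; for the half-edge [j] it is the vertex [uphalf j], whose
    turn is listed in [turns]. *)
Definition halves : seq zpt :=
  mkseq (fun j => zadd (nvtx j./2) (nvtx (uphalf j))) (size F).*2.
Definition turns : seq Z := mkseq (fun j => zsup (nturn (uphalf j))) (size F).*2.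

End Rounding.

Section PolygonClosed.
Variable R : realType.

Lemma polygon_closed (u : R) (F : seq zpt) (j : int) (y : R) :
    j%:~R <= y <= j%:~R + 1 ->
  polygon u F y =
    lerp (zvec u (vertex F j)) (zvec u (vertex F (j + 1))) (y - j%:~R).
Proof.
move=> /andP[jy]; rewrite le_eqVlt => /orP[/eqP ->|yj].
  have fl : Num.floor (j%:~R + 1 : R) = j + 1.
    by rewrite -[1]/(1%:~R) -intrD intrKfloor.
  rewrite /polygon fl intrD; apply/rowP => c; rewrite !mxE -[1%:~R]/(1 : R); ring.
by rewrite /polygon (floor_def (m := j)) // intrD jy.
Qed.

End PolygonClosed.

Section RoundingLink.
Variable R : realType.
Notation V := 'rV[R]_3.
Variables (u : R) (F : seq zpt).
Hypotheses (u0 : 0 < u) (F0 : (0 < size F)%N).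
Let n := size F.

Lemma zvecD (p q : zpt) : zvec (u / 2) (zadd p q) =
  (1 / 2) *: (zvec u p + zvec u q) :> V.
Proof.
case: p q => [[a b] c] [[d e] f]; apply/rowP => i; rewrite !mxE.
by case: i => [[|[|[|]]]] //= _; rewrite zrD; field.
Qed.

Lemma nvtxE (b : nat) (i m : int) : b%:Z = i + n%:Z * m -> nvtx F b = vertex F i.
Proof.
move=> e; rewrite /nvtx /vertex; congr nth; apply/eqP; rewrite -eqz_nat.
by rewrite zmod_natE // -modz_nat e addrC mulrC modzMDl.
Qed.

Lemma nturnE (b : nat) (i m : int) : b%:Z = i + n%:Z * m -> nturn F b = turn F i.
Proof.
move=> e; rewrite /nturn /turn /edge_vec subrK.
rewrite (nvtxE e) (@nvtxE b.+1 (i + 1) m); last by rewrite -addn1 PoszD e addrAC.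
rewrite (@nvtxE (b + n).-1 (i - 1) (m + 1)) //.
have -> : (b + n).-1%:Z = b%:Z + n%:Z - 1 by move: F0; rewrite -/n; lia.
by rewrite e; ring.
Qed.

Lemma zmod_natP (k : nat) (j : int) : (0 < k)%N ->
  exists m, (zmod_nat k j)%:Z = j + k%:Z * m.
Proof.
move=> k0; exists (- (divz j k)); rewrite zmod_natE // {2}(divz_eq j k); ring.
Qed.

Lemma size_halves : size (halves F) = n.*2.
Proof. by rewrite size_mkseq. Qed.

Let n20 : (0 < n.*2)%N. Proof. by rewrite double_gt0. Qed.

Lemma parityz (j : int) : exists i, j = i * 2 \/ j = i * 2 + 1.
Proof.
exists (divz j 2); have := divz_eq j 2; have := modz_ge0 j (isT : (2 : int) != 0).
by have := ltz_pmod j (isT : (0 : int) < 2); lia.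
Qed.

Lemma vertex_halves (i : int) :
  vertex (halves F) (i * 2) = zadd (vertex F i) (vertex F i) /\
  vertex (halves F) (i * 2 + 1) = zadd (vertex F i) (vertex F (i + 1)).
Proof.
have H (j : int) (a := zmod_nat n.*2 j) :
    vertex (halves F) j = zadd (nvtx F a./2) (nvtx F (uphalf a)).
  by rewrite /vertex size_halves nth_mkseq // zmod_nat_lt.
rewrite !H; split.
  have [m em] := zmod_natP (i * 2) n20; move: em; set a := zmod_nat _ _ => em.
  have e : a./2%:Z = i + n%:Z * m /\ uphalf a = a./2.
    by rewrite uphalf_half; have := odd_double_half a; move: em; rewrite -!muln2; lia.
  by case: e => e ->; rewrite (nvtxE e).
have [m em] := zmod_natP (i * 2 + 1) n20; move: em; set a := zmod_nat _ _ => em.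
have e : a./2%:Z = i + n%:Z * m /\ (uphalf a)%:Z = i + 1 + n%:Z * m.
  by rewrite uphalf_half; have := odd_double_half a; move: em; rewrite -!muln2; lia.
by case: e => e e'; rewrite (nvtxE e) (nvtxE e').
Qed.

Lemma nth_turns (i : int) :
  nth 0%bz (turns F) (zmod_nat n.*2 (i * 2)) = zsup (turn F i) /\
  nth 0%bz (turns F) (zmod_nat n.*2 (i * 2 + 1)) = zsup (turn F (i + 1)).
Proof.
split; rewrite nth_mkseq ?zmod_nat_lt //; congr zsup.
  have [m em] := zmod_natP (i * 2) n20; move: em; set a := zmod_nat _ _ => em.
  apply: (@nturnE _ _ m).
  by rewrite uphalf_half; have := odd_double_half a; move: em; rewrite -!muln2; lia.
have [m em] := zmod_natP (i * 2 + 1) n20; move: em; set a := zmod_nat _ _ => em.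
apply: (@nturnE _ _ m).
by rewrite uphalf_half; have := odd_double_half a; move: em; rewrite -!muln2; lia.
Qed.

Lemma polygon_halves_even (i : int) (y : R) : (i * 2)%:~R <= y <= (i * 2)%:~R + 1 ->
  polygon (u / 2) (halves F) y =
    zvec u (vertex F i) + (y / 2 - i%:~R) *: zvec u (edge_vec F i).
Proof.
move=> h; rewrite (polygon_closed _ _ h); have [-> ->] := vertex_halves i.
rewrite !zvecD edge_vecE intrM -[2%:~R]/(2 : R).
by apply/rowP => c; rewrite !mxE; field.
Qed.

Lemma polygon_halves_odd (i : int) (y : R) :
    (i * 2 + 1)%:~R <= y <= (i * 2 + 1)%:~R + 1 ->
  polygon (u / 2) (halves F) y =
    zvec u (vertex F (i + 1)) + (y / 2 - (i + 1)%:~R) *: zvec u (edge_vec F i).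
Proof.
move=> h; rewrite (polygon_closed _ _ h); have [_ ->] := vertex_halves i.
have -> : i * 2 + 1 + 1 = (i + 1) * 2 by ring.
have [-> _] := vertex_halves (i + 1).
rewrite !zvecD edge_vecE !intrD intrM -[2%:~R]/(2 : R) -[1%:~R]/(1 : R).
by apply/rowP => c; rewrite !mxE; field.
Qed.

Lemma polygon_halves (x : R) : polygon (u / 2) (halves F) (x * 2) = polygon u F x.
Proof.
have x01 := frac_itv x; set i := Num.floor x in x01.
rewrite (@polygon_closed _ u F i); last by move: x01; lra.
rewrite /lerp -edge_vecE; have x2 : x * 2 / 2 = x by field.
have [h|h] := leP x (i%:~R + 1 / 2).
  rewrite (@polygon_halves_even i); first by rewrite x2.
  by rewrite intrM -[2%:~R]/(2 : R); move: x01; lra.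
rewrite (@polygon_halves_odd i); last first.
  by rewrite intrD intrM -[2%:~R]/(2 : R) -[1%:~R]/(1 : R); move: x01; lra.
rewrite x2 edge_vecE intrD -[1%:~R]/(1 : R).
by apply/rowP => c; rewrite !mxE; ring.
Qed.

Lemma rounded_deviation (j : int) : exists c : int,
  nth 0%bz (turns F) (zmod_nat n.*2 j) = zsup (turn F c) /\
  forall y : R, j%:~R <= y <= j%:~R + 1 ->
    rounded u F (y / 2) - polygon (u / 2) (halves F) y =
    bump `|y / 2 - c%:~R| *: zvec u (turn F c).
Proof.
have [i [->|->]] := parityz j.
  exists i; split; first by have [] := nth_turns i.
  move=> y h; rewrite (polygon_halves_even h).
  move: h; rewrite intrM -[2%:~R]/(2 : R) => h.
  rewrite (@rounded_piece _ u F F0 i); last by lra.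
  rewrite corner_pieceE ifF; last by apply/negbTE; rewrite -leNgt; lra.
  by rewrite [_ + bump _ *: _]addrC addrK.
exists (i + 1); split; first by have [] := nth_turns i.
move=> y h; rewrite (polygon_halves_odd h).
have e : (i * 2 + 1)%:~R = i%:~R * 2 + 1 :> R by rewrite intrD intrM.
rewrite e in h.
have i1 : (i + 1)%:~R = i%:~R + 1 :> R by rewrite intrD.
rewrite (@rounded_piece _ u F F0 (i + 1)); last by rewrite i1; lra.
rewrite corner_pieceE addrK i1; case: ltP => h'.
  by rewrite [_ + bump _ *: _]addrC addrK.
have -> : y / 2 - (i%:~R + 1) = 0 by lra.
by rewrite !scale0r !addr0 [_ + bump _ *: _]addrC addrK.
Qed.

Lemma bump_dist (a b : R) : `|bump `|a| - bump `|b| | <= 1 / 2 * `|a - b|.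
Proof.
wlog ab : a b / `|a| <= `|b|.
  move=> h; have [/h //|/ltW/h] := leP `|a| `|b|.
  by rewrite distrC (distrC a).
have := @bump_lip R `|a| `|b|; rewrite normr_ge0 ab => /(_ isT) /andP[h1 h2].
rewrite ger0_norm //; apply: le_trans h2 _; rewrite ler_wpM2l //.
by rewrite distrC; apply: le_trans (ler_norm _) _; exact: ler_dist_dist.
Qed.

Lemma rounded_isotopic : (2 <= n)%N -> dev_ok 49 50 2 0 (halves F) (turns F) ->
  isotopic (polygon u F) (rounded u F).
Proof.
move=> n2 ok; have u20 : 0 < u / 2 by rewrite divr_gt0.
have k01 : 0 <= zr R 49 / zr R 50 < 1.
  by rewrite /zr -[49%:~R]/(49 : R) -[50%:~R]/(50 : R); apply/andP; split; lra.
have z2 : zr R 2 = 2 by rewrite /zr.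
have z0 : zr R 0 = 0 by rewrite /zr.
suff : lip_rel (zr R 49 / zr R 50) (polygon (u / 2) (halves F))
    (fun y => rounded u F (y / 2)).
  move=> /(@lip_isotopic _ _ _ _ k01)[h ah e]; exists h => // x.
  by rewrite -polygon_halves -e mulfK.
(* In the unit [u / 2] and the time [y = 2 x], the slope 1/2 of [bump] becomes half the turn, whence
   [D = 2]. The bound 1/8 on [bump] is a quarter of the turn, exactly half of this slope, so that
   [eps = 0] is enough. *)
apply: (@deviation_lip R (u / 2) u20 49 50 2 0 _ _ _ (halves F) (turns F)) => //.
- by rewrite size_halves size_mkseq.
- by rewrite size_halves -/n; move: n2; rewrite -muln2; lia.
- move=> y; rewrite size_halves -muln2 natrM mulrDl mulfK //.
  exact: rounded_periodic.
- move=> j x y jx jy; rewrite size_halves.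
  have [c [-> dc]] := rounded_deviation j; rewrite !dc // -scalerBl normrZ.
  rewrite (zvec_norm _ (ltW u0)) z2.
  have := bump_dist (x / 2 - c%:~R) (y / 2 - c%:~R).
  have -> : x / 2 - c%:~R - (y / 2 - c%:~R) = (x - y) / 2 by lra.
  rewrite normrM (ger0_norm (_ : 0 <= 2^-1)) //.
  have zc : 0 <= u * zr R (zsup (turn F c)).
    by rewrite -(zvec_norm _ (ltW u0)).
  by move=> /(ler_wpM2r zc); move: (`|x - y|) (`|bump _ - _|) => X Y; lra.
- move=> j x jx; rewrite size_halves.
  have [c [-> dc]] := rounded_deviation j; rewrite dc // normrZ.
  rewrite (zvec_norm _ (ltW u0)) z2 z0.
  have /andP[b0 b1] := bump_itv (normr_ge0 (x / 2 - c%:~R)).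
  have zc : 0 <= u * zr R (zsup (turn F c)).
    by rewrite -(zvec_norm _ (ltW u0)).
  by rewrite ger0_norm //; move: b1 => /(ler_wpM2r zc); lra.
Qed.

End RoundingLink.

(** * Deviation of a trigonometric curve from its chords *)

Section Interpolation.
Variable R : realType.
Variables (f f1 f2 : R -> R) (M : R).
Hypotheses (df : forall t, is_derive t (1 : R) f (f1 t))
           (df1 : forall t, is_derive t (1 : R) f1 (f2 t))
           (f2M : forall t, - M <= f2 t <= M).

Let sqr_derive x t : is_derive t (1 : R) (fun t => M / 2 * ((t - x) * (t - x)))
  (M * (t - x)).
Proof.
have d0 := is_derive_affine 1 (- x) t.
have d := is_deriveM (is_derive_cst (M / 2) t (1 : R)) (is_deriveM d0 d0).
have -> : (fun t => M / 2 * ((t - x) * (t - x))) =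
    (fun t => M / 2 * ((1 * t + - x) * (1 * t + - x))).
  by apply/funext => z; rewrite mul1r.
by apply: (is_derive_eq d); rewrite /GRing.scale /=; lra.
Qed.

Let f1_lip x y : x <= y -> - (M * (y - x)) <= f1 y - f1 x <= M * (y - x).
Proof.
by move=> xy; have := mean_value xy df1 (fun t _ => f2M t); rewrite mulNr.
Qed.

Let M0 : 0 <= M.
Proof. by have := f2M 0; lra. Qed.

Lemma taylor_right x b : x <= b <= x + 1 ->
  - (M / 2 * ((b - x) * (b - x))) <= f b - f x - f1 x * (b - x)
    <= M / 2 * ((b - x) * (b - x)).
Proof.
move=> /andP[xb bx].
pose q t := M / 2 * ((t - x) * (t - x)).
have dq t : is_derive t (1 : R) q (M * (t - x)) := sqr_derive x t.
have dl t := is_derive_affine (f1 x) 0 t.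
have d1 t := is_deriveB (is_deriveB (df t) (dl t)) (dq t).
have d2 t := is_deriveD (is_deriveB (df t) (dl t)) (dq t).
have tx t : x <= t <= b -> 0 <= M * (t - x) <= M.
  move=> /andP[h1 h2]; rewrite mulr_ge0 ?subr_ge0 //=.
  by rewrite -[leRHS]mulr1 ler_wpM2l //; lra.
(* [mean_value] wants bounds on both sides; only the bound 0 matters here and in [b2], the other one
   is a crude estimate using [t - x <= 1]. *)
have b1 t : x <= t <= b -> - (2 * M) <= f1 t - f1 x - M * (t - x) <= 0.
  by move=> h; have := tx t h; case/andP: h => /f1_lip; lra.
have b2 t : x <= t <= b -> 0 <= f1 t - f1 x + M * (t - x) <= 2 * M.
  by move=> h; have := tx t h; case/andP: h => /f1_lip; lra.
have /andP[_] := mean_value xb d1 b1; have /andP[+ _] := mean_value xb d2 b2.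
rewrite !mul0r /q !fctE subrr mulr0 mulr0.
by move=> h1 h2; apply/andP; split; lra.
Qed.

End Interpolation.

Section ChordInterpolation.
Variable R : realType.

Lemma is_derive_opp_arg (f f1 : R -> R) : (forall t, is_derive t (1 : R) f (f1 t)) ->
  forall t, is_derive t (1 : R) (fun t => f (- t)) (- f1 (- t)).
Proof.
move=> df t; have d := @is_derive1_comp R f _ t _ _ (df (-1 * t + 0))
  (is_derive_affine (-1) 0 t).
have -> : (fun t => f (- t)) = f \o (fun t => -1 * t + 0).
  by apply/funext => z /=; rewrite mulN1r addr0.
by apply: (is_derive_eq d); rewrite mulrN1 mulN1r addr0.
Qed.

Lemma taylor_left (f f1 f2 : R -> R) (M x a : R) :
    (forall t, is_derive t (1 : R) f (f1 t)) ->
    (forall t, is_derive t (1 : R) f1 (f2 t)) ->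
    (forall t, - M <= f2 t <= M) -> a <= x <= a + 1 ->
  - (M / 2 * ((a - x) * (a - x))) <= f a - f x - f1 x * (a - x)
    <= M / 2 * ((a - x) * (a - x)).
Proof.
move=> df df1 f2M ax.
have d2 t : is_derive t (1 : R) (fun t => - f1 (- t)) (f2 (- t)).
  have d := is_deriveN (is_derive_opp_arg df1 t).
  by apply: (is_derive_eq d); rewrite opprK.
have := @taylor_right _ _ _ (fun t => f2 (- t)) M (is_derive_opp_arg df) d2
  (fun t => f2M (- t)) (- x) (- a).
have h : - x <= - a <= - x + 1 by case/andP: ax => h1 h2; apply/andP; split; lra.
by rewrite !opprK => /(_ h); lra.
Qed.

(** Taylor expansions at [t] towards both ends bound the difference between the slope at [t] and
    that of the chord by [M / 2 * (p^2 + q^2)], with [p = t - a] and [q = a + 1 - t]. As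
    [p + q = 1], the sum of squares is [1 - 2 p q <= 1]. *)
Lemma chord_lip (f f1 f2 : R -> R) (M a x y : R) :
    (forall t, is_derive t (1 : R) f (f1 t)) ->
    (forall t, is_derive t (1 : R) f1 (f2 t)) ->
    (forall t, - M <= f2 t <= M) -> a <= x <= a + 1 -> a <= y <= a + 1 ->
  `|(f x - x * (f (a + 1) - f a)) - (f y - y * (f (a + 1) - f a))|
    <= M / 2 * `|x - y|.
Proof.
move=> df df1 f2M; set S := f (a + 1) - f a.
wlog xy : x y / y <= x.
  move=> h ax ay; have [/h|/ltW/h] := leP y x; first exact.
  by rewrite distrC (distrC x); apply.
move=> ax ay; rewrite [in leRHS]ger0_norm ?subr_ge0 //.
have M0 : 0 <= M by have := f2M 0; lra.
have d t : is_derive t (1 : R) (fun t => f t - t * S) (f1 t - S).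
  have -> : (fun t => f t - t * S) = (fun t => f t + (- S * t + 0)).
    by apply/funext => z; ring.
  exact: is_deriveD (df t) (is_derive_affine (- S) 0 t).
have b t : y <= t <= x -> - (M / 2) <= f1 t - S <= M / 2.
  move=> /andP[yt tx]; move: ax ay => /andP[ax xa] /andP[ay ya].
  have h1 : t <= a + 1 <= t + 1 by apply/andP; split; lra.
  have h2 : a <= t <= a + 1 by apply/andP; split; lra.
  have := taylor_right df df1 f2M h1; have := taylor_left df df1 f2M h2.
  rewrite /S; have p0 : 0 <= t - a by lra.
  have q0 : 0 <= a + 1 - t by lra.
  have := mulr_ge0 M0 (mulr_ge0 p0 q0).
  by move: (f (a + 1)) (f a) (f t) (f1 t) => A B C D; lra.
by have := mean_value xy d b; rewrite ler_norml mulNr.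
Qed.

Section Waves.
Variables (A1 A2 A3 a1 a2 a3 p : R).

(** The products of the braid parametrization expand into the frequencies 3, 7 and 1. The common
    phase is 0 for cosines and -pi/2 for sines. *)
Definition waves (x : R) : R :=
  A1 * cos (a1 * x + p) + A2 * cos (a2 * x + p) + A3 * cos (a3 * x + p).

Lemma is_derive_cosa (A a t : R) : is_derive t (1 : R)
  (fun x => A * cos (a * x + p)) (- (A * a) * sin (a * t + p)).
Proof.
have d := is_deriveM (is_derive_cst A t (1 : R))
  (@is_derive1_comp R cos _ t _ _ (is_derive_cos (a * t + p)) (is_derive_affine a p t)).
by apply: (is_derive_eq d); rewrite /GRing.scale /=; ring.
Qed.

Lemma is_derive_sina (A a t : R) : is_derive t (1 : R)
  (fun x => A * sin (a * x + p)) (A * a * cos (a * t + p)).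
Proof.
have d := is_deriveM (is_derive_cst A t (1 : R))
  (@is_derive1_comp R sin _ t _ _ (is_derive_sin (a * t + p)) (is_derive_affine a p t)).
by apply: (is_derive_eq d); rewrite /GRing.scale /=; ring.
Qed.

Lemma waves_chord (M a x y : R) :
    `|A1| * a1 ^+ 2 + `|A2| * a2 ^+ 2 + `|A3| * a3 ^+ 2 <= M ->
    a <= x <= a + 1 -> a <= y <= a + 1 ->
  `|(waves x - x * (waves (a + 1) - waves a)) -
    (waves y - y * (waves (a + 1) - waves a))| <= M / 2 * `|x - y|.
Proof.
move=> hM.
pose f1 x := - (A1 * a1) * sin (a1 * x + p) + - (A2 * a2) * sin (a2 * x + p)
  + - (A3 * a3) * sin (a3 * x + p).
pose f2 x := - (A1 * a1) * a1 * cos (a1 * x + p) + - (A2 * a2) * a2 * cos (a2 * x + p)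
  + - (A3 * a3) * a3 * cos (a3 * x + p).
apply: (@chord_lip waves f1 f2).
- move=> t; exact: is_deriveD (is_deriveD (is_derive_cosa _ _ _) (is_derive_cosa _ _ _))
    (is_derive_cosa _ _ _).
- move=> t; exact: is_deriveD (is_deriveD (is_derive_sina _ _ _) (is_derive_sina _ _ _))
    (is_derive_sina _ _ _).
move=> t; rewrite -ler_norml; apply: le_trans hM.
have term A a' : `|- (A * a') * a' * cos (a' * t + p)| <= `|A| * a' ^+ 2.
  have -> : - (A * a') * a' * cos (a' * t + p) = - (A * a' ^+ 2 * cos (a' * t + p)).
    by ring.
  rewrite normrN normrM normrM (ger0_norm (sqr_ge0 a')) ler_piMr //.
    by rewrite mulr_ge0 ?sqr_ge0.
  by rewrite ler_norml cos_geN1 cos_le1.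
apply: le_trans (ler_normD _ _) _; apply: lerD; last exact: term.
by apply: le_trans (ler_normD _ _) _; apply: lerD; exact: term.
Qed.

End Waves.

End ChordInterpolation.

(** * A certified table of sines and cosines of the multiples of pi/48 *)

Section TrigTable.
Local Open Scope Z_scope.

(* Triples [(c, s, e)] such that [scale * cos (n pi / 48)] and
   [scale * sin (n pi / 48)] are within [e] of [c] and [s]. *)
Definition scale : Z := 1000000000000.
(** A rotation by pi/48 with integer division; the two constants approximate [scale] times its
    cosine and sine, and the factor of [e] is their sum. *)
Definition trig_next (t : zpt) : zpt :=
  let: (c, s, e) := t in
  ((c * 997858923238 - s * 65403129232) / scale,
   (s * 997858923238 + c * 65403129232) / scale,
   e * 1063262052470 / scale + 12).

Definition trig_table : seq zpt := traject trig_next (scale, 0, 0) 96.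

(** Eighty times the flattened braid has coordinates [160 cos 3x + 40 cos 7x + 40 cos x],
    [160 sin 3x + 40 sin 7x - 40 sin x] and [40 sin 8x]. The tolerance 51/100 allows rounding to
    integers, plus 1/100 for the table. *)
Definition near_vertex (t1 t3 t7 t8 v : zpt) : bool :=
  let: (c1, s1, e1) := t1 in let: (c3, s3, e3) := t3 in
  let: (c7, s7, e7) := t7 in let: (c8, s8, e8) := t8 in
  let: (x, y, z) := v in
  let e := 160 * e3 + 40 * e7 + 40 * e1 in
  let ok d e := 100 * (Z.abs d + e) <=? 51 * scale in
  if ok (160 * c3 + 40 * c7 + 40 * c1 - scale * x) e then
  if ok (160 * s3 + 40 * s7 - 40 * s1 - scale * y) e then
     ok (40 * s8 - scale * z) (40 * e8)
  else false else false.

Definition near_vertices (F : seq zpt) : bool :=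
  let T := trig_table in
  let t k := nth p0 T (k %% 96)%N in
  lazy_all (fun m => near_vertex (t m) (t (3 * m)%N) (t (7 * m)%N) (t (8 * m)%N)
                       (nth p0 F m)) (iota 0 96).

End TrigTable.

Section TrigTableSound.
Variable R : realType.

Definition mesh : R := pi / 48.

Lemma zr0 : zr R 0 = 0.
Proof. by rewrite -[0%bz]/(0 - 0)%bz zrB subrr. Qed.

(* A section variable stands for [zr R], because tactics would try to compute
   the unary integers that [zr R] builds from large literals. *)
Variable q : Z -> R.
Hypothesis qE : q =1 zr R.

Let qD x y : q (x + y)%bz = q x + q y. Proof. by rewrite !qE zrD. Qed.
Let qB x y : q (x - y)%bz = q x - q y. Proof. by rewrite !qE zrB. Qed.
Let qM x y : q (x * y)%bz = q x * q y. Proof. by rewrite !qE zrM. Qed.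
Let q_le x y : (x <=? y)%bz = (q x <= q y). Proof. by rewrite !qE (zr_le R). Qed.
Let q_lt x y : (x <? y)%bz = (q x < q y). Proof. by rewrite !qE (zr_lt R). Qed.
Let q0 : q 0%bz = 0. Proof. by rewrite qE zr0. Qed.
Let le_q x y : (x <=? y)%bz -> q x <= q y. Proof. by rewrite q_le. Qed.
Let q_gt0 x : (0 <? x)%bz -> 0 < q x. Proof. by rewrite q_lt q0. Qed.

Let q_literals : [/\ q 2 = 2, q 997 = 997, q 1000 = 1000, q 655 = 655 & q 10000 = 1000 * 10].
Proof.
have e n : q (Z.of_nat n) = n%:R by rewrite qE /zr (_ : int_of_Z _ = n%:Z) //; lia.
have -> : 10000%bz = (1000 * 10)%bz by [].
by rewrite qM (e 2%N) (e 997%N) (e 1000%N) (e 655%N) (e 10%N).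
Qed.

Notation N := (q scale).

Let scale_gt0 : 0 < N. Proof. exact: q_gt0. Qed.

Let le_sq (y z : R) : 0 < y -> 0 < z -> y * y <= z * z -> y <= z.
Proof. by move=> /ltW y0 /ltW z0; rewrite -!expr2 ler_sqr ?nnegrE. Qed.

(** The identity [2 cos(x/2)^2 = 1 + cos x], multiplied by [M^2], reduces the bounds to comparisons
    of squares. *)
Lemma half_angle_scaled (M a b lo hi x : R) : 0 < M -> 0 < cos (x / 2) ->
    a <= M * cos x <= b -> 0 < lo -> 0 < hi ->
    2 * (lo * lo) <= M * (M + a) -> M * (M + b) <= 2 * (hi * hi) ->
  lo <= M * cos (x / 2) <= hi.
Proof.
move=> M0 c0 /andP[ax xb] lo0 hi0.
have cx : cos x = 2 * (cos (x / 2) * cos (x / 2)) - 1.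
  have {1}-> : x = x / 2 *+ 2 by rewrite -mulr_natr divfK.
  by rewrite cos_mulr2n expr2; lra.
move=> loa hib; have d0 : 0 < M * cos (x / 2) by rewrite mulr_gt0.
have e : 2 * (M * cos (x / 2) * (M * cos (x / 2))) = M * (M + M * cos x).
  by rewrite cx; ring.
have ax' := ler_wpM2l (ltW M0) ax; have xb' := ler_wpM2l (ltW M0) xb.
by apply/andP; split; apply: le_sq => //; lra.
Qed.

Lemma half_angle_bounds (a b lo hi : Z) (x : R) : 0 < cos (x / 2) ->
    q a <= N * cos x <= q b -> (0 <? lo)%bz -> (0 <? hi)%bz ->
    (2 * (lo * lo) <=? scale * (scale + a))%bz ->
    (scale * (scale + b) <=? 2 * (hi * hi))%bz ->
  q lo <= N * cos (x / 2) <= q hi.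
Proof.
have [z2 _ _ _ _] := q_literals.
move=> c0 ab; rewrite !q_lt !q_le !(qM, qD) q0 z2.
exact: half_angle_scaled scale_gt0 c0 ab.
Qed.

(** Four halvings of the angle pi/3, whose cosine is 1/2, lead to pi/48. *)
Lemma cos_mesh : q 997858923238 <= N * cos mesh <= q 997858923239.
Proof.
have p0 := pi_gt0 R; have N0 := scale_gt0.
have c0 (x : R) : 0 < x <= pi / 3 -> 0 < cos (x / 2).
  by move=> /andP[x0 x1]; apply: cos_gt0_pihalf; lra.
have h0 : q 500000000000 <= N * cos (pi / 3) <= q 500000000000.
  have -> : N = 2 * q 500000000000.
    have [<- _ _ _ _] := q_literals.
    by have -> : scale = (2 * 500000000000)%bz by []; rewrite qM.
  by rewrite cos_pi3; apply/andP; split; lra.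
have h1 : q 866025403784 <= N * cos (pi / 3 / 2) <= q 866025403785.
  by apply: (half_angle_bounds _ h0) => //; apply: c0; lra.
have h2 : q 965925826288 <= N * cos (pi / 3 / 2 / 2) <= q 965925826290.
  by apply: (half_angle_bounds _ h1) => //; apply: c0; lra.
have h3 : q 991444861373 <= N * cos (pi / 3 / 2 / 2 / 2) <= q 991444861375.
  by apply: (half_angle_bounds _ h2) => //; apply: c0; lra.
have -> : mesh = pi / 3 / 2 / 2 / 2 / 2 by rewrite /mesh; lra.
by apply: (half_angle_bounds _ h3) => //; apply: c0; lra.
Qed.

(** Obtained from [sin^2 = 1 - cos^2]. An uncertainty in the cosine is multiplied by the cotangent
    of pi/48, about 15, which explains the wider interval. *)
Lemma sin_mesh : q 65403129224 <= N * sin mesh <= q 65403129240.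
Proof.
have p0 := pi_gt0 R; have /andP[c0 c1] := cos_mesh; have N0 := scale_gt0.
have s0 : 0 < N * sin mesh.
  by rewrite mulr_gt0 //; apply: sin_gt0_pi; rewrite /mesh; lra.
have cs : N * sin mesh * (N * sin mesh) = N * N - N * cos mesh * (N * cos mesh).
  by have := cos2Dsin2 mesh; rewrite !expr2 => /(congr1 (fun z => N * N * z)); lra.
have h1 : N * cos mesh * (N * cos mesh) <= q (997858923239 * 997858923239)%bz.
  by rewrite qM; apply: ler_pM => //; apply: le_trans c0; apply: ltW; exact: q_gt0.
have h2 : q (997858923238 * 997858923238)%bz <= N * cos mesh * (N * cos mesh).
  by rewrite qM; apply: ler_pM => //; apply: ltW; exact: q_gt0.
apply/andP; split; apply: le_sq => //; rewrite ?q_gt0 // cs -!qM.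
  apply: le_trans (_ : q (scale * scale - 997858923239 * 997858923239)%bz <= _).
    exact: le_q.
  by rewrite qB; rewrite qM; lra.
apply: le_trans (_ : _ <= q (scale * scale - 997858923238 * 997858923238)%bz) _.
  by rewrite qB; rewrite qM; lra.
exact: le_q.
Qed.

(** An upper bound on pi through [x cos x <= sin x]: the difference [sin x - x cos x] has derivative
    [x sin x >= 0]. So [mesh] is at most its tangent, below [(655/10000) / (997/1000)]. *)
Lemma mesh_le : 0 < mesh /\ mesh <= 657 / 10000.
Proof.
have p0 := pi_gt0 R; have m0 : 0 < mesh by rewrite /mesh; lra.
split=> //; have m1 : 0 <= mesh by exact: ltW.
pose f (x : R) := sin x + -1 * (x * cos x).
have df t : is_derive t (1 : R) f (t * sin t).
  have d := is_deriveD (is_derive_sin t) (is_deriveM (is_derive_cst (-1 : R) t (1 : R))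
    (is_deriveM (is_derive_id t (1 : R)) (is_derive_cos t))).
  by apply: (is_derive_eq d); rewrite /GRing.scale /=; ring.
have b t : 0 <= t <= mesh -> 0 <= t * sin t <= mesh.
  move=> /andP[t0 tm]; have st : 0 <= sin t.
    by apply: sin_ge0_pi; rewrite t0 (le_trans tm) // /mesh; lra.
  by rewrite mulr_ge0 //= -[leRHS]mulr1 ler_pM // sin_le1.
have /andP[+ _] := mean_value m1 df b.
rewrite /f sin0 !(mul0r, mulr0, addr0, subr0) => h.
have N0 := scale_gt0.
have /andP[c0 _] := cos_mesh; have /andP[_ s1] := sin_mesh.
have [_ e1 e2 e3 e4] := q_literals.
have c1 : N * 997 <= q 997858923238 * 1000.
  by rewrite -e1 -e2 -!qM; exact: le_q.
have s2 : q 65403129240 * (1000 * 10) <= N * 655.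
  by rewrite -e3 -e4 -!qM; exact: le_q.
have c2 : 997 / 1000 <= cos mesh by rewrite -(ler_pM2l N0); move: c0 s1 c1 s2 {h p0 m0 m1 f df b e1 e2 e3 e4}; lra.
have s3 : sin mesh <= 655 / 10000 by rewrite -(ler_pM2l N0); move: c0 s1 c1 s2 {h p0 m0 m1 f df b e1 e2 e3 e4}; lra.
have := ler_wpM2l m1 c2.
move: (cos mesh) (sin mesh) mesh h s3 {p0 m0 m1 f df b N0 c0 s1 e1 e2 e3 e4 c1 s2 c2} => u v m; lra.
Qed.

Definition trig_near (n : nat) (t : zpt) : Prop :=
  `|N * cos (mesh *+ n) - q t.1.1| <= q t.2 /\
  `|N * sin (mesh *+ n) - q t.1.2| <= q t.2.

Let q_div (x : Z) : N * q (x / scale)%bz <= q x < N * q (x / scale)%bz + N.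
Proof.
rewrite -qM -qD -q_le -q_lt; apply/andP.
have := Z.mod_pos_bound x scale erefl; have := Z_div_mod_eq_full x scale.
by move: scale => n; lia.
Qed.

(** The error of one angle addition: the old error [e] times [a1 + b1], the errors 1 and 8 of the
    two constants times [M], and at most [M] for each of the two integer divisions. The total fits
    in the 12 added by [trig_next]. *)
Lemma rounded_product (M A B a b a1 b1 A1 B1 e e1 r : R) : 0 < M ->
    `|A| <= M -> `|B| <= M -> 0 <= a1 -> 0 <= b1 ->
    `|A - a| <= e -> `|B - b| <= e -> `|A1 - a1| <= 1 -> `|B1 - b1| <= 8 ->
    M * e1 <= e * (a1 + b1) < M * e1 + M ->
    M * r <= a * a1 + b * b1 < M * r + M ->
  `|(A * A1 + B * B1) - M * r| <= M * (e1 + 12).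
Proof.
move=> M0 AM BM a0 b0 Ae Be A1e B1e e1b rb.
have h1 := ler_pM (normr_ge0 _) a0 Ae (lexx a1).
have h2 := ler_pM (normr_ge0 _) b0 Be (lexx b1).
have h3 := ler_pM (normr_ge0 _) (normr_ge0 _) AM A1e.
have h4 := ler_pM (normr_ge0 _) (normr_ge0 _) BM B1e.
move: h1 h2; rewrite -{1}(ger0_norm a0) -{1}(ger0_norm b0) -!normrM => h1 h2.
rewrite -!normrM in h3 h4.
have e' : A * A1 + B * B1 - (a * a1 + b * b1) =
  (A - a) * a1 + (B - b) * b1 + A * (A1 - a1) + B * (B1 - b1) by ring.
move: h1 h2 h3 h4 e'; rewrite !ler_norml.
set X1 := (A - a) * a1; set X2 := (B - b) * b1.
set X3 := A * (A1 - a1); set X4 := B * (B1 - b1).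
move: X1 X2 X3 X4 rb e1b => X1 X2 X3 X4; rewrite mulrDr.
move: (A * A1 + B * B1) (a * a1 + b * b1) (e * a1) (e * b1) => P p x y.
move=> {A B a b A1 B1 a1 b1 AM BM a0 b0 Ae Be A1e B1e e}; lra.
Qed.

Let cos_mesh_near : `|N * cos mesh - q 997858923238| <= 1.
Proof.
have -> : (1 : R) = q 1 by rewrite qE.
have /andP[h1] := cos_mesh.
rewrite (_ : 997858923239%bz = (997858923238 + 1)%bz) // qD => h2.
by rewrite ler_distlC; apply/andP; split; lra.
Qed.

Let sin_mesh_near : `|N * sin mesh - q 65403129232| <= 8.
Proof.
have -> : (8 : R) = q 8 by rewrite qE.
have /andP[] := sin_mesh.
rewrite (_ : 65403129240%bz = (65403129232 + 8)%bz) //.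
rewrite (_ : 65403129224%bz = (65403129232 - 8)%bz) // qD qB => h1 h2.
by rewrite ler_distlC; apply/andP; split; lra.
Qed.

Let trig_nextP n t : trig_near n t -> trig_near n.+1 (trig_next t).
Proof.
case: t => [[c s] e] [/= hc hs]; rewrite /trig_near /trig_next /=.
have N0 := scale_gt0.
have NM x : `|x| <= 1 -> `|N * x| <= N.
  by move=> x1; rewrite normrM (gtr0_norm N0) -[leRHS]mulr1 ler_pM2l.
have cN : `|N * cos (mesh *+ n)| <= N by rewrite NM // ler_norml cos_geN1 cos_le1.
have sN : `|N * sin (mesh *+ n)| <= N by rewrite NM // ler_norml sin_geN1 sin_le1.
have c10 : 0 <= q 997858923238 by apply/ltW/q_gt0.
have s10 : 0 <= q 65403129232 by apply/ltW/q_gt0.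
have hN (x y z : R) : `|x - y| <= z -> `|- x - - y| <= z by rewrite opprK (addrC (- x)) distrC.
have q12 : q 12 = 12 by rewrite qE.
have := cos_mesh_near; have := sin_mesh_near; move: c10 s10.
have := q_div (e * 1063262052470).
have -> : q (e * 1063262052470) = q e * (q 997858923238 + q 65403129232).
  by rewrite -qD -qM.
have := q_div (c * 997858923238 - s * 65403129232).
have -> : q (c * 997858923238 - s * 65403129232) =
    q c * q 997858923238 + (- q s) * q 65403129232.
  by rewrite qB !qM mulNr.
have := q_div (s * 997858923238 + c * 65403129232).
have -> : q (s * 997858923238 + c * 65403129232) =
    q s * q 997858923238 + q c * q 65403129232.
  by rewrite qD !qM.
move: (_ / scale)%bz (_ / scale)%bz (_ / scale)%bz => s' c' e' bs bc be c10 s10 ds dc.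
rewrite mulrSr cosD sinD qD q12.
have hC := rounded_product N0 cN (_ : `|- (N * sin (mesh *+ n))| <= N) c10 s10 hc
  (hN _ _ _ hs) dc ds be bc.
have hS := rounded_product N0 sN cN c10 s10 hs hc dc ds be bs.
split; rewrite -(ler_pM2l N0) -[X in X * `|_|](gtr0_norm N0) -normrM.
  by apply: le_trans (hC _); rewrite ?normrN //; rewrite le_eqVlt; apply/orP; left; apply/eqP; congr `|_|; ring.
by apply: le_trans hS; rewrite le_eqVlt; apply/orP; left; apply/eqP; congr `|_|; ring.
Qed.

Lemma trig_tableP n : trig_near n (nth p0 trig_table (n %% 96)).
Proof.
have periodic : trig_near n = trig_near (n %% 96).
  rewrite /trig_near {1 2}(divn_eq n 96) addnC mulrnDr mulnC mulrnA.
  have -> : mesh *+ 96 = pi *+ 2 :> R by rewrite /mesh; field.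
  by rewrite (periodicn (@cosD2pi R)) (periodicn (@sinD2pi R)).
rewrite periodic /trig_table (set_nth_default (scale, 0, 0)%bz) ?size_traject ?ltn_pmod //.
rewrite nth_traject ?ltn_pmod //.
elim: (n %% 96)%N => [|m IH]; last by rewrite iterS; exact: trig_nextP.
rewrite /trig_near /= mulr0n cos0 sin0 mulr1 mulr0 subrr q0.
by split; rewrite ?subr0 normr0.
Qed.

End TrigTableSound.

(** * The explicit list of polygons and its verification *)

Section Deformation.
Local Open Scope Z_scope.

Fixpoint pts (s : seq Z) : seq zpt :=
  if s is x :: y :: z :: s' then (x, y, z) :: pts s' else [::].

(** Integral approximations of 80 times the points of the closed braid with halved height, at the
    multiples of pi/48; [start_near] certifies them. *)
Definition start : seq zpt := pts [::
   240;0;0;233;46;20;212;88;35;180;120;40;141;141;35;100;150;20;61;148;0;27;137;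
   -20;0;120;-35;-20;101;-40;-35;84;-35;-46;69;-20;-57;57;0;-69;46;20;-84;35;35;
   -101;20;40;-120;0;35;-137;-27;20;-148;-61;0;-150;-100;-20;-141;-141;-35;-120;
   -180;-40;-88;-212;-35;-46;-233;-20;0;-240;0;46;-233;20;88;-212;35;120;-180;
   40;141;-141;35;150;-100;20;148;-61;0;137;-27;-20;120;0;-35;101;20;-40;84;35;
   -35;69;46;-20;57;57;0;46;69;20;35;84;35;20;101;40;0;120;35;-27;137;20;-61;
   148;0;-100;150;-20;-141;141;-35;-180;120;-40;-212;88;-35;-233;46;-20;-240;0;
   0;-233;-46;20;-212;-88;35;-180;-120;40;-141;-141;35;-100;-150;20;-61;-148;0;
   -27;-137;-20;0;-120;-35;20;-101;-40;35;-84;-35;46;-69;-20;57;-57;0;69;-46;20;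
   84;-35;35;101;-20;40;120;0;35;137;27;20;148;61;0;150;100;-20;141;141;-35;120;
   180;-40;88;212;-35;46;233;-20;0;240;0;-46;233;20;-88;212;35;-120;180;40;-141;
   141;35;-150;100;20;-148;61;0;-137;27;-20;-120;0;-35;-101;-20;-40;-84;-35;-35;
   -69;-46;-20;-57;-57;0;-46;-69;20;-35;-84;35;-20;-101;40;0;-120;35;27;-137;20;
   61;-148;0;100;-150;-20;141;-141;-35;180;-120;-40;212;-88;-35;233;-46;-20].

(* The polygons follow each other with slowly varying displacements.  Their
   second differences are written in the bits of [codes], low bits first and up
   to the leading one: the coordinate [v] is coded by [|v|] ones, a zero and, if
   [v <> 0], the sign of [v]. *)
Fixpoint bits (p : positive) : seq bool :=
  match p with
  | xH => [::]
  | xO p' => false :: bits p'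
  | xI p' => true :: bits p'
  end.

Fixpoint decode (m : Z) (s : seq bool) : seq Z :=
  match s with
  | [::] => [::]
  | true :: s' => decode (m + 1) s'
  | false :: s' =>
    if m =? 0 then 0 :: decode 0 s' else
    if s' is b :: s'' then (if b then m else - m) :: decode 0 s'' else [::]
  end.

Definition translate (A B : seq zpt) : seq zpt := [seq zadd x.1 x.2 | x <- zip A B].

Definition codes : seq positive := [::
   0x1b7fbf9efdff9feefff3ffcdfff3fffe7dfff3ffff9fdff9ffffcff7f3ffff9fef3ffffe7fb;
   0x13fccf3f9f9cfe7f9cff9f33ffd1fffefee7fffbffdf9fff7ffeff3ff7ff7fcfdfeff37dff7;
   0x1bfffe7fff3ff7fff9ffcfffbfffcfcfffefffe79fffdfff99fffbffc7ffdff8ffefe67fef3;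
   0x17f7fff3ffff7f7fff9fffffbfbfffe7fffffbeffffcffffffb7fffe7ffffe7bfffe7ffff3f;
   0x17ee7ffefdf3ff7f7cfbfef6fff6fbfff6ff7ffddffbffbbffefdefffd7dfffe7f7efffcfff;
   0x1fdfdf7fffdfedffeff9dfeff9efeff9fbeff3fb7f9fcf7fcff3fbfe7e7feff3e7ffdfc7fff;
   0x17f9befffbdfdfffeffbfeffffdfffdffbfffefffff7fbfff7fffffdfbffbfffffefdfeffff;
   0x1eff3fe7ffffbe7fe7ffffc7fcfffffccff9fffff9e7f9fffff3e7e7fffe79e7ffe64feb9f7;
   0x1fdfcfff77fe7f3bffe7cfdfffccff7fff67f7ffbcfbfbe6ef8fbf39ffbf3f3fffbf9fe7fff;
   0x1489249127ffffe7c7ffffe727ffff98ffffacfffebcfffaf9ff9fbf3f9ffbf99fffbfb3ffe;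
   0x16d1b54a029226934a52d55aaa2ad51b4a95369b4da6d36956a8da51b5468da528891224488;
   0x1a546d268d269b486d14aa4d255a6d2693416952694242490d244d29b4a16d5b454da6d5aab;
   0x1d29b4da6d5ab56ad369b4a50a2a6d369b554842ab49a4844d2689248449248442269511349;
   0x1ab4d14a9a2a2215268d2d5a488a921112089134d5b6d2d5ab402d55b6d1521534915034a90;
   0x177cf6fcf3be79bce779cecce49ccce4cccccf19fb27e99eccf6674134a8d1a484290a2b6d5;
   0x1f3b3f3a7d4fd93d99de57caff35fe4dfe5fe37f6dfb5d5f6daeebbaecddaef377dbdeedee7;
   0x19ce799fce4fe63fcd3f367acd72b26f3373ae57daf6bde6de6bf26f277998c99ece7d9e7dc;
   0x1be66f8df4df4fbb9f767773decef4ee99b277a7ba7dd9ddcf6f3b79ddced9c4e6666733cf3;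
   0x1ce7739d9cf733c6724e64e633c6719e33b93ef39efe677f33dfce77ccfbe4fbecef67dde7b;
   0x19cf679d3a9ee9b9af33795e6bcd795e5797db6b7adcbaef5b5f76fabdaf775bcf6f3ede79b;
   0x1679cf3ce7399e63c3ed9eb2b1bc6cbdafb5ee6fbcdef5f7db78de4d989d39eccfb9e7d9e7d;
   0x179f6f3dde66f4f7bcfbde7dde7ddcf76774d736e371ef1ef4f7b3bd9db27664663999ccce6;
   0x1d215296d2a6d5aa5b4a52a6d26824268d269210d1a5e4f793de67bce7de73bce7bc9f7b3ef;
   0x1a3414422112249248422421a5b54b6d5b6d14a5536934912224884240a68d26921a369a346;
   0x1886d2969b48489a4d2a4d2412224492434688a510890dab4aad268d108489a5ab569b4da51;
   0x12a4369b4da52adb6d5aa2adb6daa2a54a349a4d244d2a552ad5ab4dab4dab56955152a556a;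
   0x14489249110244922a549a349a4d1a295054b4ab4da6d36a885268244924244884912448a92;
   0x16db55686d0524546909a549b4da6dab4da6d2a54a6d2ab4a68da6d346d3682d51b4da54448;
   0x1d369b4da51b4da68d1551b4da549a4d242124892492448912244d246d2a6d2db6db6d5ab55;
   0x12a5569b4da54da6d369b4da6d5a55a6d356a90da4d2a349a09122489242134693484d1a34a;
   0x15468da2492449244924890951a4d268d34b569694a52ad5ab6d5a536921a489a349a210294;
   0x1f33cf9ce7e79cfcf33f3fa7e7fb3e7fdcf9f89a4d268d26951b4da52a6da4346d2aa36955a;
   0x1bfeefdff77effb7dff6fdff6fdff6fdfedfbf5f7d7ef5f6b6eacbc6f27bce6ce63cc9e7279;
   0x1a6fd37e9bf75f7aee6ddb449d0674f3d3e7a7ce9e4791c30d8de57f6dfeddfebdff77dff6f;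
   0x179d3e69e6cf3679b3cd3c8f24f99e7ccf3e73f3ccfe727f993fcecfcef3e6f3cde6bcafd5f;
   0x1f9e7f7ce7f7c9fbf4fdfb3f7d9ef677795fa7dfa7dfa7efb3f7b3efa7de9f69d4f34e7a664;
   0x1bb6eeeeedddbb776ed76bb5b6db6d2693b268e934749924c6499899244e99a6773e7f73cfe;
   0x1249d334cd334aced5b2b1b1ba6d3b4dddb428269349a4898cd268d2b6ad2addb76bb6eeeed;
   0x13b2764ed3b66e9b6b6374da774ee9d8ed3a34744c926244926991919132644c924c9999999;
   0x1565adad976ddbb5b5daedb6b76db6d5b6a9a4d2a42134889262492266998ce93a4eccecce9;
   0x1a4891a924c4c932224646a48c89b3346c9a34a9374dd5a0dab4449344486951134a834dab7;
   0x1292269348924884546889a5269349d1d8e9369b1a2a0db563ba6a746d3454849222248a909;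
   0x1429221349a4890da6d29b4a8d241482242449a3456dab6db6db6db6dab56ad555aab4b68a4;
   0x14cecceccf667b33d04854156a8da2a54ab4a54aa922244469044d114a3468809242124951a;
   0x152b1b2e9be9be9bed7dafb5f7b7bdbdedf7b7ddbdbb5d2daa4d2747474924c244d33a671cf;
   0x1a99a6632499999ce4cc9ce39d33a73b35936549dc9dc9d8f74ee9b4a95210a986499a4d041;
   0x193b8d93d8ee9de9dd9dd9da6d974d8ee9ec7a3da763a4c249889a4d1d33b26ccd99d99b269;
   0x1f4de9becf7b9efb3df73becf7d9ef6776776bb54db5444d1a54436924a9229371b2771d93b;
   0x1c9b269349a3468d22424c9331ce9ce984d1a3468c4e261a9a369b46953408084d1514d1ba6;
   0x13efe9f7f4fbfb9f7f79efde7ba6c68a6d369b6db6a95353a9d4c34a52412269364dc9b26ca;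
   0x1fbfefcfbfef9fbfde7df79f7bcfbef3ddce6c9d278cf3a79d39ece7b33bccfb93ef27dc7de;
   0x19de79ef39de79ee79d99dd3695e9df67becfbfb9effbcfbfde7bfef3f7fbf3f7fdf9fdfefc;
   0x19ce79cf39e79e7cf39f3c79f679f73cfb99f799ee73ef39fbce7ef27df4fbd3ba6d9b79373;
   0x13993ccce731e7d9e7dcf3ef3cfbcf3ef93df8fbf67becef73df677dcef1ef27b9cfb3cf1e7;
   0x16952a4d281b4da0a9b569b4dee7def3df79efbd7df6ef7b7d9bdcf7dcf7de7db9fcecfc8f1;
   0x19109122449224a9b4da689a48a9220d2168d1b4d2d2a6d3468d2d369b4a68da4d1a5241a52;
   0x16db6db4a556ad5a689a484491246889152a4d26d51506d36d5b4b41b4a9a48924912112424;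
   0x11b4db4da54da68d1a369b4a6d346d36952695269348244d24489b4da54da6d51b4da6d2a5b;
   0x19a4d268a9a36adb4b4a55a54da54d26892449212488924492488924444369b544d2695268d;
   0x137fdf9bfdfebfeffbbfdff7dfbfdfbeffbfbdff7f4b69b546d3468d1348522249224549a34;
   0x1cff79fe7fde7f9ff79fe7fb9fe7f67f9fa7e7d3cf19c33a73a67793bf677d9bf737fb9bfdf;
   0x164ce934b2fb5f677a77d3bd376689a4c4f63ea7e69fe6cff3b9fe773fcfbcff3ef3fcfef3f;
   0x1f77beefbafb37ecf7d3dccfd9cfc79f93e7e73e7ccf3c9cf273e99f4e733e73cf9ce7e733e;
   0x1cd7eb7ccde7cfbe7cf7e7cf7e73dfc9effa7bfd9dff7aff7edfdfddfbfbbefef7bf7bdfbbd;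
   0x1bdbefbbbef77dddf7b7dd7dddff7f37fbf37f7e7bf7e7bef9f77cf5e7ae73b9e7a7e7c73ce;
   0x130e69e7a79d3cf673a79e9e7a79ecf3d3cf4f3d9e7a73a73a6692a41a4ee9d97a6eaed7bb7;
   0x176dd76b66e9ba769d8e9313132663313130c924cccce4cc9915268d8d97a6e9b1b56889a31;
   0x1bb3bb3b676cd666cc8cf499b3372c9b33b33667727793bc6f57d9bdd776ef6deededddb777;
   0x1a36d5a069349a0690912244891521526922448949a4d1b4aad5b6d5555ab6dab554df66f73;
   0x14d1a42421b4db6adb6ad5aab6d2daaab4da6d3468269224924854a4122489110aa9510845a;
   0x122448848a92269226952448909b4a94d14b56db6adb56db4a6d5aa369b4a94a9349a410504;
   0x1b6db6dab6db6d294da4344426949a491b4d1249248889349b48a34b4a9b49a424222244d21;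
   0x1b6f57bb77b77b77b77b6fb5f6becd1b4daa344021a224d29349a4d269349a545aa55b56da5;
   0x1a5a6d516a92a48918992731e71e71e7a79e9e7d3cf4e78f38f3939d398c8852db451bb6edb;
   0x17a6f4de9baddb6d776ddb7565b6eaad5b6d5ab4da769871324c891a369b40924c9242a68d1;
   0x1abfed7fdcdff7edfdfd7bfd6feb7f2fccddcdd9b66dd6ca99a48c4c9136dbd59349a669365;
   0x1fb79febe7f379febe7faf3fedf3fcde7facff3b3f9d9f3b33dccf76737e677f95feb7f9b7f;
   0x1df79ef73ef79edcfdb9fdbcfbbcf7bcdfbb7bbde6f7cef7cfdfbe7efbcffbee7fdde7fddcf;
   0x1e7a67933c9e7ccf9e73e79cfce73e4f3f4e7d27b1da7b4fb1f679fd3cfe64fe6cf9b9f7bcf;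
   0x177f7fb7dcef4fd93f7c7f7e3fbf27efe3f7f8fbfb3efd9efb3decf7b9becdecee9e99ee4f4;
   0x17aa54d4dab5b6edbaeeb7d77cdde76f3b7d7f337e4df99de67733de9b93ef4fba7e74eafbf;
   0x1cccfcc7f933f99e7f99f9fe73f9fcf3fcfe73fcfe73fcfe4fcfe3e78e7d99b33735cddbbdb;
   0x1f3ef73ee3c3e8e1d73ede7bbe66e4ece7666e66e66cae6b2b979371dc9f667a39264ce664f;
   0x13e7e9cfb9cde365565cdbcdb95cbade6ee76ceecdbadedeaedbedbdbdedefdbdf5efaf7cde;
   0x16bcaf35ca1a3a4fb4ed5b6976d5b6d5b6d6caccde66ccee669cd933330e47371bfdedff677;
   0x134c4c8c889b494c3924084344d295aa4da5244244c4849323232391c938cf13898cd35ccde;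
   0x1b6ca821a2a804d189a49374df4de9d1d268d228b554b69468b414525055b6ad5b5b2b36ad3;
   0x19349a369a30d2619244c9330864669230c88693a4e934acdb3b6b6b4313b2764dab545596d;
   0x1d2693134b2edab4b4b56d5aa5056a956dab2db56963454a9b4a911248d2526d3462694a952;
   0x16189d26f3379d79dbcdbaded1a4c78789f4786ad36ad22db4acb1b21232324883245d376a4;
   0x16b76ed6952a6d24618991ad369e6cf131203485a69374d1b4ed3130989224991a9a9a99a6a;
   0x1dab2a6d5b5a680549a4228874037d5f4f49c48b4b6db56ead6d6eb658290da0156d2edab6b;
   0x14d1a349d10c4c3a492421892331919122610c324c4d99a6b3b66b36ead131992666ccec9b1;
   0x1d24934dab75776eadb7576d5b5a58b6d01b4b556cb5659468d1d15246448984826d2a4d21b;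
   0x1695274989d1868d9372e5e9bda9a4891e4791e261a4814d2adb682454a94a98493a6ead9d8;
   0x1121a4d95a6c6c6d36ad22644322249309b4d4e47469229652b2934913a387235334d49a4d2;
   0x17e93a4d2b2a566b369b4529226922148b4de95226aadb776da5db75bb6d6cb56d14a489134;
   0x189c4e1e1f367ed9f6cf698644c4c489d2766766778dfa6fdcdfbe6f6293d93f64fd3e72792;
   0x1b5d5155b5b6dab2d5a6c6e9b4eecee9a9864cc3a4ec4eeccd992633b33b2764d99d99d9989;
   0x102a40a9521b6d5b44369595963769766ecec99a9b6bbabb5daed76dddbab6ddaed776edb6b;
   0x14d244d2169100b4a9152a42a4d1a21a4d220b4d2044d2889086909a3468a6d3440d2a34809;
   0x16aadb569a52a36d51a44d268a9b4ab5694a95b6d2d345a6951349a349a4d269349a4d2a21a;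
   0x1a952a49186699a4d32322466951a41522436db4dd36cacae9090da749d12489a054695a42b;
   0x146d369b4daa5a1b4a9546885b68a8d269349a51b4868da551a4d26a6d2a6d2a54488a52a54;
   0x1f67af277dcfbee7ef27ee79e9e793993984d2774f6ceef3bb3bb6836ad52d52db4124346d3;
   0x1ece793cf339ccce6739ccf3279c9e64f32732791934749c759bbb7debef5efcf7dfcf77f1e;
   0x1677d9df677d9ef67b67bd3ee4f64f1391cf73d73ede7bef5779edcf736f3bde7773779ae79;
   0x1c3ec7bd3efa7de9f78fbc7de9efa7be9bccde4ecc8c8e44db5766e9df737d9bee6fb9bee6f;
   0x1de67793df4efb3b6adcf773eee7da7d271313480d95c6cb9b66f6beddcddcaf1ba6f72e4e9;
   0x1bb2a5ab6eddd6e371ecce4e7273cce79ccf399e733933939c9cf2664c8c9861236ced9b79e;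
   0x13bc6f2771d8da6921a45b776eebb3bb3b677676e6ee6b99a6a54ec74989c4d134d46c6d5dd;
   0x1a52121055a54a94a83454da510aadab5bbb7766d9eeced9290c2264787a67b99f733dccef3;
   0x136914452d2690a90d0889b4a4d36a94b6d5b56db6954122024222492488122489244954b4d;
   0x177cfeee7db3dd3da746edbbbdb7b7b6a8281b4a44912012688a34a5216ad34505b6d0b4d2d;
   0x1e71cef39df39eff39fdfe79ff7f9cffdfe73ffbfe4ffdfd3fe8ecd9373afcfeeff3feefe7f;
   0x1f6df6fb5f76fb69dd36955b76d8d9cd9c67c73f4e7e3cf8f3f4e7ece7f673fa73f673f6678;
   0x13d7cd72b2749b2a6e9bdafb5f6bf1df8ef95f95fd37e9bf4df4de5f54ed269364deb736fad;
   0x17577bbdedfbb7eaf2e4dccd99eccf4e799e7cce7e4cfe4e7fb3e7f79f9f7cf9ef9e77cf3bf;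
   0x1f733b9cece7666c9b93bccfbccfdccff793fd8fe8f4990a5c6f9b79eef3dd9ed369b1daa41;
   0x1ededbd59658d26c9b1b36d6e6dd76ddb7a69a06a42091341da74749dc9ef27799dc9dc9ee4;
   0x11d26398cc7327332726789c4ecae66e4dcd73b726c6c6cdb36d6edb374f7a6e371dd9bb9bd;
   0x16e66c9d99fb33eccfd99f24cc4749b2d6e76f3b73767698b5757777576dd2f4dd3ba763d1d;
   0x14d95959b6bb5d9dd363648c664c989236959a364d99d99b27726f33b99dccecce93a4ec9b2;
   0x1891d2699d26ced9b676ced8dd374dd5374ee9dd9dd3ba774dd9b7776bbb76edbb374a9313a;
   0x1a349a549a1a24924a8d1a251a2a5569a34a36db4b56376763dd9dd349a66cce99d933264c9;
   0x14a54aa36adab45a1491468d294ad536a8891212492244ad52d369a369a489084349a4d2152;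
   0x154d28d2a4d1b4d15369b49a4ab56952244d2695248924912695346d369b4da5492d5a54da5;
   0x1daa36a8921248889a4d2d5a5486934b1b4d9364d26952a4d2a549a349a30912426952a6936;
   0x184344489a4492269224a9b4d15369a3696a9b484346d36ad36a8dab56a9485244d26934950;
   0x1d51b549121a2048a9349a6d50d2a48909a4889248a6d551b4da6d34851529a2a4894ed2a54;
   0x1346d2a696ad06d36ad369b4da54daa5b6db6daa5a34a549a34b6aa84d1a492492492229b56;
   0x164d4cd3224868aac68d9a9a9a349b269b6376b65949a569a2a4d104d1a4d2446d2210d3695;
   0x13a4c66964d8ddb6bab1a69226231324d36adb429d1d1b26c6d363b33b2633a66ad5b2a6467;
   0x19a94a9a6699a4c664c0d1a4922ad9b6b6b64d95dda6d06d3a365d369b56cdd363756b1b492;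
   0x14d268d22449a42a42449151a2a6d2906909349a48d3444d11569a3569b4dab56ad1363621a;
   0x1a9b6daa55ab43695b56ad5a69b4dab6d5b6da42a44842a3490b6daaaab4912449109349a2a;
   0x194a8d20a95244909a6d349a54da45484d22db6d5b6d3695ab4a4d2492549134489152a6934;
   0x12421b4d15552412489a4269354b6da5342489249244d225ab4a42448a4d269244909349b56;
   0x179244fb33e64f9c6726d10dab4a8269234a934a9249349a1349ab4da55694b42a4886d084d;
   0x1f7eedf35f2f9af36fbdbf7b77b6e6b9edccef39f739ee4f64d369ee677336bbac692249ce6;
   0x1337c6fdedf777bbbeaf66e99a6747b67b64c331913bb3773dee6f76f7dbef77bef77efbbee;
   0x17cc9e71e74e7673d99dc9dd3cc93333399ce671cf733de67b99f733d99eccd9d4cd277ccef;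
   0x14410d2d5b49a2024820892499c9cc9ce7273eccf673dc774dd53776d7b37ccef33df36f3da;
   0x144802682a4242a0208280a421468aaa45a20505b6aad55a5296a8b56d5b569534224544425;
   0x1a4d28d2a344a4d2696d2b6d1152448a4d2449249244800283416aa91410a80802242204922;
   0x1921a4d1a4dab6db695a6d3692134da6d1b4a9346d369b4d5b6daaa5ab56956d5a5b56da6d2;
   0x16674911249349a4d1b4a6aadb6da349a4d344924489a549a4d2468892491268d1a4d244d26;
   0x1edddbbbbb77776ecdd9db33b3367766763a4db55b3766e991aac9b324e93a64d3199332666;
   0x1b3b33b33b2bbb76bb599dd9dd991332644db774dd9dd375765d9dd9d3363776eeeeeddadae;
   0x1aeddb776eecec9d99d9dd9acc9332664cc99d33a674c4d99324cc4e93b33b33a6749d33a4d;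
   0x104d05b6951408296a9340d2549b486836a86944042a36aa821a34cc333333326693b5766ec;
   0x19a2122285442451a010569a081b444820aa52aaad5a048aa0921aa526951554108042a5511;
   0x1a688a88a5b6d0aaa2b56db451511a2121a25ab6d1b49a49349a23484a54868842a44241a56;
   0x1112356854a9349213469a4d221248515344434d2a9349a52d52a4a955054daab69b4d15695;
   0x15b4206d21349a696d2152688969a244349a52269369112491254a249224914db56934a2d0d;
   0x1454526936821a4449215369a48d2a82268a52492448a9b4436adb6aadb549a5b56db68da45;
   0x1da41b4d5b6db48924869a5268da349089122689122435415a3492956a9a0a5484910924922;
   0x1490890920daa54aad5b4d293422448841a268b6d292954910a514d1b49b68368a5a229ab68;
   0x22a491052b4dab5489a556d51a356dab6da024922486d3426951a5]%positive.

Definition accelerations : seq (seq zpt) :=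
  reshape (nseq 53 96%N) (pts (decode 0 (flatten (map bits codes)))).
Definition displacements : seq (seq zpt) :=
  scanl translate (nseq 96 (0, 0, 0)) accelerations.
Definition deformation : seq (seq zpt) := scanl translate start displacements.
(** Evaluated once, so that the later computations start from a literal list and do not decode
    again. *)
Definition target : seq zpt := Eval vm_compute in last start deformation.

End Deformation.

Lemma target_last : last start deformation = target.
Proof. by vm_cast_no_check (erefl target). Qed.
Lemma deformation_ok : steps_ok 96 start deformation.
Proof. by vm_cast_no_check (erefl true). Qed.
(** In the unit 1/80, the vertices are within 51/100 of the curve. The slope 845/100 is
    [80 * 743/8000], from [flat_chord], plus [2 * 51/100] from the errors at both ends of an edge.
    The constant 13/20 is below the 2/3 required by [lip_rel_isotopic_sym]. *)
Lemma start_ok : dev_ok 13 20 100 51 start (nseq 96 845%bz).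
Proof. by vm_cast_no_check (erefl true). Qed.
Lemma target_ok : dev_ok 49 50 2 0 (halves target) (turns target).
Proof. by vm_cast_no_check (erefl true). Qed.

(** * From the smooth closed braid to the first polygon *)

(** The hypothesis measures the displacement against [f], whereas moving [g] needs it measured
    against [g]. A direct move would have the constant [k / (1 - k)] and need [k < 1/2]. Through the
    midpoint [m] the constants are [(k/2) / (1 - k)] and [(k/2) / (1 - k/2)], and the first is below
    1 exactly when [k < 2/3]. *)
Lemma lip_rel_isotopic_sym (R : realType) (f g : R -> 'rV[R]_3) (k : R) :
  0 <= k < 2 / 3 -> lip_rel k f g -> isotopic g f.
Proof.
move=> /andP[k0 k1] fg; pose m t := g t + (1 / 2) *: (f t - g t).
have fgm s t (D := (g t - f t) - (g s - f s)) :
    [/\ (m t - g t) - (m s - g s) = - ((1 / 2) *: D),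
        (f t - m t) - (f s - m s) = - ((1 / 2) *: D),
        (1 - k) * `|f t - f s| <= `|g t - g s| &
        (1 - k / 2) * `|f t - f s| <= `|m t - m s|].
  have h : `|D| <= k * `|f t - f s| := fg s t.
  split.
  - by rewrite /m /D; apply/rowP => i; rewrite !mxE; ring.
  - by rewrite /m /D; apply/rowP => i; rewrite !mxE; field.
  - have -> : g t - g s = (f t - f s) + D.
      by rewrite /D; apply/rowP => i; rewrite !mxE; ring.
    by have := lerB_normD (f t - f s) D; lra.
  have -> : m t - m s = (f t - f s) + (1 / 2) *: D.
    by rewrite /m /D; apply/rowP => i; rewrite !mxE; field.
  have := lerB_normD (f t - f s) ((1 / 2) *: D).
  by rewrite normrZ ger0_norm //; lra.
have p1 : 0 < 1 - k by lra.
have p2 : 0 < 1 - k / 2 by lra.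
have half (D : 'rV[R]_3) c x y : 0 < c -> `|D| <= k * x -> c * x <= y ->
    `|- ((1 / 2) *: D)| <= k / 2 / c * y.
  move=> c0 h1 h2; rewrite normrN normrZ (ger0_norm (_ : (0 : R) <= 1 / 2)) //.
  have k2 : 0 <= k / 2 / c by rewrite !divr_ge0 // ltW.
  have := ler_wpM2l k2 h2; rewrite mulrA divfK ?gt_eqF //; lra.
have frac01 c : 0 < c -> k / 2 < c -> 0 <= k / 2 / c < 1.
  move=> c0 kc; rewrite ltr_pdivrMr // mul1r kc andbT.
  by apply: divr_ge0; [exact: divr_ge0 | exact: ltW].
apply: (@isotopic_trans _ _ m).
  apply: (@lip_isotopic _ _ _ (k / 2 / (1 - k))).
    by apply: frac01 => //; lra.
  move=> s t; have [-> _ h _] := fgm s t; exact: half (fg s t) h.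
apply: (@lip_isotopic _ _ _ (k / 2 / (1 - k / 2))).
  by apply: frac01 => //; lra.
move=> s t; have [_ -> _ h] := fgm s t; exact: half (fg s t) h.
Qed.

Section FlattenedLink.
Variable R : realType.
Notation V := 'rV[R]_3.
Notation h := (mesh R).

Definition flat_8_18 (x : R) : V := \row_(i < 3) nth 0
  [:: radius_8_18 (x * h) * cos (x * h *+ 3); radius_8_18 (x * h) * sin (x * h *+ 3);
      1 / 2 * sin (x * h *+ 8)] i.

(** Only the height moves, by half of itself, so that the criterion holds with constant 1/2. *)
Lemma flat_isotopic : isotopic (fun x => curve_8_18 (x * h)) flat_8_18.
Proof.
apply: (@lip_isotopic _ _ _ (1 / 2)) => [|s t]; first by lra.
rewrite row_norm_le ?mulr_ge0 //.
apply/forallP => i; have := row_coord_le (curve_8_18 (t * h) - curve_8_18 (s * h)) i.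
move: (`|curve_8_18 _ - _|) => c; rewrite !mxE.
case: i => [[|[|[|//]]] ?] /=; rewrite ?subrr ?normr0 => hc.
- by rewrite mulr_ge0 // (le_trans _ hc).
- by rewrite mulr_ge0 // (le_trans _ hc).
set a := sin _ in hc *; set b := sin _ in hc *.
have -> : 1 / 2 * a - a - (1 / 2 * b - b) = - (1 / 2) * (a - b) by field.
have n12 : `|- (1 / 2)| = 1 / 2 :> R by rewrite normrN ger0_norm.
by rewrite normrM n12 ler_wpM2l.
Qed.

Let X := waves 2 (1 / 2) (1 / 2) (3 * h) (7 * h) h 0.
Let Y := waves 2 (1 / 2) (- (1 / 2)) (3 * h) (7 * h) h (- (pi / 2)).
Let W := waves (1 / 2) 0 0 (8 * h) 0 0 (- (pi / 2)).

Lemma cos_sub_pihalf (t : R) : cos (t - pi / 2) = sin t.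
Proof. by rewrite cosB cos_pihalf sin_pihalf; lra. Qed.

Lemma flatE x : flat_8_18 x = \row_(i < 3) nth 0 [:: X x; Y x; W x] i.
Proof.
apply/rowP => i; rewrite !mxE.
case: i => [[|[|[|//]]] ?] /=; rewrite /X /Y /W /waves ?cos_sub_pihalf ?addr0 /radius_8_18.
- have -> : 3 * h * x = x * h *+ 3 by ring.
  have -> : 7 * h * x = x * h *+ 4 + x * h *+ 3 by ring.
  have -> : h * x = x * h *+ 4 - x * h *+ 3 by ring.
  by rewrite (cosD (x * h *+ 4)) (cosB (x * h *+ 4)); field.
- have -> : 3 * h * x = x * h *+ 3 by ring.
  have -> : 7 * h * x = x * h *+ 4 + x * h *+ 3 by ring.
  have -> : h * x = x * h *+ 4 - x * h *+ 3 by ring.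
  by rewrite (sinD (x * h *+ 4)) (sinB (x * h *+ 4)); field.
have -> : 8 * h * x = x * h *+ 8 by ring.
by ring.
Qed.

Lemma flat_periodic x : flat_8_18 (x + 96%:R) = flat_8_18 x.
Proof.
have e : (x + 96%:R) * h = x * h + pi *+ 2 by rewrite /mesh; field.
rewrite /flat_8_18 /radius_8_18 e.
have [-> _] := trig_periodn 4 (x * h); have [-> ->] := trig_periodn 3 (x * h).
by have [_ ->] := trig_periodn 8 (x * h).
Qed.

(** The second derivatives of the horizontal coordinates are at most
    [(2 * 9 + 49/2 + 1/2) h^2 = 43 h^2], and that of the halved height at most [32 h^2]. With
    [h <= 657/10000], half of [43 h^2] is below 743/8000. *)
Lemma flat_chord (a x y : R) (S := flat_8_18 (a + 1) - flat_8_18 a) :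
    a <= x <= a + 1 -> a <= y <= a + 1 ->
  `|(flat_8_18 x - x *: S) - (flat_8_18 y - y *: S)| <= 743 / 8000 * `|x - y|.
Proof.
move=> ax ay; have [h0 h1] := mesh_le (frefl (zr R)).
have hh : h * h <= 657 / 10000 * (657 / 10000) by apply: ler_pM => //; exact: ltW.
have c0 : 0 <= 743 / 8000 * `|x - y| by rewrite mulr_ge0 ?divr_ge0 ?ler0n ?normr_ge0.
rewrite /S !flatE (row_norm_le _ c0).
have M w A1 A2 A3 a1 a2 a3 p : w = waves A1 A2 A3 a1 a2 a3 p ->
    `|A1| * a1 ^+ 2 + `|A2| * a2 ^+ 2 + `|A3| * a3 ^+ 2 <= 43 * h ^+ 2 ->
    `|(w x - x * (w (a + 1) - w a)) - (w y - y * (w (a + 1) - w a))|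
      <= 743 / 8000 * `|x - y|.
  move=> -> hM; have wc := waves_chord p hM ax ay; apply: (le_trans wc).
  apply: ler_wpM2r; first exact: normr_ge0.
  by move: hh; rewrite expr2; move: (h * h) => z {hM c0 h0 h1 ax ay}; lra.
have n2 : `|2| = 2 :> R by rewrite ger0_norm.
have n12 : `|1 / 2| = 1 / 2 :> R by rewrite ger0_norm.
apply/forallP => -[[|[|[|//]]] ?]; rewrite !mxE /=.
- apply: (M _ _ _ _ _ _ _ _ (erefl _)); rewrite n2 n12 le_eqVlt; apply/orP; left; apply/eqP; by field.
- apply: (M _ _ _ _ _ _ _ _ (erefl _)); rewrite normrN n2 n12 le_eqVlt; apply/orP; left; apply/eqP; by field.
apply: (M _ _ _ _ _ _ _ _ (erefl _)); rewrite normr0 n12 !mul0r !addr0.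
have -> : 1 / 2 * (8 * h) ^+ 2 = 32 * h ^+ 2 by field.
by rewrite ler_wpM2r ?sqr_ge0 ?ler_nat.
Qed.

End FlattenedLink.

Lemma start_near : near_vertices start.
Proof. by vm_cast_no_check (erefl true). Qed.

Lemma start_size : size start = 96%N.
Proof. by vm_compute. Qed.

Section VerticesNear.
Variable R : realType.
Notation V := 'rV[R]_3.
Notation h := (mesh R).
Variable q : Z -> R.
Hypothesis qE : q =1 zr R.

Let qD x y : q (x + y)%bz = q x + q y. Proof. by rewrite !qE zrD. Qed.
Let qB x y : q (x - y)%bz = q x - q y. Proof. by rewrite !qE zrB. Qed.
Let qM x y : q (x * y)%bz = q x * q y. Proof. by rewrite !qE zrM. Qed.
Let qabs x : q (Z.abs x) = `|q x|. Proof. by rewrite !qE zr_abs. Qed.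
Let q_le x y : (x <=? y)%bz = (q x <= q y). Proof. by rewrite !qE (zr_le R). Qed.
Let q_nat (n : nat) : q (Z.of_nat n) = n%:R.
Proof. by rewrite qE /zr (_ : int_of_Z _ = n%:Z) //; lia. Qed.
Let q_lit : [/\ q 40 = 40, q 160 = 160, q 100 = 100 & q 51 = 51].
Proof. by rewrite (q_nat 40) (q_nat 160) (q_nat 100) (q_nat 51). Qed.

Let close (N E x d e : R) : 0 < N -> `|N * E - (d + N * x)| <= e ->
  100 * (`|d| + e) <= 51 * N -> `|E - x| <= 51 / 100.
Proof.
move=> N0 h1 h2; have h3 : `|N * (E - x)| <= `|d| + e.
  have -> : N * (E - x) = d + (N * E - (d + N * x)) by ring.
  by apply: le_trans (ler_normD _ _) _; rewrite lerD2l.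
rewrite -(ler_pM2l N0) -{1}(gtr0_norm N0) -normrM.
by apply: le_trans h3 _; lra.
Qed.

Let comb (N C3 C7 C1 c3 c7 c1 e3 e7 e1 g d x: R) : `|g| = 40 ->
    `|N * C3 - c3| <= e3 -> `|N * C7 - c7| <= e7 -> `|N * C1 - c1| <= e1 ->
    d = 160 * c3 + 40 * c7 + g * c1 - N * x ->
  `|N * (160 * C3 + 40 * C7 + g * C1) - (d + N * x)| <= 160 * e3 + 40 * e7 + 40 * e1.
Proof.
move=> hg h3 h7 h1 ->.
have -> : N * (160 * C3 + 40 * C7 + g * C1) -
    (160 * c3 + 40 * c7 + g * c1 - N * x + N * x) =
  160 * (N * C3 - c3) + 40 * (N * C7 - c7) + g * (N * C1 - c1) by ring.
apply: le_trans (ler_normD _ _) _; apply: lerD; last first.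
  by rewrite normrM hg ler_wpM2l.
apply: le_trans (ler_normD _ _) _.
by apply: lerD; rewrite normrM (ger0_norm (ler0n _ _)) ler_wpM2l.
Qed.

Lemma near_vertexP m (v : zpt) (T := trig_table) (t := fun k => nth p0 T (k %% 96)) :
    near_vertex (t m) (t (3 * m)%N) (t (7 * m)%N) (t (8 * m)%N) v ->
  `|(80 : R) *: flat_8_18 (m%:R : R) - \row_(i < 3) nth 0 [:: q v.1.1; q v.1.2; q v.2] i|
    <= 51 / 100.
Proof.
have := trig_tableP qE m; have := trig_tableP qE (3 * m).
have := trig_tableP qE (7 * m); have := trig_tableP qE (8 * m); rewrite -!/(t _).
case: (t m) => [[c1 s1] e1]; case: (t (3 * m)%N) => [[c3 s3] e3].
case: (t (7 * m)%N) => [[c7 s7] e7]; case: (t (8 * m)%N) => [[c8 s8] e8]; case: v => [[x y] z].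
move=> [_ hs8] [hc7 hs7] [hc3 hs3] [hc1 hs1]; move: hs8 hc7 hs7 hc3 hs3 hc1 hs1.
cbv beta iota zeta delta [fst snd near_vertex] => hs8 hc7 hs7 hc3 hs3 hc1 hs1.
have N0 : 0 < q scale by rewrite qE -(zr0 R) -(zr_lt R).
have [q40 q160 q100 q51] := q_lit.
do 2![case: ifP => //]; rewrite !q_le ![q (100 * _)]qM !(qD (Z.abs _)) !qabs !(qM 51) q100 q51.
rewrite ![q (160 * e3 + _ + _)]qD ![q (160 * e3 + _)]qD !(qM _ e3) !(qM _ e7) !(qM _ e1).
rewrite !(qM _ e8) q40 q160 => hy hx hz.
have n40 : `|40| = 40 :> R by rewrite ger0_norm.
have n40' : `|- 40| = 40 :> R by rewrite normrN.
have ang k : h *+ (k * m) = m%:R * h *+ k by rewrite mulnC mulrnA mulr_natl.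
rewrite ang in hs8 *; rewrite ang in hc7 *; rewrite ang in hs7 *.
rewrite ang in hc3 *; rewrite ang in hs3 *.
rewrite -[h *+ m]mulr_natl in hc1 hs1.
set th := m%:R * h in hs8 hc7 hs7 hc3 hs3 hc1 hs1 *.
rewrite row_norm_le; last by rewrite divr_ge0.
apply/forallP => i; rewrite !mxE -/th /radius_8_18.
case: i => [[|[|[|//]]] ?].
- rewrite -[X in `|X|]/(80 * ((2 + cos (th *+ 4)) * cos (th *+ 3)) - q x).
  have -> : 80 * ((2 + cos (th *+ 4)) * cos (th *+ 3)) =
      160 * cos (th *+ 3) + 40 * cos (th *+ 7) + 40 * cos th.
    have -> : th *+ 7 = th *+ 4 + th *+ 3 by ring.
    have -> : cos th = cos (th *+ 4 - th *+ 3) by congr cos; ring.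
    by rewrite (cosD (th *+ 4)) (cosB (th *+ 4)); ring.
  apply: close N0 _ hx; apply: comb n40 hc3 hc7 hc1 _.
  by rewrite !qB !qD !qM q40 q160.
- rewrite -[X in `|X|]/(80 * ((2 + cos (th *+ 4)) * sin (th *+ 3)) - q y).
  have -> : 80 * ((2 + cos (th *+ 4)) * sin (th *+ 3)) =
      160 * sin (th *+ 3) + 40 * sin (th *+ 7) + - 40 * sin th.
    have -> : th *+ 7 = th *+ 4 + th *+ 3 by ring.
    have -> : sin th = sin (th *+ 4 - th *+ 3) by congr sin; ring.
    by rewrite (sinD (th *+ 4)) (sinB (th *+ 4)); ring.
  apply: close N0 _ hy; apply: comb n40' hs3 hs7 hs1 _.
  by rewrite !qB !qD !qM q40 q160; ring.
rewrite -[X in `|X|]/(80 * (1 / 2 * sin (th *+ 8)) - q z).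
apply: close N0 _ hz; rewrite qB !qM q40.
have -> : q scale * (80 * (1 / 2 * sin (th *+ 8))) - (40 * q s8 - q scale * q z + q scale * q z) =
  40 * (q scale * sin (th *+ 8) - q s8) by field.
by rewrite normrM n40 ler_wpM2l.
Qed.

End VerticesNear.

Section FlattenedPolygon.
Variable R : realType.
Notation V := 'rV[R]_3.
Notation u := (1 / 80 : R).

Let d (x : R) : V := flat_8_18 x - polygon u start x.

Let vertex_near (m : nat) : (m < 96)%N ->
  `|flat_8_18 (m%:R : R) - zvec u (nth p0 start m)| <= u * (51 / 100).
Proof.
move=> m96; have := start_near; rewrite /near_vertices lazy_allP => /allP /(_ m).
rewrite mem_iota => /(_ m96) /(near_vertexP (frefl (zr R))).
case: (nth p0 start m) => [[x y] z] h.
have -> : zvec u (x, y, z) = u *: (\row_(i < 3) nth 0 [:: zr R x; zr R y; zr R z] i).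
  by apply/rowP => i; rewrite !mxE.
have -> : flat_8_18 (m%:R : R) = u *: (80 *: flat_8_18 (m%:R : R)).
  by rewrite scalerA divfK ?scale1r // pnatr_eq0.
by rewrite -scalerBr normrZ ger0_norm ?divr_ge0 // ler_wpM2l ?divr_ge0.
Qed.

Let d_int (i : int) : `|d i%:~R| <= u * (51 / 100).
Proof.
have pE : polygon u start i%:~R = zvec u (vertex start i).
  have i01 : i%:~R <= (i%:~R : R) <= i%:~R + 1. by apply/andP; split; lra.
  by rewrite (polygon_closed u start i01) subrr /lerp scale0r addr0.
have m96 := zmod_natE i (isT : (0 < 96)%N).
have ie : i%:~R = (zmod_nat 96 i)%:R + 96%:R *~ (i %/ 96)%Z :> R.
  have := congr1 (fun z : int => z%:~R : R) (divz_eq i 96).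
  rewrite -m96 intrD intrM -mulrzr -[(Posz (zmod_nat 96 i))%:~R]/((zmod_nat 96 i)%:R).
  by rewrite -[(Posz 96)%:~R]/(96 : R); lra.
rewrite /d pE ie (periodic_int (@flat_periodic R)) /vertex start_size.
exact: vertex_near (zmod_nat_lt i (isT : (0 < 96)%N)).
Qed.

(** On an edge the deviation is that of the curve from its own chord, plus that of the chord from
    the edge, which interpolates linearly between the errors at the two vertices. *)
Lemma start_flat : lip_rel (zr R 13 / zr R 20) (polygon u start) (@flat_8_18 R).
Proof.
have dl (i : int) x y : i%:~R <= x <= i%:~R + 1 -> i%:~R <= y <= i%:~R + 1 ->
    `|d x - d y| <= u * (845 / 100) * `|x - y|.
  move=> hx hy; rewrite /d !(polygon_closed u start hx) (polygon_closed u start hy).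
  have := d_int (i + 1); have := d_int i; have := flat_chord hx hy.
  have i1 : (i + 1)%:~R = i%:~R + 1 :> R by rewrite intrD.
  have i01 : i%:~R <= (i%:~R : R) <= i%:~R + 1 by apply/andP; split; lra.
  have i11 : i%:~R <= (i%:~R + 1 : R) <= i%:~R + 1 by apply/andP; split; lra.
  rewrite /d i1 (polygon_closed u start i01) (polygon_closed u start i11).
  rewrite /lerp subrr scale0r addr0 [_ + 1 - _]addrC addKr scale1r [_ + (_ - _)]addrC subrK.
  set S := _ - flat_8_18 i%:~R; set A := zvec _ _; set B := zvec _ _ => h1 h2 h3.
  have -> : flat_8_18 x - (A + (x - i%:~R) *: (B - A)) -
      (flat_8_18 y - (A + (y - i%:~R) *: (B - A))) =
    (flat_8_18 x - x *: S - (flat_8_18 y - y *: S)) +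
      (x - y) *: ((flat_8_18 (i%:~R + 1) - B) - (flat_8_18 i%:~R - A)).
    by rewrite /S; apply/rowP => j; rewrite !mxE; ring.
  apply: le_trans (ler_normD _ _) _; rewrite normrZ.
  have := ler_wpM2l (normr_ge0 (x - y)) (le_trans (ler_normB _ _) (lerD h3 h2)).
  by move: h1 {h2 h3}; move: (`|x - y|) (`|_ - _|) (`|x - y| * _) => X Y Z; lra.
have e k : zr R (Z.of_nat k) = k%:R by rewrite /zr (_ : int_of_Z _ = k%:Z) //; lia.
have b845 a : (a < 96)%N ->
    zr R (nth 0%bz (nseq 96 845%bz) a) / zr R 100%bz = 845 / 100.
  by move=> a96; rewrite nth_nseq a96 (e 845%N) (e 100%N).
have u0 : 0 < u by rewrite divr_gt0.
apply: (@deviation_lip R u u0 13 20 100 51 _ _ _ start (nseq 96 845%bz) _ _ _ start_ok) => //.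
- by move=> x; rewrite start_size flat_periodic.
- by move=> i x y hx hy; rewrite start_size b845 ?zmod_nat_lt //; exact: dl hx hy.
move=> i x hx; rewrite start_size b845 ?zmod_nat_lt // (e 51%N) (e 100%N).
have -> : 1 / 80 * (845 / 100 / 2 + 51%:R / 100%:R) =
  1 / 80 * (845 / 100) / 2 + 1 / 80 * (51 / 100) :> R by field.
apply: deviation_bound (dl i) _ _ hx; first exact: d_int.
by have := d_int (i + 1); rewrite intrD.
Qed.

Lemma knot_8_18_polygon :
  isotopic (fun x => curve_8_18 (x * mesh R)) (polygon u start).
Proof.
apply: isotopic_trans (@flat_isotopic R) _.
apply: lip_rel_isotopic_sym start_flat.
by rewrite /zr -[13%:~R]/(13 : R) -[20%:~R]/(20 : R); apply/andP; split; lra.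
Qed.

End FlattenedPolygon.

(** * Derivatives of the rounded curve *)

Lemma smooth_expr_affine (R : realType) (f : R -> R) (a b : R) :
  smooth_expr f -> smooth_expr (fun t => f (a * t + b)).
Proof.
elim=> {f} [p c d|c|f g _ sf _ sg|f g _ sf _ sg|f fn0 _ sf].
- have -> : (fun t => flat p (c * (a * t + b) + d)) =
      (fun t => flat p (c * a * t + (c * b + d))).
    by apply/funext => t; congr flat; ring.
  exact: smooth_flat.
- exact: smooth_cst.
- exact: smooth_add.
- exact: smooth_mul.
- by apply: smooth_inv sf => t; exact: fn0.
Qed.

Section RoundedCurve.
Variable R : realType.
Notation V := 'rV[R]_3.
Variables (u h : R) (F : seq zpt).
Hypotheses (h0 : 0 < h) (F0 : (0 < size F)%N).

Definition window (t : R) : int := Num.floor (t / h + 1 / 2).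

Lemma window_itv t : - (1 / 2) <= t / h - (window t)%:~R < 1 / 2.
Proof.
have /andP[] := floor_itv (t / h + 1 / 2); rewrite -/(window t) intrD -[1%:~R]/(1 : R).
by move=> h1 h2; apply/andP; split; lra.
Qed.

(** Up to the factor [1/h], this is the convex combination of the two edges at the vertex [i] with
    weight [step]. *)
Definition corner_velocity (i : int) (k : 'I_3) (t : R) : R :=
  h^-1 * zvec u (edge_vec F (i - 1)) 0 k +
  zvec u (turn F i) 0 k * h^-1 * step (h^-1 * t + - i%:~R).

Lemma corner_derive i k t : is_derive t (1 : R)
  (fun t => corner_piece u F i (t / h) 0 k) (corner_velocity i k t).
Proof.
set E := zvec u (edge_vec F (i - 1)) 0 k; set T := zvec u (turn F i) 0 k.
have d := is_deriveD (is_derive_affine (h^-1 * E) (zvec u (vertex F i) 0 k - i%:~R * E) t)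
  (is_deriveM (is_derive_cst T t (1 : R))
   (@is_derive1_comp R (@ramp R) _ t _ _ (ramp_derive (h^-1 * t + - i%:~R))
     (is_derive_affine h^-1 (- i%:~R) t))).
have -> : (fun t => corner_piece u F i (t / h) 0 k) =
  (fun t => h^-1 * E * t + (zvec u (vertex F i) 0 k - i%:~R * E) +
     T * ramp (h^-1 * t + - i%:~R)).
  by apply/funext => x; rewrite /corner_piece !mxE -/E -/T (mulrC h^-1 x); ring.
by apply: (is_derive_eq d); rewrite /corner_velocity /GRing.scale /= -/E -/T; ring.
Qed.

Lemma rounded_near (t : R) :
  \forall y \near t, corner_piece u F (window t) (y / h) = rounded u F (y / h).
Proof.
have h4 : 0 < h / 4 by rewrite divr_gt0.
have := nbhsx_ballx t _ h4; apply: filterS => y; rewrite /ball /= => ty.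
rewrite (@rounded_piece _ u F F0 (window t)) //.
have /andP[w1 w2] := window_itv t.
have : `|t / h - y / h| < 1 / 4.
  by rewrite -mulrBl normrM normfV (gtr0_norm h0) ltr_pdivrMr //; lra.
rewrite ltr_norml => /andP[h1 h2]; apply/andP; split; lra.
Qed.

Lemma rounded_derive t (k : 'I_3) : is_derive t (1 : R)
  (fun t => rounded u F (t / h) 0 k) (corner_velocity (window t) k t).
Proof.
apply: near_eq_is_derive (corner_derive _ _ _).
by have := rounded_near t; apply: filterS => y /= ->.
Qed.

Lemma rounded_smooth (k : 'I_3) : smooth (fun t => rounded u F (t / h) 0 k).
Proof.
apply: smooth_near => t; exists (fun t' => corner_piece u F (window t) (t' / h) 0 k).
  apply: smooth_derive (corner_derive _ _) _; apply: smooth_expr_smooth.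
  apply: smooth_add; first exact: smooth_cst.
  by apply: smooth_mul; [exact: smooth_cst | exact: smooth_expr_affine (smooth_step R)].
by have := rounded_near t; apply: filterS => y /= ->.
Qed.

End RoundedCurve.

(** * Integral conditions on the final diagram *)

Section DiagramChecks.
Local Open Scope Z_scope.

(* A window [(p, e, f)] is the part of the rounded polygon around the vertex
   [p], between the midpoints of the edges [e] and [f] which meet there. *)
Definition wdata := (zpt * zpt * zpt)%type.

Definition windows (F : seq zpt) : seq wdata :=
  mkseq (fun a => (nvtx F a, zsub (nvtx F a) (nvtx F (a + size F).-1),
                   zsub (nvtx F a.+1) (nvtx F a))) (size F).

(** Horizontal linear forms: they ignore the height, hence speak of the shadow. *)
Definition rays : seq zpt :=
  let r := [:: -6; -5; -4; -3; -2; -1; 0; 1; 2; 3; 4; 5; 6] in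
  [:: (1, 0, 0); (-1, 0, 0); (0, 1, 0); (0, -1, 0)] ++
  flatten [seq [seq (x, y, 0) | y <- r] | x <- r].

Definition det2 (p q : zpt) : Z :=
  let: (a, b, _) := p in let: (c, d, _) := q in a * d - b * c.
Definition sqn2 (p : zpt) : Z := let: (a, b, _) := p in a * a + b * b.
Definition lin2 (a : Z) (p : zpt) (b : Z) (q : zpt) : zpt :=
  let: (x, y, z) := p in let: (x', y', z') := q in
  (a * x + b * x', a * y + b * y', a * z + b * z').

(* Twice the extreme values of [l] on the triangle spanned by [p], [p - e / 2]
   and [p + f / 2]. *)
Definition upper (l : zpt) (w : wdata) : Z :=
  let: (p, e, f) := w in 2 * zdot l p + Z.max 0 (Z.max (- zdot l e) (zdot l f)).
Definition lower (l : zpt) (w : wdata) : Z :=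
  let: (p, e, f) := w in 2 * zdot l p + Z.min 0 (Z.min (- zdot l e) (zdot l f)).

Definition apart (w w' : wdata) : bool :=
  lazy_has (fun l => upper l w <? lower l w') rays.

(** A form increasing along three consecutive edges makes the shadow injective on two consecutive
    windows, and its velocity nonzero. *)
Definition forward (ww : wdata * wdata) : bool :=
  let: ((p, e, f), (p', e', f')) := ww in
  lazy_has (fun l => if 0 <? zdot l e then if 0 <? zdot l f then 0 <? zdot l f'
                     else false else false) rays.

(** The turn is zero: the vertex is interior to a segment run at constant speed, which rounding does
    not alter. *)
Definition straight (w : wdata) : bool := let: (p, e, f) := w in zsup (zsub e f) =? 0.

(* The crossing of two straight windows: [p + (a / d) e = p' + (b / d) e'],
   for [(a, b, d) = meet w w']. *)
Definition meet (w w' : wdata) : zpt :=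
  let: (p, e, _) := w in let: (p', e', _) := w' in
  (det2 (zsub p' p) e', det2 (zsub p' p) e, det2 e e').

(** The bounds by [d] put the crossing in the interior of both windows. The last one says that
    heights vary too little over the two windows to reverse the order of the heights of the two
    vertices. *)
Definition cross_ok (w w' : wdata) : bool :=
  let: (a, b, d) := meet w w' in
  [&& straight w, straight w', 2 * Z.abs a <? Z.abs d, 2 * Z.abs b <? Z.abs d &
      Z.abs (w.1.2).2 + Z.abs (w'.1.2).2 <? 2 * Z.abs ((w.1.1).2 - (w'.1.1).2)].

Variable n : nat.
Variable ws : seq wdata.
Let w0 : wdata := (p0, p0, p0).
Let W (k : nat) := nth w0 ws k.

Definition far_ok (cr : seq (nat * nat)) (x y : nat * wdata) : bool :=
  if (y.1 == x.1.+1)%N then true else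
  if lazy_has (fun ij => if (ij.1 == x.1)%N then (ij.2 == y.1)%N else false) cr then true else
  if (x.1 == 0)%N && (y.1 == n.-1)%N then true else apart x.2 y.2.

(** The list [cr] is to contain all the crossings. Its [uniq] condition lets a window take part in
    one crossing at most, which excludes triple points. *)
Definition curve_ok (cr : seq (nat * nat)) : bool :=
  [&& lazy_all forward (zip ws (rot 1 ws)),
      pairs_all (far_ok cr) (zip (iota 0 n) ws),
      lazy_all (fun ij => [&& (ij.1 < ij.2)%N, (ij.2 < n)%N & cross_ok (W ij.1) (W ij.2)]) cr &
      uniq (unzip1 cr ++ unzip2 cr)].

Variable r : Z.

(** A window lies in the triangle [p], [p - e/2], [p + f/2], and a disk is convex. Vectors from the
    centre are doubled, hence [4 * (r * r)]. *)
Definition inside (c : zpt) (w : wdata) : bool :=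
  let: (p, e, f) := w in let q := lin2 2 p (-2) c in
  [&& sqn2 q <? 4 * (r * r), sqn2 (zsub q e) <? 4 * (r * r) &
      sqn2 (lin2 1 q 1 f) <? 4 * (r * r)].
Definition enters (c : zpt) (w : wdata) : bool :=
  let: (p, e, f) := w in let q := lin2 2 p (-2) c in
  [&& straight w, 4 * (r * r) <? sqn2 (zsub q e) & sqn2 (lin2 1 q 1 e) <? 4 * (r * r)].
Definition leaves (c : zpt) (w : wdata) : bool :=
  let: (p, e, f) := w in let q := lin2 2 p (-2) c in
  [&& straight w, 4 * (r * r) <? sqn2 (lin2 1 q 1 e) & sqn2 (zsub q e) <? 4 * (r * r)].
(** Some half-plane contains the window and is at distance more than [r] from the centre; [m] is
    twice the margin of the form [l]. *)
Definition outside (c : zpt) (w : wdata) : bool :=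
  lazy_has (fun l => let m := lower l w - 2 * zdot l c in
    if 0 <? m then 4 * (r * r) * sqn2 l <? m * m else false) rays.

Definition strand_ok (c : zpt) (i : nat) : bool :=
  [&& enters c (W i), inside c (W i.+1), inside c (W i.+2) & leaves c (W i.+3)].

(* A clasp [(i, j, c)] is made of the windows [i, ..., i + 3] and
   [j, ..., j + 3], in the disk of centre [c] and radius [r]. *)
Definition clasp := (nat * nat * zpt)%type.

(** The strands being antiparallel, the first window of each crosses the last window of the
    other. *)
Definition clasp_crossings (x : clasp) : (nat * nat) * (nat * nat) :=
  let: (i, j, c) := x in ((i, j.+3), (i.+3, j)).

Definition crossing_inside (c : zpt) (ij : nat * nat) : bool :=
  let: (a, b, d) := meet (W ij.1) (W ij.2) in
  sqn2 (lin2 d (lin2 1 (W ij.1).1.1 (-1) c) a (W ij.1).1.2) <? d * d * (r * r).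

Definition handedness (ij : nat * nat) : Z :=
  ((W ij.1).1.1.2 - (W ij.2).1.1.2) * det2 (W ij.1).1.2 (W ij.2).1.2.

(** Windows off the two strands miss the disk. A third crossing in the disk would thus have its
    first window on a strand, which the last test forbids. *)
Definition clasp_ok (cr : seq (nat * nat)) (x : clasp) : bool :=
  let: (i, j, c) := x in let: (P, Q) := clasp_crossings x in
  let core (k : nat) := (if (i <= k)%N then (k <= i.+3)%N else false) ||
                        (if (j <= k)%N then (k <= j.+3)%N else false) in
  [&& [&& (i.+3 < j)%N, (j.+3 < n)%N, strand_ok c i & strand_ok c j],
      lazy_all (fun kw => if core kw.1 then true else outside c kw.2) (zip (iota 0 n) ws),
      crossing_inside c P && crossing_inside c Q,
      0 <? handedness P * handedness Q &
      lazy_all (fun ij => [|| ij == P, ij == Q | ~~ core ij.1]) cr].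

Definition diagram_ok (xs : seq clasp) : bool :=
  let PQ := map clasp_crossings xs in let cr := unzip1 PQ ++ unzip2 PQ in
  curve_ok cr && lazy_all (clasp_ok cr) xs.

End DiagramChecks.

(** Six clasps for the 12 crossings; up to rounding, their centres form two concentric equilateral
    triangles. *)
Definition clasps : seq clasp := [::
  (3, 49, (0, -57, 0)%bz); (10, 85, (-50, 29, 0)%bz); (17, 42, (50, 29, 0)%bz);
  (24, 78, (0, 169, 0)%bz); (35, 56, (147, -85, 0)%bz); (67, 92, (-147, -85, 0)%bz)]%N.

Lemma target_diagram : diagram_ok (size target) (windows target) 29 clasps.
Proof. by vm_cast_no_check (erefl true). Qed.

Definition window_data (F : seq zpt) (i : int) : wdata :=
  (vertex F i, edge_vec F (i - 1), edge_vec F i).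

Lemma nth_windows (F : seq zpt) (w0 : wdata) (a : nat) (i m : int) : (0 < size F)%N -> (a < size F)%N ->
  a%:Z = i + (size F)%:Z * m -> nth w0 (windows F) a = window_data F i.
Proof.
move=> F0 an e; rewrite nth_mkseq // /window_data /edge_vec subrK (nvtxE F0 e).
rewrite (@nvtxE _ F0 a.+1 (i + 1) m); last by rewrite -addn1 PoszD e addrAC.
rewrite (@nvtxE _ F0 (a + size F).-1 (i - 1) (m + 1)) //.
have -> : (a + size F).-1%:Z = a%:Z + (size F)%:Z - 1 by move: F0; lia.
by rewrite e; ring.
Qed.

Lemma raysP l : l \in rays -> l.2 = 0%bz.
Proof.
have /allP h : all (fun l => l.2 =? 0)%bz rays by vm_compute.
by move=> /h /Z.eqb_eq.
Qed.

Lemma straightP p e f : straight (p, e, f) -> e = f.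
Proof.
case: e f => [[a b] c] [[d e] f]; rewrite /straight /zsup /zsub => /Z.eqb_eq h.
by have [-> -> ->] : [/\ a = d, b = e & c = f] by split; lia.
Qed.

(** * Geometry of the windows and of the disks *)

Section WindowGeometry.
Variable R : realType.
Notation V := 'rV[R]_3.
Variables (u : R) (F : seq zpt).
Notation window_data := (window_data F).
Notation piece := (corner_piece u F).

Lemma zr_min (x y : Z) : zr R (Z.min x y) = Num.min (zr R x) (zr R y).
Proof. by rewrite /Num.min -zr_lt; case: ifP => h; congr zr; lia. Qed.

Definition planar (v w : V) : Prop := v 0 0 = w 0 0 /\ v 0 1 = w 0 1.

Lemma zvecE (p : zpt) : [/\ zvec u p 0 0 = u * zr R p.1.1,
  zvec u p 0 1 = u * zr R p.1.2 & zvec u p 0 2 = u * zr R p.2].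
Proof. by case: p => [[a b] c]; rewrite !mxE. Qed.

Lemma dotr_planar l v w : l.2 = 0%bz -> planar v w ->
  dotr (zvec 1 l) v = dotr (zvec 1 l) w.
Proof.
case: l => [[a b] c] /= -> [e0 e1].
rewrite /dotr !big_ord_recl !big_ord0 !mxE /=.
have -> : lift ord0 ord0 = 1 :> 'I_3 by apply/val_inj.
by rewrite e0 e1 zr0 mulr0 !mul0r.
Qed.

(** By [rampN] the piece is the vertex minus [ramp (i - x)] times the incoming edge plus
    [ramp (x - i)] times the outgoing one, with nonnegative coefficients. *)
Lemma ray_piece l i x : dotr (zvec 1 l) (piece i x) =
  u * (zr R (zdot l (vertex F i)) - ramp (i%:~R - x) * zr R (zdot l (edge_vec F (i - 1)))
       + ramp (x - i%:~R) * zr R (zdot l (edge_vec F i))).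
Proof.
rewrite /corner_piece !(dotrD, dotrZ) /turn zvecB dotrB !zvec_dot.
by rewrite -[i%:~R - x]opprB rampN; ring.
Qed.

(** With [a] and [b] the two ramps, [2 a], [2 b] and [1 - 2 a - 2 b] are barycentric coordinates in
    the triangle of the window. *)
Lemma ramp_half (t : R) : - (1 / 2) <= t <= 1 / 2 ->
  [/\ 0 <= ramp t, 0 <= ramp (- t) & ramp t + ramp (- t) <= 1 / 2].
Proof.
move=> /andP[t0 t1]; have [r0 _] := ramp_itv t; have [r1 _] := ramp_itv (- t).
split=> //; rewrite rampN.
have [h|h] := leP t (- (1 / 4)); first by rewrite ramp_le; lra.
have [h'|h'] := leP (1 / 4) t; first by rewrite ramp_ge; lra.
have := ramp_ge (lexx (1 / 4 : R)).
have /andP[+ _] := ramp_lip (ltW h').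
have /andP[_ +] := ramp_lip (ltW h).
by rewrite (@ramp_le _ (- (1 / 4))) //; lra.
Qed.

Lemma straight_piece i x : straight (window_data i) ->
  piece i x = zvec u (vertex F i) + (x - i%:~R) *: zvec u (edge_vec F i) /\
  edge_vec F (i - 1) = edge_vec F i.
Proof.
move=> /straightP e; split=> //; rewrite /corner_piece /turn e zvecB subrr.
by rewrite scaler0 addr0.
Qed.

Hypothesis u0 : 0 < u.

Lemma ray_bounds l i x : - (1 / 2) <= x - i%:~R <= 1 / 2 ->
  u * zr R (lower l (window_data i)) <= 2 * dotr (zvec 1 l) (piece i x)
    <= u * zr R (upper l (window_data i)).
Proof.
move=> /ramp_half[]; rewrite opprB ray_piece /lower /upper /window_data.
rewrite !zrD !zrM !zr_max !zr_min zr0 zrN.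
have -> : zr R 2 = 2 by rewrite /zr.
move: (zr R (zdot l (vertex F i))) (zr R (zdot l (edge_vec F (i - 1)))) => P A.
move: (zr R (zdot l (edge_vec F i))) (ramp (x - _)) (ramp (_ - x)) => B b a b0 a0 ab.
have [m0 mA mB] : [/\ 0 <= Num.max 0 (Num.max (- A) B), - A <= Num.max 0 (Num.max (- A) B) &
    B <= Num.max 0 (Num.max (- A) B)] by rewrite !le_max !lexx !orbT.
have [l0 lA lB] : [/\ Num.min 0 (Num.min (- A) B) <= 0, Num.min 0 (Num.min (- A) B) <= - A &
    Num.min 0 (Num.min (- A) B) <= B] by rewrite !ge_min !lexx !orbT.
move: m0 mA mB l0 lA lB; set M := Num.max _ _; set L := Num.min _ _ => m0 mA mB l0 lA lB.
have mA' := ler_wpM2l a0 mA; have mB' := ler_wpM2l b0 mB.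
have lA' := ler_wpM2l a0 lA; have lB' := ler_wpM2l b0 lB.
have mm := ler_wpM2l m0 ab; have l0' : 0 <= - L by lra.
have ll := ler_wpM2l l0' ab.
rewrite !(mulrCA 2 u) !ler_pM2l //; apply/andP; split; lra.
Qed.

Lemma apart_planar i j x y : apart (window_data i) (window_data j) ->
    - (1 / 2) <= x - i%:~R <= 1 / 2 -> - (1 / 2) <= y - j%:~R <= 1 / 2 ->
  ~ planar (piece i x) (piece j y).
Proof.
rewrite /apart lazy_hasP => /hasP[l /raysP l0]; rewrite (zr_lt R) -(ltr_pM2l u0) => lt hx hy.
move=> /(dotr_planar l0) e; have /andP[_] := ray_bounds l hx.
have /andP[+ _] := ray_bounds l hy; rewrite e; move: lt; lra.
Qed.

(** From [x] to [y] the outgoing coefficient grows by some amount between 0 and [y - x], and the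
    incoming one by the rest; the form is positive on both edges. *)
Lemma ray_increasing l i x y : x < y -> 0 < zr R (zdot l (edge_vec F (i - 1))) ->
    0 < zr R (zdot l (edge_vec F i)) ->
  dotr (zvec 1 l) (piece i x) < dotr (zvec 1 l) (piece i y).
Proof.
move=> xy A0 B0; rewrite !ray_piece ltr_pM2l //.
rewrite -![i%:~R - _]opprB !rampN.
have : x - i%:~R <= y - i%:~R by lra.
move=> /ramp_lip /andP[]; move: A0 B0 (ramp (x - _)) (ramp (y - _)).
move: (zr R (zdot l (edge_vec F (i - 1)))) (zr R (zdot l (edge_vec F i))) => A B.
move=> A0 B0 a b h1 h2.
have := mulr_ge0 (ltW B0) h1.
have [e|ne] := eqVneq (b - a) 0.
  have : 0 < (y - x) * A by rewrite mulr_gt0 ?subr_gt0.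
  have -> : b = a by lra.
  lra.
have : 0 < (b - a) * B by rewrite mulr_gt0 // lt0r ne.
have : 0 <= (y - x - (b - a)) * A by apply: mulr_ge0; [lra | exact: ltW].
lra.
Qed.

Lemma meet_planar i j x y (abd := meet (window_data i) (window_data j)) :
    straight (window_data i) -> straight (window_data j) -> zr R abd.2 != 0 ->
  planar (piece i x) (piece j y) <->
  x - i%:~R = zr R abd.1.1 / zr R abd.2 /\ y - j%:~R = zr R abd.1.2 / zr R abd.2.
Proof.
move=> si sj; have [-> ei] := straight_piece x si; have [-> ej] := straight_piece y sj.
rewrite /abd /meet /window_data ei ej /planar !mxE.
case: (vertex F i) => [[a b] c]; case: (vertex F j) => [[a' b'] c'].
case: (edge_vec F i) => [[p q] r]; case: (edge_vec F j) => [[p' q'] r'] /=.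
rewrite !mxE !(zrB, zrM) /=; move: (x - _) (y - _) => s t d0; split.
  move=> [e0 e1]; have un : u != 0 by rewrite gt_eqF.
  have {}e0 : zr R a + s * zr R p = zr R a' + t * zr R p'.
    by apply: (mulfI un); move: e0; clear; lra.
  have {}e1 : zr R b + s * zr R q = zr R b' + t * zr R q'.
    by apply: (mulfI un); move: e1; clear; lra.
  split; apply: (mulIf d0); rewrite divfK //.
    have := congr1 (fun z => z * zr R q') e0; have := congr1 (fun z => z * zr R p') e1.
    by clear; lra.
  have := congr1 (fun z => z * zr R q) e0; have := congr1 (fun z => z * zr R p) e1.
  by clear; lra.
by move=> [-> ->]; split; field.
Qed.

End WindowGeometry.

Section QuadraticRoots.
Variable R : realType.

Lemma convex_quadratic (A B C s t l : R) : 0 <= A -> 0 <= l <= 1 ->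
  A * ((1 - l) * s + l * t) ^+ 2 + B * ((1 - l) * s + l * t) + C <=
  (1 - l) * (A * s ^+ 2 + B * s + C) + l * (A * t ^+ 2 + B * t + C).
Proof.
move=> A0 /andP[l0 l1]; rewrite -subr_ge0.
have -> : (1 - l) * (A * s ^+ 2 + B * s + C) + l * (A * t ^+ 2 + B * t + C) -
  (A * ((1 - l) * s + l * t) ^+ 2 + B * ((1 - l) * s + l * t) + C) =
  A * (l * (1 - l)) * (s - t) ^+ 2 by ring.
by apply: mulr_ge0 (sqr_ge0 _); rewrite mulr_ge0 // mulr_ge0 // subr_ge0.
Qed.

(** The intermediate value theorem gives a root. Convexity and the negative value at 1/2 force
    positive values before it and negative values after it. *)
Lemma entry_point (A B C : R) (f := fun t => A * t ^+ 2 + B * t + C) :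
    0 <= A -> 0 < f (- (1 / 2)) -> f (1 / 2) < 0 ->
  exists2 t0, - (1 / 2) < t0 < 1 / 2 &
    forall t, - (1 / 2) <= t <= 1 / 2 -> (f t <= 0) = (t0 <= t) /\ (f t < 0) = (t0 < t).
Proof.
move=> A0 fa fb.
have cf : continuous f.
  move=> x; apply: (@is_derive_continuous _ _ _ (2 * A * x + B)).
  have d := is_deriveD (is_deriveD (is_deriveM (is_derive_cst A x (1 : R))
    (is_deriveM (is_derive_id x (1 : R)) (is_derive_id x (1 : R))))
    (is_deriveM (is_derive_cst B x (1 : R)) (is_derive_id x (1 : R)))) (is_derive_cst C x (1 : R)).
  by apply: (is_derive_eq d); rewrite /GRing.scale /=; ring.
have ab : - (1 / 2) <= 1 / 2 :> R by lra.
have [|t0] := @IVT R f _ _ 0 ab (continuous_subspaceT cf).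
  by rewrite ge_min le_max (ltW fb) (ltW fa) !orbT.
rewrite in_itv /= => /andP[t1 t2] ft0.
have t1' : - (1 / 2) < t0.
  by rewrite lt_neqAle t1 andbT; apply: contraTneq fa => ->; rewrite ft0 ltxx.
have t2' : t0 < 1 / 2.
  by rewrite lt_neqAle t2 andbT; apply: contraTneq fb => <-; rewrite ft0 ltxx.
have before t : - (1 / 2) <= t -> t < t0 -> 0 < f t.
  move=> _ tt0; rewrite ltNge; apply/negP => ft.
  have d0 : 0 < 1 / 2 - t by lra.
  pose l := (t0 - t) / (1 / 2 - t).
  have l01 : 0 < l <= 1 by apply/andP; split; [apply: divr_gt0 => //; lra | rewrite /l ler_pdivrMr //; lra].
  have /andP[l0 l1] := l01.
  have e : (1 - l) * t + l * (1 / 2) = t0.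
    by have : l * (1 / 2 - t) = t0 - t by [rewrite divfK ?gt_eqF //]; lra.
  have := @convex_quadratic A B C t (1 / 2) l A0; rewrite (ltW l0) l1 => /(_ isT).
  rewrite e -!/(f _) ft0 => h; have h1 : 0 <= (1 - l) by lra.
  have := ler_wpM2l h1 ft; have : l * f (1 / 2) < 0 by rewrite pmulr_rlt0.
  by move: h; rewrite /f; lra.
have after t : t0 < t -> t <= 1 / 2 -> f t < 0.
  move=> tt0 t12; have d0 : 0 < 1 / 2 - t0 by lra.
  pose l := (t - t0) / (1 / 2 - t0).
  have l01 : 0 < l <= 1 by apply/andP; split; [apply: divr_gt0 => //; lra | rewrite /l ler_pdivrMr //; lra].
  have /andP[l0 l1] := l01.
  have e : (1 - l) * t0 + l * (1 / 2) = t.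
    by have : l * (1 / 2 - t0) = t - t0 by [rewrite divfK ?gt_eqF //]; lra.
  have := @convex_quadratic A B C t0 (1 / 2) l A0; rewrite (ltW l0) l1 => /(_ isT).
  rewrite e -!/(f _) ft0 mulr0 add0r => h.
  by apply: le_lt_trans h _; rewrite pmulr_rlt0.
exists t0 => [|t /andP[ta tb]]; first by rewrite t1'.
have [h|h|<-] := ltgtP t0 t.
- by have h' := after t h tb; rewrite h' (ltW h').
- by have h' := before t ta h; rewrite leNgt h' ltNge (ltW h').
by rewrite ft0 lexx ltxx.
Qed.

End QuadraticRoots.

Section DiskGeometry.
Variable R : realType.
Notation V := 'rV[R]_3.
Variables (u : R) (F : seq zpt) (r : Z).
Hypothesis u0 : 0 < u.
Notation piece := (corner_piece u F).
Notation wd := (window_data F).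

Definition disk_fun (c : zpt) (v : V) : R :=
  (v 0 0 - u * zr R c.1.1) ^+ 2 + (v 0 1 - u * zr R c.1.2) ^+ 2 - (u * zr R r) ^+ 2.

Lemma sqr_convex (a b c k l m : R) : 0 <= k -> 0 <= l -> 0 <= m -> k + l + m = 1 ->
  (k * a + l * b + m * c) ^+ 2 <= k * a ^+ 2 + l * b ^+ 2 + m * c ^+ 2.
Proof.
move=> k0 l0 m0 e; rewrite -subr_ge0.
have -> : k * a ^+ 2 + l * b ^+ 2 + m * c ^+ 2 - (k * a + l * b + m * c) ^+ 2 =
    k * l * (a - b) ^+ 2 + k * m * (a - c) ^+ 2 + l * m * (b - c) ^+ 2.
  have -> : k = 1 - l - m by lra.
  by ring.
by apply: addr_ge0; [apply: addr_ge0|]; apply: mulr_ge0 (sqr_ge0 _); exact: mulr_ge0.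
Qed.

Lemma convex_disk (x1 x2 x3 y1 y2 y3 k l m M : R) :
    0 <= k -> 0 <= l -> 0 <= m -> k + l + m = 1 ->
    x1 ^+ 2 + y1 ^+ 2 < M -> x2 ^+ 2 + y2 ^+ 2 < M -> x3 ^+ 2 + y3 ^+ 2 < M ->
  (k * x1 + l * x2 + m * x3) ^+ 2 + (k * y1 + l * y2 + m * y3) ^+ 2 < M.
Proof.
move=> k0 l0 m0 e; have := sqr_convex x1 x2 x3 k0 l0 m0 e.
have := sqr_convex y1 y2 y3 k0 l0 m0 e.
move: ((k * x1 + _ + _) ^+ 2) ((k * y1 + _ + _) ^+ 2) => X Y hY hX h1 h2 h3.
set N1 := x1 ^+ 2 + y1 ^+ 2 in h1; set N2 := x2 ^+ 2 + y2 ^+ 2 in h2.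
set N3 := x3 ^+ 2 + y3 ^+ 2 in h3.
have {hX hY} h : X + Y <= k * N1 + l * N2 + m * N3 by rewrite /N1 /N2 /N3; lra.
(* Some weights may vanish, so strictness is obtained from the largest of the three squared
   norms. *)
pose d := Num.max N1 (Num.max N2 N3).
have dM : d < M by rewrite !gt_max h1 h2.
have [d1 d2 d3] : [/\ N1 <= d, N2 <= d & N3 <= d] by rewrite !le_max !lexx !orbT.
have := ler_wpM2l k0 d1; have := ler_wpM2l l0 d2; have := ler_wpM2l m0 d3.
have := congr1 (fun z => z * d) e.
by move: d dM {d1 d2 d3 h1 h2 h3} => d dM; lra.
Qed.

Lemma inside_piece c i x : inside r c (wd i) -> - (1 / 2) <= x - i%:~R <= 1 / 2 ->
  disk_fun c (piece i x) < 0.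
Proof.
move=> ins /ramp_half[]; rewrite opprB => b0 a0 ab; move: ins.
have pe k : piece i x 0 k = zvec u (vertex F i) 0 k -
    ramp (i%:~R - x) * zvec u (edge_vec F (i - 1)) 0 k + ramp (x - i%:~R) * zvec u (edge_vec F i) 0 k.
  rewrite /corner_piece /turn zvecB !mxE -[i%:~R - x]opprB rampN.
  by move: (zvec _ _ _ _) (zvec _ _ _ _) (zvec _ _ _ _) => X Y Z; ring.
move: a0 b0 ab; set a := ramp (i%:~R - x) in pe *; set b := ramp (x - _) in pe * => a0 b0 ab.
rewrite /disk_fun !pe /inside /window_data.
case: (vertex F i) => [[p q] z]; case: (edge_vec F (i - 1)) => [[e e'] e''].
case: (edge_vec F i) => [[f f'] f'']; case: c => [[c c'] c''].
rewrite /lin2 /sqn2 /zsub => /and3P[]; rewrite !(zr_lt R) !mxE !(zrD, zrB, zrM, zrN) /=.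
have -> : zr R 2 = 2 by rewrite /zr.
have -> : zr R 4 = 4 by rewrite /zr.
have -> : zr R (-2) = -2 by rewrite /zr.
have -> : zr R 1 = 1 by rewrite /zr.
move: (zr R p) (zr R q) (zr R c) (zr R c') (zr R e) (zr R e') (zr R f) (zr R f') (zr R r).
clear pe p q c c' e e' f f' z e'' f'' c'' => p q c c' e e' f f' rho.
rewrite -!expr2 !mul1r => h1 h2 h3.
have -> : (u * p - a * (u * e) + b * (u * f) - u * c) ^+ 2 +
    (u * q - a * (u * e') + b * (u * f') - u * c') ^+ 2 - (u * rho) ^+ 2 =
  u ^+ 2 / 4 * (((1 - 2 * a - 2 * b) * (2 * p + - 2 * c) + 2 * a * (2 * p + - 2 * c - e) +
      2 * b * (2 * p + - 2 * c + f)) ^+ 2 +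
    ((1 - 2 * a - 2 * b) * (2 * q + - 2 * c') + 2 * a * (2 * q + - 2 * c' - e') +
      2 * b * (2 * q + - 2 * c' + f')) ^+ 2 - 4 * rho ^+ 2) by field.
rewrite pmulr_rlt0 ?divr_gt0 ?exprn_gt0 // subr_lt0.
by apply: convex_disk => //; lra.
Qed.

(** The Cauchy-Schwarz inequality turns the margin of the linear form into a distance from the
    centre. *)
Lemma outside_piece c i x : outside r c (wd i) -> - (1 / 2) <= x - i%:~R <= 1 / 2 ->
  0 < disk_fun c (piece i x).
Proof.
rewrite /outside lazy_hasP => /hasP[l /raysP l0]; cbv zeta.
case: ifP => // m0 m1 hx.
have /andP[+ _] := @ray_bounds R u F u0 l i x hx; move: m0 m1 (piece i x) => m0 m1 v; move: m0 m1.
rewrite !(zr_lt R) zr0 !(zrM, zrB).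
have -> : zr R 2 = 2 by rewrite /zr.
have -> : zr R 4 = 4 by rewrite /zr.
move: (lower l (wd i)) => L.
case: l l0 => [[p q] z] /= ->; case: c => [[c c'] c'']; rewrite /disk_fun /= /dotr.
rewrite !big_ord_recl big_ord0 !mxE /=.
have -> : lift ord0 ord0 = 1 :> 'I_3 by apply/val_inj.
rewrite !(zrD, zrM) zr0 !mulr0 !mul0r !addr0.
have -> : ord0 = 0 :> 'I_3 by [].
move: (v 0 0) (v 0 1) (zr R L) (zr R p) (zr R q) (zr R c) (zr R c') (zr R r).
clear v L => x0 y0 L P Q C C' rho m0 m1 h.
set A := x0 - u * C; set B := y0 - u * C'.
set m := L - 2 * (P * C + Q * C') in m0 m1.
have um : 0 < u * m by rewrite mulr_gt0.
have h1 : u * m <= 2 * (P * A + Q * B) by rewrite /m /A /B; lra.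
have h2 : (u * m) ^+ 2 <= 4 * (P * A + Q * B) ^+ 2.
  have -> : 4 * (P * A + Q * B) ^+ 2 = (2 * (P * A + Q * B)) ^+ 2 by ring.
  by apply: lerXn2r => //; rewrite nnegrE; lra.
have h3 : (P * A + Q * B) ^+ 2 <= (P * P + Q * Q) * (A ^+ 2 + B ^+ 2).
  rewrite -subr_ge0; have -> : (P * P + Q * Q) * (A ^+ 2 + B ^+ 2) - (P * A + Q * B) ^+ 2 =
    (P * B - Q * A) ^+ 2 by ring.
  exact: sqr_ge0.
have h4 : 0 < (P * P + Q * Q) * (A ^+ 2 + B ^+ 2 - (u * rho) ^+ 2).
  have u2 : 0 < u ^+ 2 by rewrite exprn_gt0.
  by move: m1; rewrite -(ltr_pM2l u2) => m1; lra.
have n0 : 0 <= P * P + Q * Q by rewrite -!expr2 addr_ge0 ?sqr_ge0.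
by rewrite ltNge; apply/negP => h5; have := mulr_ge0_le0 n0 h5; lra.
Qed.

Lemma straight_disk c i : straight (wd i) -> exists A B C : R, [/\ 0 <= A,
   forall x, disk_fun c (piece i x) = A * (x - i%:~R) ^+ 2 + B * (x - i%:~R) + C,
   4 * (A * (- (1 / 2)) ^+ 2 + B * (- (1 / 2)) + C) = u ^+ 2 *
     (zr R (sqn2 (zsub (lin2 2 (vertex F i) (-2) c) (edge_vec F i))) - zr R (4 * (r * r))%bz) &
   4 * (A * (1 / 2) ^+ 2 + B * (1 / 2) + C) = u ^+ 2 *
     (zr R (sqn2 (lin2 1 (lin2 2 (vertex F i) (-2) c) 1 (edge_vec F i))) - zr R (4 * (r * r))%bz)].
Proof.
move=> st; have pe y k : piece i y 0 k = zvec u (vertex F i) 0 k +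
    (y - i%:~R) * zvec u (edge_vec F i) 0 k.
  by have [-> _] := straight_piece u y st; rewrite !mxE.
rewrite /disk_fun; move: pe.
case: (vertex F i) => [[p q] z]; case: (edge_vec F i) => [[e e'] e'']; case: c => [[c c'] c''] pe.
exists ((u * zr R e) ^+ 2 + (u * zr R e') ^+ 2).
exists (2 * u ^+ 2 * ((zr R p - zr R c) * zr R e + (zr R q - zr R c') * zr R e')).
exists (u ^+ 2 * ((zr R p - zr R c) ^+ 2 + (zr R q - zr R c') ^+ 2 - zr R r ^+ 2)).
have z2 : zr R 2 = 2 by rewrite /zr.
have z4 : zr R 4 = 4 by rewrite /zr.
have zm2 : zr R (-2) = -2 by rewrite /zr.
have z1 : zr R 1 = 1 by rewrite /zr.
split; first by rewrite addr_ge0 ?sqr_ge0.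
- by move=> y; rewrite !pe !mxE /=; ring.
- by rewrite /lin2 /zsub /sqn2 !(zrB, zrD, zrM) z2 z4 zm2; field.
by rewrite /lin2 /zsub /sqn2 !(zrB, zrD, zrM) z2 z4 zm2 z1; field.
Qed.

Lemma enters_piece c i : enters r c (wd i) -> exists2 a, - (1 / 2) < a - i%:~R < 1 / 2 &
  forall x, - (1 / 2) <= x - i%:~R <= 1 / 2 ->
    (disk_fun c (piece i x) <= 0) = (a <= x) /\ (disk_fun c (piece i x) < 0) = (a < x).
Proof.
have u2 : 0 < u ^+ 2 by rewrite exprn_gt0.
rewrite /enters /window_data => /and3P[st]; have [_ ->] := straight_piece u 0 st.
have [A [B [C [A0 fE fa fb]]]] := straight_disk c st.
rewrite !(zr_lt R) -subr_gt0 -[_ < zr R (4 * _)]subr_lt0.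
rewrite -(pmulr_rgt0 _ u2) -[_ < 0](pmulr_rlt0 _ u2) -fa -fb => ha hb.
have [|| t t01 ht] := @entry_point _ A B C A0.
- by move: ha; lra.
- by move: hb; lra.
exists (i%:~R + t) => [|x /ht]; first by rewrite addrC addKr.
by rewrite fE => -[-> ->]; rewrite lerBrDl ltrBrDl.
Qed.

Lemma leaves_piece c i : leaves r c (wd i) -> exists2 b, - (1 / 2) < b - i%:~R < 1 / 2 &
  forall x, - (1 / 2) <= x - i%:~R <= 1 / 2 ->
    (disk_fun c (piece i x) <= 0) = (x <= b) /\ (disk_fun c (piece i x) < 0) = (x < b).
Proof.
have u2 : 0 < u ^+ 2 by rewrite exprn_gt0.
rewrite /leaves /window_data => /and3P[st]; have [_ ->] := straight_piece u 0 st.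
have [A [B [C [A0 fE fa fb]]]] := straight_disk c st.
rewrite !(zr_lt R) -subr_gt0 -[_ < zr R (4 * _)]subr_lt0.
rewrite -(pmulr_rgt0 _ u2) -[_ < 0](pmulr_rlt0 _ u2) -fb -fa => ha hb.
(* Reversing time, [-B] for [B], turns leaving the disk into entering it. *)
have [|| t /andP[t0 t1] ht] := @entry_point _ A (- B) C A0.
- by move: ha; lra.
- by move: hb; lra.
exists (i%:~R - t) => [|x /andP[x0 x1]]; first by apply/andP; split; lra.
have [|] := ht (- (x - i%:~R)); first by apply/andP; split; lra.
rewrite fE mulrNN sqrrN => -> ->; split; apply/idP/idP; lra.
Qed.
End DiskGeometry.

Lemma succ3 (i : nat) :
  [/\ i < i.+3, i.+1 < i.+3, i.+2 < i.+3, i < i.+1 & i < i.+2]%N.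
Proof. by split; lia. Qed.

Lemma le3 (i : nat) : (i <= i <= i.+3)%N /\ (i <= i.+3 <= i.+3)%N.
Proof. by split; lia. Qed.

Lemma lt3_trans (i j n : nat) : (i.+3 < j)%N -> (j.+3 < n)%N -> (i.+3 < n)%N.
Proof. by lia. Qed.

Lemma nth_zip_rot1 (T : Type) (x0 : T) (s : seq T) (a : nat) : (a < size s)%N ->
  nth (x0, x0) (zip s (rot 1 s)) a = (nth x0 s a, nth x0 s (a.+1 %% size s)).
Proof.
move=> aF; rewrite nth_zip ?size_rot //; congr (_, _).
case: s aF => [//|x s] aF; rewrite rot1_cons nth_rcons.
move: aF; rewrite /= ltnS leq_eqVlt => /orP[/eqP ->|h].
  by rewrite ltnn eqxx modnn.
by rewrite h modn_small.
Qed.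

Lemma uniq_map_inj (T U : eqType) (f : T -> U) (s : seq T) : uniq (map f s) ->
  {in s &, injective f}.
Proof.
elim: s => //= a s IH /andP[nfa us] x y; rewrite !inE.
case/orP=> [/eqP->|xs] /orP[/eqP->|ys] // e; last exact: IH.
  by case/negP: nfa; rewrite e map_f.
by case/negP: nfa; rewrite -e map_f.
Qed.

(** A horizontal form positive on both edges is positive on their convex combinations, so the
    velocity has a nonzero horizontal part. *)
Lemma corner_velocity_neq0 (R : realType) (u h : R) (F : seq zpt) (i : int) (t : R)
    (l : zpt) : 0 < u -> 0 < h -> l.2 = 0%bz ->
    0 < zr R (zdot l (edge_vec F (i - 1))) -> 0 < zr R (zdot l (edge_vec F i)) ->
  corner_velocity u h F i 0 t != 0 \/ corner_velocity u h F i 1 t != 0.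
Proof.
move=> u0 h0 l0 h1 h2; apply/orP; rewrite -negb_and; apply/negP.
move=> /andP[/eqP v0 /eqP v1].
pose w : 'rV[R]_3 := h^-1 *: zvec u (edge_vec F (i - 1)) +
  (h^-1 * step (h^-1 * t + - i%:~R)) *: zvec u (turn F i).
have : planar w 0.
  by split; rewrite [RHS]mxE; [rewrite -[RHS]v0 | rewrite -[RHS]v1];
    rewrite /corner_velocity !mxE; ring.
move=> /(dotr_planar l0); rewrite /w !(dotrD, dotrZ) /turn zvecB dotrB !zvec_dot.
have -> : dotr (zvec 1 l) 0 = 0 :> R by rewrite -(scale0r 0) dotrZ mul0r.
have /andP[] := step_itv (h^-1 * t + - i%:~R); move: (step _) => z z0 z1.
move: (zr R (zdot l (edge_vec F (i - 1)))) (zr R (zdot l (edge_vec F i))) h1 h2.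
move=> A B A0 B0; have uh : 0 < h^-1 * u by rewrite mulr_gt0 ?invr_gt0.
have : 0 < (1 - z) * A + z * B.
  have [->|zn] := eqVneq z 0; first by lra.
  have p1 : 0 < z * B by rewrite mulr_gt0 // lt0r zn.
  have p2 : 0 <= (1 - z) * A by apply: mulr_ge0; [lra | exact: ltW].
  by lra.
move=> pos; have := mulr_gt0 uh pos; lra.
Qed.

(** * Crossings and clasps of the rounded polygon *)

Section RoundedDiagram.
Variable R : realType.
Notation V := 'rV[R]_3.
Variables (u h : R) (F : seq zpt) (r : Z) (xs : seq clasp) (K : knot R).
Notation n := (size F).
Notation g := (rounded u F).
Notation wd := (window_data F).
Hypotheses (u0 : 0 < u) (h0 : 0 < h) (F0 : (0 < n)%N).
Hypothesis KE : forall t, K t = g (t / h).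
Hypothesis hn : h * n%:R = pi *+ 2.

Definition in_window (i : int) (x : R) : Prop := - (1 / 2) <= x - i%:~R < 1 / 2.

Lemma in_window_piece i x : - (3 / 4) <= x - i%:~R <= 3 / 4 -> g x = corner_piece u F i x.
Proof. exact: (@rounded_piece R u F F0 i x). Qed.

Lemma window_dataP (i j m : int) : i = j + n%:Z * m -> wd i = wd j.
Proof.
move=> ->; rewrite /window_data /edge_vec !subrK.
by rewrite [_ + _ * _ + 1]addrAC [_ + _ * _ - 1]addrAC !vertex_periodic.
Qed.

(* [x] is the representative of [t / h] modulo [n] in the windows [0, ..., n - 1]. *)
Definition rep (t : R) (a : nat) (x : R) : Prop :=
  [/\ (a < n)%N, in_window a x & exists m : int, t / h = x + n%:R *~ m].

Lemma rep_exists t : exists a x, rep t a x.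
Proof.
pose i := Num.floor (t / h + 1 / 2); have [m em] := zmod_natP i F0.
exists (zmod_nat n i), (t / h + n%:R *~ m); split.
- exact: zmod_nat_lt.
- have /andP[] := floor_itv (t / h + 1 / 2); rewrite -/i intrD -[1%:~R]/(1 : R) => h1 h2.
  rewrite /in_window em intrD intrM -[(Posz n)%:~R]/(n%:R) mulrzr.
  by apply/andP; split; lra.
by exists (- m); rewrite mulrNz addrK.
Qed.

Lemma repE t a x : rep t a x -> K t = g x.
Proof.
by case=> _ _ [m e]; rewrite KE e (periodic_int (@rounded_periodic R u F)).
Qed.

Lemma rep_window t a x : rep t a x -> - (1 / 2) <= x < n%:R - 1 / 2.
Proof.
case=> an /andP[h1 h2] _; have : (a.+1%:R <= n%:R :> R) by rewrite ler_nat.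
move: h1 h2; rewrite -[(Posz a)%:~R]/(a%:R : R) -[a.+1%:R]natr1 => h1 h2 h3.
by have := ler0n R a; move=> h4; apply/andP; split; lra.
Qed.

Lemma rep_same s t a b x y : rep s a x -> rep t b y -> same_param s t <-> x = y.
Proof.
move=> rs rt; have /andP[x0 x1] := rep_window rs; have /andP[y0 y1] := rep_window rt.
case: rs rt => _ _ [m em] [_ _ [k ek]]; have hn0 := lt0r_neq0 h0.
have es : s = h * x + (pi *+ 2) *~ m.
  by rewrite -hn -mulrzAr -mulrDr -em mulrC divfK.
have et : t = h * y + (pi *+ 2) *~ k.
  by rewrite -hn -mulrzAr -mulrDr -ek mulrC divfK.
split; last by move=> xy; exists (k - m); rewrite es et xy mulrzBr; ring.
move=> [l e]; have exy : y - x = n%:R *~ (m + l - k).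
  apply: (mulfI hn0); rewrite mulrzAr hn mulrzBr mulrzDr mulrBr.
  by move: e; rewrite es et; lra.
move: exy; rewrite -mulrzr => exy.
have n0 : 0 < n%:R :> R by rewrite ltr0n.
have l1 : (m + l - k)%:~R < 1 :> R by rewrite -(ltr_pM2l n0) -exy; lra.
have l2 : -1 < (m + l - k)%:~R :> R by rewrite -(ltr_pM2l n0) -exy; lra.
have l0 : m + l - k = 0.
  by move: l1 l2; rewrite -[1]/(1%:~R) -[-1]/((-1)%:~R) !ltr_int; lia.
by move: exy; rewrite l0 mulr0; lra.
Qed.

Lemma in_window_uniq (a b : nat) x : in_window a x -> in_window b x -> a = b.
Proof.
move=> /andP[a0 a1] /andP[b0 b1].
have : a%:Z < b%:Z + 1 by rewrite -(ltr_int R) intrD -[1%:~R]/(1 : R); lra.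
have : b%:Z < a%:Z + 1 by rewrite -(ltr_int R) intrD -[1%:~R]/(1 : R); lra.
by lia.
Qed.

Let PQ := map clasp_crossings xs.
Let cr := unzip1 PQ ++ unzip2 PQ.
Let ws := windows F.
Let w0 : wdata := (p0, p0, p0).
Hypothesis ok : curve_ok n ws cr.

Let sw : size ws = n. Proof. exact: size_mkseq. Qed.

Let nth_ws (a : nat) : (a < n)%N -> nth w0 ws a = wd a.
Proof. by move=> an; apply: (@nth_windows _ _ _ a 0) => //; rewrite mulr0 addr0. Qed.

Lemma forwardP (i : int) : exists l, [/\ l.2 = 0%bz,
  0 < zr R (zdot l (edge_vec F (i - 1))), 0 < zr R (zdot l (edge_vec F i)) &
  0 < zr R (zdot l (edge_vec F (i + 1)))].
Proof.
have /and4P[+ _ _ _] := ok; rewrite lazy_allP => /(all_nthP (w0, w0)) /(_ (zmod_nat n i)).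
rewrite size_zip size_rot minnn sw nth_zip_rot1 ?sw ?zmod_nat_lt // => /(_ isT).
rewrite -zmod_natS // !nth_ws ?zmod_nat_lt //.
have [m em] := zmod_natP i F0; rewrite (window_dataP em).
have [m' em'] := zmod_natP (i + 1) F0; rewrite (window_dataP em').
rewrite /forward /window_data lazy_hasP => /hasP[l /raysP l0].
case: ifP => // h1; case: ifP => // h2 h3; exists l.
by split=> //; rewrite -(zr0 R) -zr_lt.
Qed.

Lemma same_window (i : int) x y : in_window i x -> in_window i y ->
  planar (g x) (g y) -> x = y.
Proof.
wlog xy : x y / x <= y.
  move=> H wx wy [e0 e1]; have [/H|/ltW /H] := leP x y; first by apply.
  by move=> H'; apply/esym/H'.
move=> /andP[a0 a1] /andP[b0 b1]; rewrite (@in_window_piece i x); last by lra.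
rewrite (@in_window_piece i y); last by lra.
have [l [l0 h1 h2 _]] := forwardP i => /(dotr_planar l0) e.
move: xy; rewrite le_eqVlt => /orP[/eqP //|xy].
by have := ray_increasing u0 xy h1 h2; rewrite e ltxx.
Qed.

Lemma next_window (i : int) x y : in_window i x -> in_window (i + 1) y ->
  ~ planar (g x) (g y).
Proof.
have i1 : (i + 1)%:~R = i%:~R + 1 :> R by rewrite intrD.
move=> /andP[a0 a1] /andP[]; rewrite i1 => b0 b1.
rewrite (@in_window_piece i x); last by lra.
rewrite (@in_window_piece (i + 1) y); last by rewrite i1; lra.
have [l [l0 h1 h2 h3]] := forwardP i => /(dotr_planar l0) e.
(* The form increases up to the junction at [i + 1/2], where the two pieces agree, and then beyond
   it. *)
have xm : x < i%:~R + 1 / 2 by lra.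
have my : i%:~R + 1 / 2 <= y by lra.
have := ray_increasing u0 xm h1 h2.
have -> : corner_piece u F i (i%:~R + 1 / 2) = corner_piece u F (i + 1) (i%:~R + 1 / 2).
  by rewrite -!in_window_piece // ?i1; lra.
rewrite e; move: my; rewrite le_eqVlt => /orP[/eqP ->|my]; first by rewrite ltxx.
have := @ray_increasing _ _ F u0 l (i + 1) _ _ my; rewrite addrK => /(_ h2 h3) => h4.
by move=> /(lt_trans h4); rewrite ltxx.
Qed.

Definition joined (a b : nat) : Prop := (a, b) \in cr \/ (b, a) \in cr.

Lemma planar_sym (v w : V) : planar v w -> planar w v.
Proof. by case=> e0 e1; split. Qed.

Lemma planar_trans (v w z : V) : planar v w -> planar w z -> planar v z.
Proof. by case=> e0 e1 [e2 e3]; split; [rewrite e0 | rewrite e1]. Qed.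

Lemma planar_windows (a b : nat) x y : (a < n)%N -> (b < n)%N -> in_window a x ->
  in_window b y -> planar (g x) (g y) -> x = y \/ joined a b.
Proof.
wlog ab : a b x y / (a <= b)%N.
  move=> H an bn ax bY p; have [/H|/ltnW /H] := leqP a b; first exact.
  by move=> /(_ y x bn an bY ax (planar_sym p))[->|[]]; [left | right; right | right; left].
move=> an bn ax bY p; move: ab; rewrite leq_eqVlt => /orP[/eqP e|ab].
  by left; move: bY; rewrite -e => bY; exact: same_window ax bY p.
have /and4P[_ + _ _] := ok => /(pairs_allP (0%N, w0)) /(_ a b).
rewrite size_zip size_iota sw minnn ab bn => /(_ isT).
rewrite !nth_zip ?size_iota // !nth_iota // !add0n !nth_ws // /far_ok.
case: ifP => [/eqP /= e _|_].
  by case: (next_window ax (_ : in_window (Posz a + 1) y) p); rewrite -PoszD addn1 -e.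
case: ifP => [+ _|_].
  rewrite lazy_hasP => /hasP[[i j] ij /=]; case: ifP => // /eqP ei /eqP ej.
  by right; left; rewrite -ei -ej.
case: ifP => [/andP[/eqP /= ea /eqP /= eb] _|_ /= ap].
  (* The last window precedes the first one: shifted by a period it becomes the window -1. *)
  have ya : in_window (- 1) (y - n%:R).
    move: bY; rewrite /in_window eb.
    have -> : (n.-1%:Z)%:~R = n%:R - 1 :> R by rewrite -[_%:~R]/(n.-1%:R) -subn1 natrB.
    by rewrite -[(-1)%:~R]/(-1 : R) opprK => /andP[h1 h2]; apply/andP; split; lra.
  have gy : g (y - n%:R) = g y by rewrite -[in RHS](subrK n%:R y) rounded_periodic.
  case: (@next_window (-1) (y - n%:R) x ya); first by move: ax; rewrite ea.
  by rewrite gy; exact: planar_sym.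
case: (apart_planar u0 ap _ _ (_ : planar (corner_piece u F a x) (corner_piece u F b y))).
- by case/andP: ax => h1 h2; apply/andP; split=> //; exact: ltW.
- by case/andP: bY => h1 h2; apply/andP; split=> //; exact: ltW.
by rewrite -!in_window_piece //; [case/andP: bY|case/andP: ax] => h1 h2; apply/andP; split; lra.
Qed.

Let meeting (ij : nat * nat) : zpt := meet (wd ij.1) (wd ij.2).
Definition position1 (ij : nat * nat) : R :=
  ij.1%:R + zr R (meeting ij).1.1 / zr R (meeting ij).2.
Definition position2 (ij : nat * nat) : R :=
  ij.2%:R + zr R (meeting ij).1.2 / zr R (meeting ij).2.

Lemma cr_ok ij : ij \in cr -> [/\ (ij.1 < ij.2)%N, (ij.2 < n)%N &
  cross_ok (wd ij.1) (wd ij.2)].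
Proof.
have /and4P[_ _ + _] := ok; rewrite lazy_allP => /allP H /H /and3P[h1 h2].
by rewrite !nth_ws // ?(ltn_trans h1).
Qed.

Lemma cr_lt ij : ij \in cr -> (ij.1 < n)%N /\ (ij.2 < n)%N.
Proof. by move=> /cr_ok[h1 h2 _]; split=> //; exact: ltn_trans h1 h2. Qed.

Lemma cr_straight ij : ij \in cr -> straight (wd ij.1) /\ straight (wd ij.2).
Proof.
move=> /cr_ok[_ _]; rewrite /cross_ok; case: (meet _ _) => [[a b] d].
by move=> /and5P[h1 h2 _ _ _].
Qed.

Lemma cr_half ij : ij \in cr -> [/\ zr R (meeting ij).2 != 0,
  `|zr R (meeting ij).1.1 / zr R (meeting ij).2| < 1 / 2 &
  `|zr R (meeting ij).1.2 / zr R (meeting ij).2| < 1 / 2].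
Proof.
move=> /cr_ok[_ _]; rewrite /cross_ok /meeting; case: (meet _ _) => [[a b] d].
move=> /and5P[_ _]; cbv iota beta delta [fst snd]; rewrite !(zr_lt R) !zrM !zr_abs => ha hb _.
have z2 : zr R 2 = 2 by rewrite /zr.
move: ha hb; rewrite z2 => ha hb; have d0 : 0 < `|zr R d|.
  by apply: le_lt_trans ha; rewrite mulr_ge0.
by split; [rewrite -normr_gt0 | |]; rewrite // normrM normfV ltr_pdivrMr //; lra.
Qed.

Lemma position_window ij : ij \in cr ->
  in_window ij.1 (position1 ij) /\ in_window ij.2 (position2 ij).
Proof.
move=> /cr_half[_]; rewrite !ltr_norml /in_window /position1 /position2 => /andP[h1 h2] /andP[h3 h4].
by split; rewrite -[(Posz _)%:~R]/(_%:R : R) addrC addKr; apply/andP; split; lra.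
Qed.

Lemma positionP ij x y : ij \in cr -> in_window ij.1 x -> in_window ij.2 y ->
  planar (g x) (g y) <-> x = position1 ij /\ y = position2 ij.
Proof.
move=> c /andP[x0 x1] /andP[y0 y1]; have [s1 s2] := cr_straight c.
have [d0 _ _] := cr_half c.
rewrite (@in_window_piece ij.1 x); last by apply/andP; split; lra.
rewrite (@in_window_piece ij.2 y); last by apply/andP; split; lra.
rewrite (meet_planar u0 x y s1 s2 d0) -/(meeting ij) /position1 /position2.
rewrite -![(Posz _)%:~R]/(_%:R : R); split; first by move=> [<- <-]; split; lra.
by move=> [-> ->]; split; lra.
Qed.

Lemma position_planar ij : ij \in cr -> planar (g (position1 ij)) (g (position2 ij)).
Proof. by move=> c; have [w1 w2] := position_window c; apply/(positionP c w1 w2). Qed.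

Lemma rep_time (a : nat) x : (a < n)%N -> in_window a x -> rep (x * h) a x.
Proof.
by move=> an ax; split=> //; exists 0; rewrite mulr0z addr0 mulfK // gt_eqF.
Qed.

Lemma cr_uniq : uniq (unzip1 cr ++ unzip2 cr).
Proof. by have /and4P[] := ok. Qed.

Lemma cr_inj ij kl : ij \in cr -> kl \in cr ->
  [/\ ij.1 = kl.1 -> ij = kl, ij.2 = kl.2 -> ij = kl & ij.1 != kl.2].
Proof.
move=> ci ck; have := cr_uniq; rewrite cat_uniq => /and3P[u1 dj u2].
split.
- by move=> e; apply: (uniq_map_inj u1).
- by move=> e; apply: (uniq_map_inj u2).
apply: contra dj => /eqP e; apply/hasP; exists kl.2; first exact: map_f.
by rewrite -e; exact: map_f.
Qed.

(** By [cr_uniq] a window occurs in only one crossing and on only one side of it. This is what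
    excludes triple points in [rounded_regular]. *)
Lemma joined_uniq a b c : joined a b -> joined b c -> a = c.
Proof.
case=> h1 [] h2; have [e1 e2 e3] := cr_inj h1 h2; have [_ _ e4] := cr_inj h2 h1.
- by move: e4; rewrite /= eqxx.
- by have [] := e2 erefl.
- by have [] := e1 erefl.
- by move: e3; rewrite /= eqxx.
Qed.

Lemma shadowE s t a b x y : rep s a x -> rep t b y ->
  shadow K s = shadow K t <-> planar (g x) (g y).
Proof.
move=> rs rt; rewrite -(repE rs) -(repE rt); split=> [/rowP e|[e0 e1]].
  have := e 0; have := e 1; rewrite !mxE => e1 e0; split.
    by move: e0; congr (K _ _ _ = K _ _ _); exact/val_inj.
  by move: e1; congr (K _ _ _ = K _ _ _); exact/val_inj.
apply/rowP => k; rewrite !mxE; case: k => [[|[|//]] k].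
  by move: e0; congr (K _ _ _ = K _ _ _); exact/val_inj.
by move: e1; congr (K _ _ _ = K _ _ _); exact/val_inj.
Qed.

Lemma crossing_joined s t a b x y : rep s a x -> rep t b y -> crossing K s t -> joined a b.
Proof.
move=> rs rt [ns /(shadowE rs rt) p]; case: (rs) (rt) => an wa _ [bn wb _].
by case: (planar_windows an bn wa wb p) => // /(rep_same rs rt).
Qed.

Definition point (ij : nat * nat) : 'rV[R]_2 := shadow K (position1 ij * h).

Lemma rep_position ij : ij \in cr ->
  rep (position1 ij * h) ij.1 (position1 ij) /\ rep (position2 ij * h) ij.2 (position2 ij).
Proof.
move=> c; have [w1 w2] := position_window c; have [l1 l2] := cr_lt c.
by split; exact: rep_time.
Qed.

Lemma crossing_position ij : ij \in cr -> crossing K (position1 ij * h) (position2 ij * h).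
Proof.
move=> c; have [r1 r2] := rep_position c; split; last first.
  by apply/(shadowE r1 r2)/position_planar.
move=> /(rep_same r1 r2) e; have [w1 w2] := position_window c.
have [lt _ _] := cr_ok c; move: w2; rewrite -e => /(in_window_uniq w1) e'.
by rewrite e' ltnn in lt.
Qed.

Lemma crossing_points_rounded : crossing_points K = [set P | P \in map point cr].
Proof.
apply/seteqP; split=> P /=; last first.
  move=> /mapP[ij c ->]; exists (position1 ij * h), (position2 ij * h); split=> //.
  exact: crossing_position.
move=> [s [t [st <-]]]; have [a [x rs]] := rep_exists s; have [b [y rt]] := rep_exists t.
have [ns e] := st; have p := (shadowE rs rt).1 e; have [_ wa _] := rs; have [_ wb _] := rt.
case: (crossing_joined rs rt st) => c; apply/mapP.
  exists (a, b) => //; have [xe _] := (positionP c wa wb).1 p.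
  have [r1 _] := rep_position c; apply/(shadowE rs r1); rewrite -xe; by split.
exists (b, a) => //; have [xe _] := (positionP c wb wa).1 (planar_sym p).
have [r1 _] := rep_position c; rewrite e; apply/(shadowE rt r1); rewrite -xe; by split.
Qed.

Lemma point_uniq : uniq (map point cr).
Proof.
have /andP[u1 _] : uniq (unzip1 cr) && true.
  by have := cr_uniq; rewrite cat_uniq => /and3P[->].
rewrite map_inj_in_uniq ?(map_uniq u1) // => ij kl ci ck e.
have [r1 _] := rep_position ci; have [r2 _] := rep_position ck.
have p := (shadowE r1 r2).1 e; have [l1 l2] := cr_lt ci; have [l3 _] := cr_lt ck.
have [w1 _] := position_window ci; have [w2 _] := position_window ck.
have [e1 _ e2] := cr_inj ci ck; have [_ _ e3] := cr_inj ck ci.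
case: (planar_windows l1 l3 w1 w2 p) => [xy|[c|c]].
- by apply: e1; move: w2; rewrite -xy; exact: in_window_uniq w1.
- have [e4 _ _] := cr_inj ci c; have [_ _ e5] := cr_inj ck ci.
  by move: e5; rewrite (e4 erefl) /= eqxx.
have [e4 _ _] := cr_inj ck c; have [_ _ e5] := cr_inj ci ck.
by move: e5; rewrite (e4 erefl) /= eqxx.
Qed.

Lemma coord_derive (k : 'I_3) t :
  derive1 (Defs.coord K k) t = corner_velocity u h F (window h t) k t.
Proof.
rewrite derive1E (_ : Defs.coord K k = (fun t => g (t / h) 0 k)); last first.
  by apply/funext => s; rewrite /Defs.coord KE.
exact: (@derive_val _ _ _ _ _ _ _ (rounded_derive u h0 F0 t k)).
Qed.

Lemma straight_derive (a : nat) x t (k : 'I_3) : rep t a x -> straight (wd a) ->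
  derive1 (Defs.coord K k) t = h^-1 * zvec u (edge_vec F a) 0 k.
Proof.
move=> rt st; rewrite coord_derive; have [an wa [m e]] := rt.
have em : window h t = a%:Z + n%:Z * m.
  apply: floor_def; move: wa; rewrite /in_window e !intrD intrM -[(Posz n)%:~R]/(n%:R).
  by rewrite mulrzr -[1%:~R]/(1 : R) => /andP[h1 h2]; apply/andP; split; lra.
move: (window_dataP em); rewrite /corner_velocity /turn => -[_ -> ->].
have [_ ->] := straight_piece u 0 st.
by rewrite zvecB subrr mxE !mul0r addr0.
Qed.

Lemma velocity_cr ij s t x y : ij \in cr -> rep s ij.1 x -> rep t ij.2 y ->
  velocity_det K s t = (h^-1 * u) ^+ 2 * zr R (meeting ij).2.
Proof.
move=> c rs rt; have [s1 s2] := cr_straight c; rewrite /velocity_det.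
rewrite !(straight_derive _ rs s1) !(straight_derive _ rt s2) /meeting /meet /window_data.
have [_ ->] := straight_piece u 0 s1; have [_ ->] := straight_piece u 0 s2.
have [-> -> _] := zvecE u (edge_vec F ij.1); have [-> -> _] := zvecE u (edge_vec F ij.2).
case: (edge_vec F ij.1) => [[p q] z]; case: (edge_vec F ij.2) => [[p' q'] z'].
by rewrite /det2 zrB !zrM /=; ring.
Qed.

Lemma rounded_regular : regular_diagram K.
Proof.
split.
- move=> t; rewrite !coord_derive; set i := window h t.
  have [l [l0 h1 h2 _]] := forwardP i.
  exact: corner_velocity_neq0 u0 h0 l0 h1 h2.
- move=> s t st; have [a [x rs]] := rep_exists s; have [b [y rt]] := rep_exists t.
  have h2 : (h^-1 * u) ^+ 2 != 0 by rewrite expf_neq0 // mulf_neq0 ?invr_eq0 ?gt_eqF.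
  case: (crossing_joined rs rt st) => c.
    by rewrite (velocity_cr c rs rt) mulf_neq0 //; have [] := cr_half c.
  have -> : velocity_det K s t = - velocity_det K t s by rewrite /velocity_det; ring.
  by rewrite oppr_eq0 (velocity_cr c rt rs) mulf_neq0 //; have [] := cr_half c.
- move=> s t v st tv; have [a [x rs]] := rep_exists s; have [b [y rt]] := rep_exists t.
  have [c [z rv]] := rep_exists v; have e := joined_uniq (crossing_joined rs rt st)
    (crossing_joined rt rv tv); rewrite -e in rv.
  apply/(rep_same rs rv); have [_ wa _] := rs; have [_ wc _] := rv.
  apply: same_window wa wc _; apply: (planar_trans (w := g y)).
    by apply/(shadowE rs rt); case: st.
  by apply/(shadowE rt rv); case: tv.
by rewrite crossing_points_rounded; exact: finite_seq.
Qed.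

Hypothesis r0 : (0 <? r)%bz.

Let rho : R := u * zr R r.
Let rho0 : 0 < rho.
Proof. by rewrite mulr_gt0 //; move: r0; rewrite (zr_lt R) zr0. Qed.

Definition disk_map (c : zpt) (w : 'rV[R]_2) : 'rV[R]_2 :=
  \row_k (u * zr R (if k == 0 then c.1.1 else c.1.2) + rho * w 0 k).

Lemma disk_mapK c w : (disk_map c w 0 0 - u * zr R c.1.1) ^+ 2 +
  (disk_map c w 0 1 - u * zr R c.1.2) ^+ 2 = rho ^+ 2 * (w 0 0 ^+ 2 + w 0 1 ^+ 2).
Proof. by rewrite !mxE /=; ring. Qed.

Lemma disk_map_onto c (P : 'rV[R]_2) : exists w, disk_map c w = P.
Proof.
exists (\row_k ((P 0 k - u * zr R (if k == 0 then c.1.1 else c.1.2)) / rho)).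
by apply/rowP => k; rewrite !mxE [rho * _]mulrC (divfK (lt0r_neq0 rho0)) addrC subrK.
Qed.

Lemma disk_map_inj c : injective (disk_map c).
Proof.
move=> v w /rowP e; apply/rowP => k; have := e k; rewrite !mxE => /addrI.
by move/(mulfI (lt0r_neq0 rho0)).
Qed.

Lemma disk_image t a x c : rep t a x ->
  ((disk_map c @` @closed_disk R) (shadow K t) <-> disk_fun u r c (g x) <= 0) /\
  ((disk_map c @` @open_disk R) (shadow K t) <-> disk_fun u r c (g x) < 0).
Proof.
move=> rt; have [w e] := disk_map_onto c (shadow K t).
have Dw : disk_fun u r c (g x) = rho ^+ 2 * (w 0 0 ^+ 2 + w 0 1 ^+ 2 - 1).
  rewrite mulrBr mulr1 -(disk_mapK c) e /disk_fun -/rho -(repE rt) !mxE.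
  congr (_ - _); congr ((_ - _) ^+ 2 + (_ - _) ^+ 2); congr (K _ _ _); exact/val_inj.
have r2 : 0 < rho ^+ 2 by rewrite exprn_gt0.
rewrite Dw pmulr_rle0 // pmulr_rlt0 // subr_le0 subr_lt0; split; split.
- by move=> [w' h' e']; rewrite -(disk_map_inj (etrans e' (esym e))).
- by move=> h'; exists w.
- by move=> [w' h' e']; rewrite -(disk_map_inj (etrans e' (esym e))).
by move=> h'; exists w.
Qed.

Lemma disk_map_continuous c : {within @closed_disk R, continuous (disk_map c)}.
Proof.
have -> : disk_map c = (fun w => disk_map c 0 + rho *: w).
  by apply/funext => z; apply/rowP => k; rewrite !mxE mulr0 addr0.
apply: continuous_subspaceT => w.
have h1 : {for w, continuous (fun z : 'rV[R]_2 => rho *: z)} by exact: scaler_continuous.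
have h2 : {for w, continuous (fun z : 'rV[R]_2 => disk_map c 0)} by exact: cst_continuous.
exact: (continuousD h2 h1).
Qed.

Lemma window_lt (k l : nat) x y : in_window k x -> in_window l y -> (k < l)%N -> x < y.
Proof.
move=> /andP[k0 k1] /andP[l0 l1] kl; have : (k.+1%:R <= l%:R :> R) by rewrite ler_nat.
rewrite -[k.+1%:R]natr1; move: k0 k1 l0 l1.
by rewrite -![(Posz _)%:~R]/(_%:R : R) => k0 k1 l0 l1; lra.
Qed.

Let half_closed (i : int) x : in_window i x -> - (1 / 2) <= x - i%:~R <= 1 / 2.
Proof. by move=> /andP[-> /ltW ->]. Qed.

Let in_open (i : int) x : - (1 / 2) < x - i%:~R < 1 / 2 -> in_window i x.
Proof. by move=> /andP[/ltW h1 h2]; rewrite /in_window h1. Qed.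

Let pieceE (i : int) x : in_window i x -> g x = corner_piece u F i x.
Proof. by move=> /andP[h1 h2]; apply: in_window_piece; apply/andP; split; lra. Qed.

Lemma strand_disk c i : (i.+3 < n)%N -> strand_ok ws r c i -> exists a b,
  [/\ in_window i a, in_window i.+3 b & forall k x, (i <= k <= i.+3)%N -> in_window k x ->
    (disk_fun u r c (g x) <= 0) = (a <= x <= b) /\ (disk_fun u r c (g x) < 0) = (a < x < b)].
Proof.
move=> i3 /and4P[]; rewrite !nth_ws //; try lia.
move=> /(enters_piece u0)[a /in_open wa ha] i1 i2 /(leaves_piece u0)[b /in_open wb hb].
exists a, b; split=> // k x /andP[ik ki] wx; have hx := half_closed wx.
have [ek|[ek|[ek|ek]]] : k = i \/ k = i.+1 \/ k = i.+2 \/ k = i.+3 by lia.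
- have xb : x < b by apply: window_lt wx wb _; rewrite ek; have [] := succ3 i.
  have := ha x; rewrite -ek => /(_ hx); rewrite -(pieceE wx) => -[-> ->].
  by rewrite xb (ltW xb) !andbT.
- have xb : x < b by apply: window_lt wx wb _; rewrite ek; have [] := succ3 i.
  have ax : a < x by apply: window_lt wa wx _; rewrite ek; have [] := succ3 i.
  have := inside_piece u0 i1; rewrite -ek => /(_ _ hx); rewrite -(pieceE wx) => d0.
  by rewrite d0 (ltW d0) xb ax !ltW.
- have xb : x < b by apply: window_lt wx wb _; rewrite ek; have [] := succ3 i.
  have ax : a < x by apply: window_lt wa wx _; rewrite ek; have [] := succ3 i.
  have := inside_piece u0 i2; rewrite -ek => /(_ _ hx); rewrite -(pieceE wx) => d0.
  by rewrite d0 (ltW d0) xb ax !ltW.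
have ax : a < x by apply: window_lt wa wx _; rewrite ek; have [] := succ3 i.
have := hb x; rewrite -ek => /(_ hx); rewrite -(pieceE wx) => -[-> ->].
by rewrite ax (ltW ax).
Qed.

Lemma disk_position c ij : ij \in cr -> crossing_inside ws r c ij ->
  disk_fun u r c (g (position1 ij)) < 0.
Proof.
move=> cij; have [w1 _] := position_window cij; have [l1 l2] := cr_lt cij.
have [s1 s2] := cr_straight cij; have [d0 _ _] := cr_half cij.
rewrite /crossing_inside !nth_ws // -/(meeting ij) (pieceE w1).
have [-> e1] := straight_piece u (position1 ij) s1.
rewrite /position1 -[(Posz _)%:~R]/(_%:R : R) [X in X *: _]addrC addKr.
rewrite /window_data e1 /disk_fun; move: d0; case: (meeting ij) => [[a b] d] d0.
cbv beta iota delta [fst snd]; rewrite (zr_lt R); move: d0.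
case: (vertex F ij.1) => [[p q] z]; case: (edge_vec F ij.1) => [[e e'] e'']; case: c => [[c c'] c''].
rewrite /lin2 /sqn2 !(zrD, zrM) !mxE /=.
have -> : zr R 1 = 1 by rewrite /zr.
have -> : zr R (-1) = -1 by rewrite /zr.
move: (zr R a) (zr R d) (zr R p) (zr R q) (zr R e) (zr R e') (zr R c) (zr R c').
move=> A D P Q E E' C C' /= D0 lt.
have k0 : 0 < u ^+ 2 / D ^+ 2.
  by apply: divr_gt0; rewrite exprn_even_gt0 //= ?D0 ?gt_eqF.
have -> : (u * P + A / D * (u * E) - u * C) ^+ 2 + (u * Q + A / D * (u * E') - u * C') ^+ 2 -
    (u * zr R r) ^+ 2 = u ^+ 2 / D ^+ 2 * ((D * (1 * P + -1 * C) + A * E) * (D * (1 * P + -1 * C) + A * E)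
    + (D * (1 * Q + -1 * C') + A * E') * (D * (1 * Q + -1 * C') + A * E') - D * D * (zr R r * zr R r)).
  by field.
by rewrite pmulr_rlt0 // subr_lt0.
Qed.

Lemma sg_perturb (Z w : R) : `|w| < `|Z| -> Num.sg (u * (Z + w)) = Num.sg Z.
Proof.
rewrite sgrM (gtr0_sg u0) mul1r; have [Z0|Z0|->] := ltgtP Z 0.
- rewrite (ltr0_norm Z0) ltr_norml => /andP[h1 h2].
  by rewrite (ltr0_sg Z0) ltr0_sg //; lra.
- rewrite (gtr0_norm Z0) ltr_norml => /andP[h1 h2].
  by rewrite (gtr0_sg Z0) gtr0_sg //; lra.
by rewrite normr0 ltNge normr_ge0.
Qed.

(** Within half a unit of the vertices the difference of heights keeps its sign, by the last test of
    [cross_ok]; so the sign is read off the vertices and the edges. *)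
Lemma crossing_sign_cr ij : ij \in cr ->
  crossing_sign K (position1 ij * h) (position2 ij * h) = Num.sg (zr R (handedness ws ij)).
Proof.
move=> c; have [r1 r2] := rep_position c; have [w1 w2] := position_window c.
have [s1 s2] := cr_straight c; have [l1 l2] := cr_lt c; have [d0 ha hb] := cr_half c.
have kk : 0 < (h^-1 * u) ^+ 2 by rewrite exprn_gt0 // mulr_gt0 ?invr_gt0.
rewrite /crossing_sign (velocity_cr c r1 r2) sgrM [Num.sg (_ * zr R _)]sgrM (gtr0_sg kk) mul1r.
rewrite /handedness !nth_ws // zrM sgrM; congr (_ * _).
rewrite /height /Defs.coord (repE r1) (repE r2) (pieceE w1) (pieceE w2).
have [-> e1] := straight_piece u (position1 ij) s1.
have [-> e2] := straight_piece u (position2 ij) s2.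
rewrite /position1 /position2 -![(Posz _)%:~R]/(_%:R : R) ![_%:R + _ - _]addrC !addKr.
have [_ _ hz] := cr_ok c; move: hz; rewrite /cross_ok /window_data e1 e2.
case: (meet _ _) => [[? ?] ?] /and5P[_ _ _ _] hz.
have {hz} : zr R (Z.abs (edge_vec F ij.1).2 + Z.abs (edge_vec F ij.2).2)%bz <
    zr R (2 * Z.abs ((vertex F ij.1).2 - (vertex F ij.2).2))%bz by rewrite -zr_lt.
rewrite zrD zrM !zr_abs !(zrB _ (vertex F ij.1).2).
have -> : zr R 2 = 2 by rewrite /zr.
move=> hz; rewrite !mxE.
have [_ _ ->] := zvecE u (vertex F ij.1); have [_ _ ->] := zvecE u (vertex F ij.2).
have [_ _ ->] := zvecE u (edge_vec F ij.1); have [_ _ ->] := zvecE u (edge_vec F ij.2).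
move: ha hb hz; move: (zr R (meeting ij).1.1 / zr R (meeting ij).2).
move=> A; move: (zr R (meeting ij).1.2 / zr R (meeting ij).2) => B.
move: (zr R (vertex F ij.1).2) (zr R (vertex F ij.2).2) => Z1 Z2.
move: (zr R (edge_vec F ij.1).2) (zr R (edge_vec F ij.2).2) => E1 E2 hA hB hz.
rewrite -(sg_perturb (Z := Z1 - Z2) (w := A * E1 - B * E2)); first by congr Num.sg; ring.
apply: le_lt_trans (ler_normB _ _) _; rewrite !normrM.
have := ler_wpM2r (normr_ge0 E1) (ltW hA); have := ler_wpM2r (normr_ge0 E2) (ltW hB).
by lra.
Qed.

Lemma clasp_crossings_cr i j c : (i, j, c) \in xs ->
  (i, j.+3) \in cr /\ (i.+3, j) \in cr.
Proof.
move=> x; have : clasp_crossings (i, j, c) \in PQ by apply: map_f.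
by move=> p; split; rewrite mem_cat; apply/orP; [left | right]; apply: (map_f _ p).
Qed.

Lemma span_lt (a d N : R) :
  - (1 / 2) <= a < N - 1 / 2 -> - (1 / 2) <= d < N - 1 / 2 -> d < a + N.
Proof. by move=> /andP[a0 a1] /andP[d0 d1]; lra. Qed.

(** In [matched_pair] the period starts at the entry [a] of the first strand, whereas
    representatives start at -1/2: the two differ by at most one period. *)
Lemma span_shift (a y N : R) (m : int) : 0 < N ->
    - (1 / 2) <= a < N - 1 / 2 -> - (1 / 2) <= y < N - 1 / 2 ->
    a <= y + N * m%:~R -> y + N * m%:~R < a + N ->
  m = 0 \/ m = 1.
Proof.
move=> N0 /andP[a0 a1] /andP[y0 y1] ta td.
have m2 : m%:~R < 2 :> R by rewrite -(ltr_pM2l N0); lra.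
have m1 : -1 < m%:~R :> R by rewrite -(ltr_pM2l N0); lra.
by move: m1 m2; rewrite -[-1]/((-1)%:~R) -[2]/(2%:~R) !ltr_int; clear; lia.
Qed.

Lemma rounded_matched i j c : (i, j, c) \in xs -> clasp_ok n ws r cr (i, j, c) ->
  matched_pair K (point (i, j.+3)) (point (i.+3, j)).
Proof.
move=> x /and5P[/and4P[ij jn si sj] out /andP[inP inQ] hand others].
have [cP cQ] := clasp_crossings_cr x.
have i3 := lt3_trans ij jn.
have [ii ii3] := le3 i; have [jj jj3] := le3 j.
have [a [b [wa wb hab]]] := strand_disk i3 si; have [c' [d [wc wd' hcd]]] := strand_disk jn sj.
set P := (i, j.+3) in cP inP hand others *; set Q := (i.+3, j) in cQ inQ hand others *.
have [wP1 wP2] := position_window cP; have [wQ1 wQ2] := position_window cQ.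
have [lP1 lP2] := cr_lt cP; have [lQ1 lQ2] := cr_lt cQ.
have dP1 := disk_position cP inP; have dQ1 := disk_position cQ inQ.
have dE ij' : ij' \in cr ->
    disk_fun u r c (g (position2 ij')) = disk_fun u r c (g (position1 ij')).
  by move=> /position_planar[e0 e1]; rewrite /disk_fun e0 e1.
have [aP Pb] : a < position1 P /\ position1 P < b.
  have [_] := hab i _ ii wP1.
  by rewrite dP1 => /esym/andP.
have [aQ Qb] : a < position1 Q /\ position1 Q < b.
  have [_] := hab i.+3 _ ii3 wQ1.
  by rewrite dQ1 => /esym/andP.
have [cP' Pd] : c' < position2 P /\ position2 P < d.
  have [_] := hcd j.+3 _ jj3 wP2.
  by rewrite dE // dP1 => /esym/andP.
have [cQ' Qd] : c' < position2 Q /\ position2 Q < d.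
  have [_] := hcd j _ jj wQ2.
  by rewrite dE // dQ1 => /esym/andP.
have bc : b < c' by apply: window_lt wb wc ij.
have PQ1 : position1 P < position1 Q by apply: window_lt wP1 wQ1 _; have [] := succ3 i.
have QP2 : position2 Q < position2 P by apply: window_lt wQ2 wP2 _; have [] := succ3 j.
have core k y : (k < n)%N -> in_window k y ->
    ((disk_fun u r c (g y) <= 0) <-> a <= y <= b \/ c' <= y <= d) /\
    ((disk_fun u r c (g y) < 0) <-> a < y < b \/ c' < y < d).
  move=> kn wy; have [hi|hi] := boolP (i <= k <= i.+3)%N.
    have [-> ->] := hab k y hi wy.
    have yc : y < c' by apply: window_lt wy wc _; case/andP: hi => _ h2; exact: leq_ltn_trans h2 ij.
    split; split; [by left | case=> // /andP[h1 _] | by left | case=> // /andP[h1 _]].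
      by have := lt_le_trans yc h1; rewrite ltxx.
    by have := lt_trans yc h1; rewrite ltxx.
  have [hj|hj] := boolP (j <= k <= j.+3)%N.
    have [-> ->] := hcd k y hj wy.
    have by_ : b < y by apply: window_lt wb wy _; case/andP: hj => h1 _; exact: leq_trans ij h1.
    split; split; [by right | case=> // /andP[_ h1] | by right | case=> // /andP[_ h1]].
      by have := lt_le_trans by_ h1; rewrite ltxx.
    by have := lt_trans by_ h1; rewrite ltxx.
  have D0 : 0 < disk_fun u r c (g y).
    move: out; rewrite lazy_allP => /(all_nthP (0%N, w0)) /(_ k).
    rewrite size_zip size_iota sw minnn nth_zip ?size_iota // nth_iota // add0n nth_ws //.
    cbv beta iota zeta delta [fst snd].
    have -> : (if (i <= k)%N then (k <= i.+3)%N else false) = false.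
      by move: hi; case: (i <= k)%N => //= /negbTE.
    have -> : (if (j <= k)%N then (k <= j.+3)%N else false) = false.
      by move: hj; case: (j <= k)%N => //= /negbTE.
    move=> /(_ kn) /(outside_piece u0) /(_ (half_closed wy)).
    by rewrite -(pieceE wy).
  have ny1 : ~ (a <= y <= b).
    move=> /andP[h1 h2]; move: hi; rewrite negb_and -!ltnNge => /orP[hk|hk].
      by have := window_lt wy wa hk; rewrite ltNge h1.
    by have := window_lt wb wy hk; rewrite ltNge h2.
  have ny2 : ~ (c' <= y <= d).
    move=> /andP[h1 h2]; move: hj; rewrite negb_and -!ltnNge => /orP[hk|hk].
      by have := window_lt wy wc hk; rewrite ltNge h1.
    by have := window_lt wd' wy hk; rewrite ltNge h2.
  have ltw (p q : R) : p < y < q -> p <= y <= q by move=> /andP[/ltW -> /ltW ->].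
  split; split; rewrite ?[_ <= 0]leNgt ?[_ < 0]ltNge ?D0 ?(ltW D0) //.
    by case=> [/ny1|/ny2].
  by case=> /ltw; [move/ny1 | move/ny2].
have lt_h (p q : R) : (p * h < q * h) = (p < q) by rewrite ltr_pM2r.
have le_h (p q : R) : (p * h <= q * h) = (p <= q) by rewrite ler_pM2r.
have an : (i < n)%N by apply: leq_ltn_trans i3; case/andP: ii.
have wa0 := rep_window (rep_time an wa); have wd0 := rep_window (rep_time jn wd').
have ad := span_lt wa0 wd0.
have e2pi p : p * h + pi *+ 2 = (p + n%:R) * h by rewrite -hn mulrDl (mulrC h).
exists (disk_map c), (a * h), (position1 P * h), (position1 Q * h), (b * h).
exists (c' * h), (position2 Q * h), (position2 P * h), (d * h).
have [_ shP] := crossing_position cP; have [_ shQ] := crossing_position cQ.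
split; rewrite ?e2pi ?lt_h //.
- by split; [exact: disk_map_continuous | move=> v w _ _; exact: disk_map_inj].
- move=> t /andP[ta td]; have [k [y rt]] := rep_exists t; have [kn wy [m em]] := rt.
  have th : t = (y + n%:R * m%:~R) * h by rewrite mulrzr -em divfK ?gt_eqF.
  have [dc dop] := disk_image c rt; have [c1 c2] := core k y kn wy.
  have y01 := rep_window rt.
  move: ta td; rewrite th le_h lt_h => ta td.
  have n0 : 0 < n%:R :> R by rewrite ltr0n.
  have [m0|m0] := span_shift n0 wa0 y01 ta td.
  + have ey : y + n%:R * m%:~R = y by rewrite m0 mulr0 addr0.
    rewrite ey !le_h !lt_h -c1 -c2; move: dc dop; rewrite th ey; by split.
  (* Here [y < a], so that [t] comes after both strands and both sides of each equivalence are
     false. *)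
  have ey : y + n%:R * m%:~R = y + n%:R by rewrite m0 mulr1.
  have ac : a < c' := lt_trans (lt_trans aP Pb) bc.
  have ya : y < a by move: td; rewrite ey ltrD2r.
  have yn := span_lt y01 wd0.
  have bd : b < d by apply: lt_trans bc (lt_trans cQ' Qd).
  move: dc dop; rewrite th ey !le_h !lt_h => dc dop; split.
    split; last by case=> /andP[_ h2];
      [have := lt_trans (le_lt_trans h2 bd) yn | have := le_lt_trans h2 yn]; rewrite ltxx.
    by move=> /dc /c1 [] /andP[h1 _];
      [have := lt_le_trans ya h1 | have := lt_le_trans (lt_trans ya ac) h1]; rewrite ltxx.
  split; last by case=> /andP[_ h2];
    [have := lt_trans (lt_trans h2 bd) yn | have := lt_trans h2 yn]; rewrite ltxx.
  by move=> /dop /c2 [] /andP[h1 _]; [have := lt_trans ya h1 | have := lt_trans (lt_trans ya ac) h1];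
    rewrite ltxx.
- split; first by rewrite -shP -shQ.
  rewrite crossing_points_rounded; apply/seteqP; split=> p /=.
    move=> [/mapP[kl ckl ->] dkl]; have [r1 _] := rep_position ckl.
    have [dc _] := disk_image c r1; move: dkl => /dc dkl.
    move: others; rewrite lazy_allP => /allP /(_ kl ckl) /or3P[/eqP ->|/eqP ->|nc].
    + by left.
    + by right.
    have [w1 _] := position_window ckl; have [l1 _] := cr_lt ckl.
    move: out; rewrite lazy_allP => /(all_nthP (0%N, w0)) /(_ kl.1).
    rewrite size_zip size_iota sw minnn nth_zip ?size_iota // nth_iota // add0n nth_ws //.
    cbv beta iota zeta delta [fst snd] => /(_ l1).
    move: nc; cbv beta iota zeta => /negbTE ->.
    move=> /(outside_piece u0) /(_ (half_closed w1)).
    by rewrite -(pieceE w1) ltNge dkl.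
  have inD ij' : ij' \in cr -> disk_fun u r c (g (position1 ij')) < 0 ->
      (disk_map c @` @closed_disk R) (point ij').
    by move=> c0 neg; have [r1 _] := rep_position c0; apply/(disk_image c r1).1/ltW.
  by case=> ->; split; [apply/map_f | exact: inD | apply/map_f | exact: inD].
rewrite !crossing_sign_cr //; move: hand; rewrite (zr_lt R) zr0 zrM.
move: (zr R (handedness ws P)) (zr R (handedness ws Q)) => X Y.
have [X0|X0|->] := ltgtP X 0; last by rewrite mul0r ltxx.
  by rewrite nmulr_rgt0 // => Y0; rewrite !ltr0_sg.
by rewrite pmulr_rgt0 // => Y0; rewrite !gtr0_sg.
Qed.

Lemma rounded_matched_diagram : all (clasp_ok n ws r cr) xs -> matched_diagram K.
Proof.
move=> /allP xs_ok; split; first exact: rounded_regular.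
exists [seq (point pq.1, point pq.2) | pq <- PQ].
have -> : unzip1 [seq (point pq.1, point pq.2) | pq <- PQ] ++
    unzip2 [seq (point pq.1, point pq.2) | pq <- PQ] = map point cr.
  by rewrite /cr /unzip1 /unzip2 map_cat -!map_comp; congr (_ ++ _); exact: eq_map.
split; [exact: point_uniq | exact: crossing_points_rounded |].
move=> _ /mapP[_ /mapP[[[i j] c] x ->] ->]; exact: rounded_matched x (xs_ok _ x).
Qed.
End RoundedDiagram.


(** * The matched knot and the conclusion *)

Section RoundedKnot.
Variable R : realType.
Notation V := 'rV[R]_3.
Variables (u h : R) (F : seq zpt) (r : Z) (xs : seq clasp).
Hypotheses (u0 : 0 < u) (h0 : 0 < h) (F0 : (0 < size F)%N).
Hypothesis hn : h * (size F)%:R = pi *+ 2.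
Hypotheses (r0 : (0 <? r)%bz) (ok : diagram_ok (size F) (windows F) r xs).

Definition rounded_curve (t : R) : V := rounded u F (t / h).

Hypothesis inj : forall s t, rounded_curve s = rounded_curve t -> same_param s t.

Lemma rounded_curve_periodic t : rounded_curve (t + pi *+ 2) = rounded_curve t.
Proof.
rewrite /rounded_curve -hn mulrDl mulrAC mulfV ?mul1r ?gt_eqF //.
exact: rounded_periodic.
Qed.

Lemma rounded_curve_immersion t : exists i,
  derive1 (fun s => rounded_curve s 0 i) t != 0.
Proof.
have d k : derive1 (fun s => rounded_curve s 0 k) t =
    corner_velocity u h F (window h t) k t.
  by rewrite derive1E; exact: (@derive_val _ _ _ _ _ _ _ (rounded_derive u h0 F0 t k)).
have /andP[ok' _] := ok.
have [l [l0 h1 h2 _]] := forwardP R F0 ok' (window h t).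
case: (corner_velocity_neq0 t u0 h0 l0 h1 h2) => v; [exists 0|exists 1]; by rewrite d.
Qed.

Definition rounded_knot : knot R :=
  Knot rounded_curve_periodic (@rounded_smooth R u h F h0 F0) rounded_curve_immersion inj.

Lemma rounded_knot_matched : matched_diagram rounded_knot.
Proof.
have /andP[ok'] := ok; rewrite lazy_allP => xs_ok.
by apply: (rounded_matched_diagram u0 h0 F0 _ hn ok' _ xs_ok).
Qed.

End RoundedKnot.

Lemma target_size : size target = 96%N.
Proof. by vm_compute. Qed.

Section MatchedCurve.
Variable R : realType.
Notation u := (1 / 80 : R).
Notation h := (mesh R).

Let u0 : 0 < u. Proof. by rewrite divr_gt0. Qed.
Let h0 : 0 < h. Proof. by have [] := mesh_le (frefl (zr R)). Qed.
Let F0 : (0 < size target)%N. Proof. by rewrite target_size. Qed.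
Let hn : h * (size target)%:R = pi *+ 2.
Proof. by rewrite target_size /mesh; field. Qed.

Lemma curve_8_18_isotopic : isotopic (@curve_8_18 R) (rounded_curve u h target).
Proof.
have [f af e] : isotopic (fun x => curve_8_18 (x * h)) (rounded u target).
  apply: isotopic_trans (@knot_8_18_polygon R) _.
  apply: isotopic_trans (_ : isotopic (polygon u target) _).
    rewrite -target_last; apply: (@steps_isotopic _ _ u0 _ deformation).
      by rewrite start_size.
    by rewrite start_size; exact: deformation_ok.
  by apply: (rounded_isotopic u0 F0 _ target_ok); rewrite target_size.
exists f => // t; rewrite /rounded_curve e divfK // gt_eqF //; exact: h0.
Qed.

(** The rounded curve is the image of the injective braid parametrization under a homeomorphism,
    with the same parameter. *)
Let inj s t : rounded_curve u h target s = rounded_curve u h target t -> same_param s t.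
Proof.
have [f [[_ [k [_ fK _]]] _] e] := curve_8_18_isotopic.
by rewrite !e => /(can_inj fK) /curve_8_18_injective.
Qed.

Lemma knot_8_18_equiv_matched :
  exists2 L : knot R, knot_equiv (knot_8_18 R) L & matched_diagram L.
Proof.
exists (rounded_knot u0 h0 F0 hn target_diagram inj); last first.
  exact: (@rounded_knot_matched _ _ _ _ 29 _ u0 h0 F0 hn (erefl true) target_diagram inj).
apply: (@isotopic_knot_equiv _ (knot_8_18 R)
  (rounded_knot u0 h0 F0 hn target_diagram inj)).
exact: curve_8_18_isotopic.
Qed.

End MatchedCurve.

Theorem mainTheorem1 (R : realType) : bipartite (knot_8_18 R).
Proof. by have [L] := knot_8_18_equiv_matched R; exists L. Qed.
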